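(* Let $n\ge 1$, $L\ge 1$, and let $\{\psi^{(\epsilon)}_{j,k}\}$, $\{\tilde\psi^{(\epsilon)}_{j,k}\}$ ($1\le\epsilon\le L$, $j\in\mathbb{Z}$, $k\in\mathbb{Z}^n$) be a pair of band-limited biorthogonal Riesz wavelet bases of $L^2(\mathbb{R}^n)$ with Riesz bounds $A,B$ and with the Fourier transforms of all generators supported in $\{a\le|\xi|\le b\}$, $0<a<b$ (see context). Let $\tau>0$ and $\sigma>2n$, with $\psi^{(\epsilon)}\in M^\tau$ and $\tilde\psi^{(\epsilon)}\in\mathcal{D}_\sigma$ for all $\epsilon$. Let $s>0$, $1<p<\infty$, $0<q<\infty$, and $w\in A_p$. Put $$\theta(p):=\tfrac12\max\{1,(p-1)^{-1}\},\qquad C_0:=\frac{L\,(2L)^{s/n}}{1-2^{-s}}\,C_M\,K_U\,K_L,$$ where $K_U:=\max_{1\le\epsilon\le L}K_U(\psi^{(\epsilon)})$ and $K_L:=\max_{1\le\epsilon\le L}K_L(\tilde\psi^{(\epsilon)})$, with $C_M$, $K_U(\cdot)$, $K_L(\cdot)$ as defined in the context. Then for every $f$ in the localized class $\dot B^s_{p,q}(w;Q_0)$ and every integer $N\ge 1$, $$E_N^{\mathcal{F}}(f)_{L^p_w}\le C_0\,[w]_{A_p}^{2/p}\,N^{-s/n}\,\|f\|_{\dot B^s_{p,q}(w)}\le C_0\,[w]_{A_p}^{2\theta(p)}\,N^{-s/n}\,\|f\|_{\dot B^s_{p,q}(w)}.$$ Moreover, $C_0$ is determined by $n,L,p,s,M$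 and the decay envelopes of the generators $\psi^{(\epsilon)},\tilde\psi^{(\epsilon)}$ through the series $K_U$, $K_L$, and, with $\gamma:=n+n/p'$, $\gamma':=n+n/p$, and $\zeta$ the Riemann zeta function, it has the closed-form majorant $$C_0\le\frac{L(2L)^{s/n}}{1-2^{-s}}\,C_M\,\Bigl[\max_{\epsilon}|\psi^{(\epsilon)}|_{M^\tau}\bigl(1+2\gamma\,3^{\gamma-1}\zeta(1+\tau+n/p)\bigr)\Bigr]\Bigl[2^\sigma K_\Phi\max_{\epsilon}|\tilde\psi^{(\epsilon)}|_{\mathcal{D}_\sigma}\bigl(1+2\gamma'\,3^{\gamma'-1}\zeta(1+\sigma-n-n/p)\bigr)\Bigr],$$ which depends only on $n,L,p,s,M$ and the decay parameters, i.e. on $\tau$, $\max_\epsilon|\psi^{(\epsilon)}|_{M^\tau}$, $\sigma$, $\max_\epsilon|\tilde\psi^{(\epsilon)}|_{\mathcal{D}_\sigma}$, $a$, $b$. Both $C_0$ and this majorant are independent of $N$, $f$, $q$, $w$, $A$, $B$.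
   Context: Conventions. $\hat f(\xi)=\int_{\mathbb{R}^n} f(x)e^{-2\pi i x\cdot\xi}dx$. $|\cdot|$ is the Euclidean norm, $|\cdot|_\infty$ the maximum norm. $\langle f,g\rangle=\int f\,\overline{g}$. $1/p+1/p'=1$. $\mathcal{S}$ denotes Schwartz functions, $\mathcal{S}'$ tempered distributions, $\mathcal{P}$ polynomials on $\mathbb{R}^n$. For a function $h$, $h_{j,k}(x):=2^{jn/2}h(2^jx-k)$ for $j\in\mathbb{Z}$, $k\in\mathbb{Z}^n$. $Q_{j,k}:=2^{-j}(k+[0,1)^n)$, $w(E):=\int_E w$, $\|g\|_{L^p_w}:=(\int|g|^pw)^{1/p}$. Wavelet system. Generators $\psi^{(1)},\dots,\psi^{(L)}$ and dual generators $\tilde\psi^{(1)},\dots,\tilde\psi^{(L)}$ have Fourier transforms in $C_c^\infty(\mathbb{R}^n)$ supported in $\{a\le|\xi|\le b\}$ for fixed $0<a<b$ (band-limited). Each of the systems $\{\psi^{(\epsilon)}_{j,k}\}$, $\{\tilde\psi^{(\epsilon)}_{j,k}\}$ is a Riesz basis of $L^2(\mathbb{R}^n)$: closed linear span $L^2$ and $A\sum|c|^2\le\|\sum c^{(\epsilon)}_{j,k}\psi^{(\epsilon)}_{j,k}\|_{L^2}^2\le B\sum|c|^2$ for finitely supported coefficients (Riesz bounds $A,B>0$), similarly for the dual system; $\langle\psi^{(\epsilon)}_{j,k},\tilde\psi^{(\epsilon')}_{j',k'}\rangle=\delta_{\epsilon,\epsilon'}\delta_{j,j'}\delta_{k,k'}$;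 and every $f\in L^2$ satisfies $f=\sum_{\epsilon,j,k}\langle f,\tilde\psi^{(\epsilon)}_{j,k}\rangle\psi^{(\epsilon)}_{j,k}$ in $L^2$. $\mathcal{F}$ denotes the system $\{\psi^{(\epsilon)}_{j,k}\}$. $N$-term error. $E_N^{\mathcal{F}}(f)_{L^p_w}:=\inf\|f-\sum_{(\epsilon,j,k)\in\Lambda}d^{(\epsilon)}_{j,k}\psi^{(\epsilon)}_{j,k}\|_{L^p_w}$ over all index sets $\Lambda$ with $\#\Lambda\le N$ and all complex coefficients. Weights. A weight is a locally integrable, a.e. positive function on $\mathbb{R}^n$; $w\in A_p$ iff $[w]_{A_p}:=\sup_Q(\frac1{|Q|}\int_Qw)(\frac1{|Q|}\int_Qw^{-1/(p-1)})^{p-1}<\infty$, sup over cubes with sides parallel to the axes. Littlewood–Paley and Besov space. Fix $\varphi\in\mathcal{S}(\mathbb{R}^n)$ with $\hat\varphi$ real-valued, radial, supported in $\{c_1\le|\xi|\le c_2\}$ ($0<c_1<c_2$), $\sum_{j\in\mathbb{Z}}\hat\varphi(2^{-j}\xi)=1$ for $\xi\neq0$; $\varphi_j(x):=2^{jn}\varphi(2^jx)$, $\Delta_jf:=\varphi_j*f$. $\dot B^s_{p,q}(w)$ is the set of $f\in\mathcal{S}'/\mathcal{P}$ with $\|f\|_{\dot B^s_{p,q}(w)}:=(\sum_{j\in\mathbb{Z}}2^{jsq}\|\Delta_jf\|_{L^p_w}^q)^{1/q}<\infty$. Every $f\in L^p_w$ ($w\in A_p$) defines a tempered distribution and has absolutely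 convergent pairings $\langle f,\tilde\psi^{(\epsilon)}_{j,k}\rangle$; $L^p_w\cap\dot B^s_{p,q}(w)$ consists of $f\in L^p_w$ whose class modulo polynomials is in $\dot B^s_{p,q}(w)$. Finite-band quantities. $M:=\lceil\max\{\log_2(b/c_1),\log_2(c_2/a),0\}\rceil$, $C_M:=\sum_{|i|\le M}2^{is}$ ($i$ integer). Localized class. $Q_0:=[0,1)^n$, $\mathcal{D}(Q_0):=\{(j,k):j\ge0,\ Q_{j,k}\subset Q_0\}$. For $f\in L^p_w$, $J\ge0$: $T_Jf:=\sum_{\epsilon=1}^L\sum_{j=0}^J\sum_{k:(j,k)\in\mathcal{D}(Q_0)}\langle f,\tilde\psi^{(\epsilon)}_{j,k}\rangle\psi^{(\epsilon)}_{j,k}$. $\dot B^s_{p,q}(w;Q_0)$ is the set of $f\in L^p_w\cap\dot B^s_{p,q}(w)$ with $T_Jf\to f$ in $L^p_w$ as $J\to\infty$. Decay quantities. $|\psi|_{M^\tau}:=\sup_x(1+|x|)^{2n+\tau}|\psi(x)|$, $\psi\in M^\tau$ iff this is finite; $|\tilde\psi|_{\mathcal{D}_\sigma}:=\int(1+|x|^\sigma)|\tilde\psi(x)|dx$, $\tilde\psi\in\mathcal{D}_\sigma$ iff this is finite. $\Phi\in\mathcal{S}(\mathbb{R}^n)$ is a fixed function, chosen depending only on $n,a,b$, with $\hat\Phi=1$ on $\{a\le|\xi|\le b\}$, and $K_\Phi:=\sup_z(1+|z|)^\sigma|\Phi(z)|$. For a function $h$, its decay envelope is $\beta_0(h):=\sup|h|$,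 $\beta_m(h):=\sup\{|h(z)|:|z|_\infty\ge m-1\}$ for $m\ge1$, and $K_U(h):=\sum_{i\ge0}(\beta_i(h)-\beta_{i+1}(h))(2i+1)^{n+n/p'}$, $K_L(h):=\sum_{i\ge0}(\beta_i(h)-\beta_{i+1}(h))(2i+1)^{n+n/p}$. *)

(* Defs.v *)
From HB Require Import structures.
From mathcomp Require Import all_boot all_order all_algebra.
From mathcomp Require Import finmap.
From mathcomp Require Import all_classical all_reals all_analysis.
From mathcomp Require Import complex.

Set Implicit Arguments.
Unset Strict Implicit.
Unset Printing Implicit Defensive.
Import Order.TTheory GRing.Theory Num.Theory.
Import numFieldNormedType.Exports.

Local Open Scope classical_set_scope.
Local Open Scope ring_scope.

Definition rV_display : measure_display.
Proof. exact. Qed.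

Section measurable_rV.
Context {R : realType} (n : nat).

Let coord (i : 'I_n) (v : 'rV[R]_n) : R := v ord0 i.

Let rV_set0 : g_sigma_preimage coord set0.
Proof. exact: sigma_algebra0. Qed.

Let rV_setC A : g_sigma_preimage coord A -> g_sigma_preimage coord (~` A).
Proof. exact: sigma_algebraC. Qed.

Let rV_bigcup (F : (set 'rV[R]_n)^nat) :
  (forall i, g_sigma_preimage coord (F i)) ->
  g_sigma_preimage coord (\bigcup_i F i).
Proof. exact: sigma_algebra_bigcup. Qed.

(* Generated by the coordinates: the product sigma-algebra, which is also the Borel
   sigma-algebra of R^n. *)
HB.instance Definition _ := @isMeasurable.Build rV_display
  'M[R]_(1, n) (g_sigma_preimage coord) rV_set0 rV_setC rV_bigcup.

End measurable_rV.

Lemma measurable_rV_coord {R : realType} (n : nat) (i : 'I_n) :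
  measurable_fun [set: 'rV[R]_n] (fun v => v ord0 i).
Proof.
move=> _ Y mY; rewrite setTI; apply: sub_sigma_algebra => /=.
rewrite -bigcup_seq/=; exists i; first by rewrite /= mem_index_enum.
by exists Y => //; rewrite setTI.
Qed.

Lemma measurable_fun_rV {R : realType} d (T : measurableType d) (n : nat)
    (f : T -> 'rV[R]_n) :
  (forall i, measurable_fun setT (fun t => f t ord0 i)) ->
  measurable_fun setT f.
Proof.
move=> mf _ Y; rewrite /measurable/= => mY; rewrite setTI.
have : image_set_system setT f measurable Y.
  apply: mY; split; first exact/sigma_algebra_image/sigma_algebra_measurable.
  move=> A; rewrite -bigcup_seq/= => -[i _ [B mB <-]].
  by rewrite /image_set_system/= !setTI -[X in measurable X]setTI; exact: mf.
by rewrite /image_set_system/= setTI.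
Qed.

Section rV_cons.
Context {R : realType} (n : nat).

Definition rV_cons (p : measurableTypeR R * 'rV[R]_n) : 'rV[R]_n.+1 :=
  row_mx (const_mx p.1 : 'rV_1) p.2.

Lemma measurable_rV_cons : measurable_fun [set: measurableTypeR R * 'rV[R]_n] rV_cons.
Proof.
apply: measurable_fun_rV => i; case: (split_ordP (i : 'I_(1 + n))) => j ->.
  rewrite (_ : (fun p => _) = fst); first exact: measurable_fst.
  by apply/funext => p; rewrite [LHS]row_mxEl mxE.
rewrite (_ : (fun p => _) = (fun v : 'rV[R]_n => v ord0 j) \o snd); last first.
  by apply/funext => p; exact: row_mxEr.
apply: measurableT_comp; first exact: measurable_rV_coord.
exact: measurable_snd.
Qed.

End rV_cons.

Section lebesgue_step.
Local Open Scope ereal_scope.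
Context {R : realType} (n : nat).
Variable mu : {sigma_finite_measure set 'rV[R]_n -> \bar R}.

Definition lebesgue_step : set 'rV[R]_n.+1 -> \bar R :=
  pushforward (@lebesgue_measure R \x mu) (@rV_cons R n).

Let lebesgue_step0 : lebesgue_step set0 = 0.
Proof. by rewrite /lebesgue_step /pushforward preimage_set0 measure0. Qed.

Let mcons (A : set 'rV[R]_n.+1) :
  measurable A -> measurable (@rV_cons R n @^-1` A).
Proof.
by move=> mA; rewrite -[X in measurable X]setTI; exact: measurable_rV_cons.
Qed.

Let lebesgue_step_ge0 A : 0 <= lebesgue_step A.
Proof. by rewrite /lebesgue_step /pushforward measure_ge0. Qed.

Let lebesgue_step_sigma_additive : semi_sigma_additive lebesgue_step.
Proof.
move=> F mF tF mUF; rewrite /lebesgue_step /pushforward preimage_bigcup.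
apply: measure_semi_sigma_additive.
- by move=> k; exact: mcons.
- apply/trivIsetP => /= i j _ _ ij; rewrite -preimage_setI.
  by move/trivIsetP : tF => /(_ _ _ _ _ ij) ->//; rewrite preimage_set0.
- by rewrite -preimage_bigcup; exact: mcons.
Qed.

HB.instance Definition _ := isMeasure.Build _ _ _ lebesgue_step
  lebesgue_step0 lebesgue_step_ge0 lebesgue_step_sigma_additive.

Let rV_uncons (v : 'rV[R]_n.+1) : measurableTypeR R * 'rV[R]_n :=
  ((lsubmx (v : 'rV_(1 + n))) ord0 ord0, rsubmx (v : 'rV_(1 + n))).

Let rV_consK : cancel (@rV_cons R n) rV_uncons.
Proof.
move=> [x v]; rewrite /rV_uncons /rV_cons /=; congr pair.
  by rewrite row_mxKl mxE.
by rewrite row_mxKr.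
Qed.

Let measurable_rV_uncons : measurable_fun [set: 'rV[R]_n.+1] rV_uncons.
Proof.
have m1 : measurable_fun setT (fun v => (rV_uncons v).1).
  under eq_fun do rewrite /= mxE; exact: measurable_rV_coord.
have m2 : measurable_fun setT (fun v => (rV_uncons v).2).
  apply: measurable_fun_rV => i.
  under eq_fun do rewrite /= mxE; exact: measurable_rV_coord.
by apply/measurable_fun_pairP; split.
Qed.

Let lebesgue_step_sigma_finite : sigma_finite setT lebesgue_step.
Proof.
have /sigma_finiteP[F [FT ndF Foo]] := sigma_finiteT (@lebesgue_measure R).
have /sigma_finiteP[G [GT ndG Goo]] := sigma_finiteT mu.
exists (fun k => rV_uncons @^-1` (F k `*` G k)).
  rewrite -preimage_bigcup (_ : \bigcup_k _ = setT) ?preimage_setT//.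
  rewrite -subTset => -[x v] _.
  have [i _ Fx] : (\bigcup_k F k) x by rewrite -FT.
  have [j _ Gv] : (\bigcup_k G k) v by rewrite -GT.
  exists (maxn i j) => //; split => /=.
  - by move: x Fx; exact/subsetPset/ndF/leq_maxl.
  - by move: v Gv; exact/subsetPset/ndG/leq_maxr.
move=> k; have [mF Fk] := Foo k; have [mG Gk] := Goo k; split.
  rewrite -[X in measurable X]setTI; apply: measurable_rV_uncons => //.
  exact: measurableX.
rewrite /lebesgue_step /pushforward -comp_preimage.
rewrite (_ : rV_uncons \o _ = id); last first.
  by apply/funext => x; exact: rV_consK.
by rewrite preimage_id product_measure1E// lte_mul_pinfty// ge0_fin_numE.
Qed.

HB.instance Definition _ := Measure_isSigmaFinite.Build _ _ _ lebesgue_step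
  lebesgue_step_sigma_finite.

End lebesgue_step.

Fixpoint lebesgue_rV_rec (R : realType) (n : nat) :
    {sigma_finite_measure set 'rV[R]_n -> \bar R} :=
  match n return {sigma_finite_measure set 'rV[R]_n -> \bar R} with
  | 0 => [the {sigma_finite_measure set 'rV[R]_0 -> \bar R} of \d_(0 : 'rV[R]_0)]
  | m.+1 => [the {sigma_finite_measure set 'rV[R]_m.+1 -> \bar R} of
              lebesgue_step (lebesgue_rV_rec R m)]
  end.

Definition lebesgue_rV {R : realType} {n : nat} :
    {sigma_finite_measure set 'rV[R]_n -> \bar R} :=
  lebesgue_rV_rec R n.

Notation cabs := Normc.normc.
Local Notation Re := complex.Re.
Local Notation Im := complex.Im.

Local Open Scope complex_scope.

Section complex_valued.
Context {R : realType} {n : nat}.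
Local Notation V := 'rV[R]_n.
Local Notation C := R[i].
Local Notation mu := (@lebesgue_rV R n).
Implicit Types (f g h : V -> C) (x y xi : V).

(* On ['rV[R]_n] the library norm [`|x|] is the maximum norm, so the Euclidean
   norm needs its own name. *)
Definition dotp x y : R := \sum_(i < n) x ord0 i * y ord0 i.
Definition enorm x : R := Num.sqrt (dotp x x).

Definition cmeasurable f :=
  measurable_fun setT (fun x => Re (f x)) /\
  measurable_fun setT (fun x => Im (f x)).

Definition ccontinuous f :=
  continuous (fun x => Re (f x)) /\ continuous (fun x => Im (f x)).

Definition cintegrable f :=
  mu.-integrable setT (fun x => (Re (f x))%:E) /\
  mu.-integrable setT (fun x => (Im (f x))%:E).

Definition cint f : C :=
  (\int[mu]_x Re (f x)) +i* (\int[mu]_x Im (f x)).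

Definition pairing f g : C := cint (fun x => f x * (g x)^*).

Definition fourier f xi : C :=
  cint (fun x => f x * (cos (2 * pi * dotp x xi) -i* sin (2 * pi * dotp x xi))).

Definition iter_partial (a : seq 'I_n) (u : V -> R) : V -> R :=
  foldr (fun i v => 'D_(delta_mx ord0 i) v) u a.

Definition smooth (u : V -> R) := forall a : seq 'I_n,
  continuous (iter_partial a u) /\
  forall i x, derivable (iter_partial a u) x (delta_mx ord0 i).

Definition csmooth f :=
  smooth (fun x => Re (f x)) /\ smooth (fun x => Im (f x)).

Definition citer_partial (a : seq 'I_n) f x : C :=
  iter_partial a (fun y => Re (f y)) x +i* iter_partial a (fun y => Im (f y)) x.

Definition schwartz_norm (m : nat) f : \bar R :=
  ereal_sup [set e | exists (a : seq 'I_n) x,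
    (size a <= m)%N /\ e = ((1 + enorm x) ^+ m * cabs (citer_partial a f x))%:E].

Definition schwartz f :=
  csmooth f /\ forall m, (schwartz_norm m f < +oo)%E.

Definition annulus_supported (r1 r2 : R) f :=
  forall xi, f xi != 0 -> r1 <= enorm xi <= r2.

(* Continuity selects, in the a.e. class of a function with smooth compactly
   supported Fourier transform, the representative whose pointwise values
   enter the suprema below. *)
Definition band_limited (a b : R) f :=
  [/\ ccontinuous f, cintegrable f, csmooth (fourier f) &
      annulus_supported a b (fourier f)].

Definition L2norm f : \bar R := Lnorm mu 2%:E (fun x => (cabs (f x))%:E).

Definition L2 f := cmeasurable f /\ (L2norm f < +oo)%E.

Definition dilate (j : int) (k : 'rV[int]_n) f x : C :=
  (2 `^ (j%:~R * n%:R / 2))%:C * f ((2 ^ j) *: x - map_mx intr k).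

Definition dyadic (j : int) (k : 'rV[int]_n) : set V :=
  [set (2 ^ (- j)) *: (map_mx intr k + y) |
    y in [set y : V | forall i, 0 <= y ord0 i < 1]].

Definition unit_cube : set V := [set x | forall i, 0 <= x ord0 i < 1].

Section wavelets.
Context {L : nat}.

Definition windex := ('I_L * (int * 'rV[int]_n))%type.

Implicit Types (psi tpsi : 'I_L -> V -> C) (La : {fset windex}).

Definition wavelet psi (i : windex) : V -> C :=
  dilate i.2.1 i.2.2 (psi i.1).

Definition wcomb psi La (c : windex -> C) x : C :=
  \sum_(i <- La) c i * wavelet psi i x.

Definition riesz_basis (A B : R) psi :=
  [/\ 0 < A, 0 < B,
      forall i, L2 (wavelet psi i),
      forall f, L2 f -> forall e : R, 0 < e -> exists La c,
        (L2norm (fun x => f x - wcomb psi La c x)%R < e%:E)%E &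
      forall La c,
        ((A * \sum_(i <- La) cabs (c i) ^+ 2)%:E
           <= L2norm (wcomb psi La c) ^+ 2)%E /\
        (L2norm (wcomb psi La c) ^+ 2
           <= (B * \sum_(i <- La) cabs (c i) ^+ 2)%:E)%E].

Definition biorthogonal psi tpsi := forall i j : windex,
  pairing (wavelet psi i) (wavelet tpsi j) = (i == j)%:R.

(* The expansion converges in L^2 unconditionally, i.e. along the net of finite
   index sets; for a Riesz basis this is the same as convergence along any
   enumeration. *)
Definition reconstructs psi tpsi := forall f, L2 f ->
  forall e : R, 0 < e -> exists La0, forall La, (La0 `<=` La)%fset ->
    (L2norm (fun x =>
       f x - wcomb psi La (fun i => pairing f (wavelet tpsi i)) x)%R < e%:E)%E.

Definition biorthogonal_riesz_pair (a b A B A' B' : R) psi tpsi :=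
  [/\ forall e, band_limited a b (psi e) /\ band_limited a b (tpsi e),
      riesz_basis A B psi, riesz_basis A' B' tpsi,
      biorthogonal psi tpsi & reconstructs psi tpsi].

End wavelets.

Definition weight (w : V -> R) :=
  [/\ measurable_fun setT w,
      {ae mu, forall x, 0 < w x} &
      forall K : set V, compact K -> mu.-integrable K (fun x => (w x)%:E)].

Definition wLp_norm (p : R) (w : V -> R) f : \bar R :=
  ((\int[mu]_x (cabs (f x) `^ p * w x)%:E) `^ p^-1)%E.

Definition wLp (p : R) (w : V -> R) f :=
  cmeasurable f /\ (wLp_norm p w f < +oo)%E.

Definition cube x (r : R) : set V :=
  [set y | forall i, x ord0 i <= y ord0 i < x ord0 i + r].

Definition average (u : V -> R) (Q : set V) : \bar R :=
  ((fine (mu Q))^-1%:E * \int[mu]_(y in Q) (u y)%:E)%E.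

(* [average w] is positive for a weight, so no product 0 * +oo occurs. *)
Definition Ap_const (p : R) (w : V -> R) : \bar R :=
  ereal_sup [set e | exists x (r : R), 0 < r /\
    e = (average w (cube x r) *
         average (fun y => w y `^ (- (p - 1)^-1))%R (cube x r) `^ (p - 1))%E].

Definition Ap (p : R) (w : V -> R) := weight w /\ (Ap_const p w < +oo)%E.

Definition tempered (u : (V -> C) -> C) :=
  (forall (c : C) g h, schwartz g -> schwartz h ->
    u (fun x => c * g x + h x) = c * u g + u h) /\
  exists (m : nat) (K : R), forall g, schwartz g ->
    ((cabs (u g))%:E <= K%:E * schwartz_norm m g)%E.

Definition dist_of f : (V -> C) -> C := fun g => cint (fun x => f x * g x).

(* For a fixed frequency only finitely many terms of the last sum are nonzero,
   so the finitely supported sum is the whole series. *)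
Definition lp_generator (c1 c2 : R) (phi : V -> C) :=
  [/\ schwartz phi,
      forall xi, Im (fourier phi xi) = 0,
      forall xi eta, enorm xi = enorm eta -> fourier phi xi = fourier phi eta,
      annulus_supported c1 c2 (fourier phi) &
      forall xi, xi != 0 ->
        \sum_(j \in [set: int]) fourier phi ((2 ^ (- j)) *: xi) = 1].

(* Normalised in L^1, unlike [dilate]. *)
Definition lp_dilate (phi : V -> C) (j : int) x : C :=
  (2 `^ (j%:~R * n%:R))%:C * phi ((2 ^ j) *: x).

(* The convolution of a Schwartz function with a tempered distribution; when
   the latter is [dist_of f] this is the integral of phi_j(x - y) f(y) dy. *)
Definition lp_block (phi : V -> C) (j : int) (u : (V -> C) -> C) x : C :=
  u (fun y => lp_dilate phi j (x - y)).

(* An element of S'/P is given by a representative u in S'. The blocks kill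
   polynomials (the Fourier transform of phi_j vanishes near the origin), so the
   quantity below does not depend on the representative. *)
Definition besov_norm (phi : V -> C) (s p q : R) (w : V -> R)
    (u : (V -> C) -> C) : \bar R :=
  ((\esum_(j in [set: int])
      ((2 `^ (j%:~R * s * q))%:E * wLp_norm p w (lp_block phi j u) `^ q))
    `^ q^-1)%E.

Definition besov (phi : V -> C) (s p q : R) (w : V -> R)
    (u : (V -> C) -> C) :=
  tempered u /\ (besov_norm phi s p q w u < +oo)%E.

Section localized.
Context {L : nat}.
Implicit Types psi tpsi : 'I_L -> V -> C.

(* The innermost index set is finite: it consists of the k with all entries in
   [0, 2^j). *)
Definition truncation psi tpsi f (J : nat) x : C :=
  \sum_(e < L) \sum_(0 <= j < J.+1)
    \sum_(k \in [set k | dyadic j%:Z k `<=` unit_cube])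
      pairing f (dilate j%:Z k (tpsi e)) * dilate j%:Z k (psi e) x.

Definition besov_localized psi tpsi (phi : V -> C) (s p q : R) (w : V -> R) f :=
  [/\ wLp p w f, besov phi s p q w (dist_of f) &
      wLp_norm p w (fun x => truncation psi tpsi f J x - f x) @[J --> \oo]
        --> 0%E].

Definition nterm_error psi (p : R) (w : V -> R) (N : nat) f : \bar R :=
  ereal_inf [set e | exists (La : {fset @windex L}) c, (#|` La| <= N)%N /\
    e = wLp_norm p w (fun x => f x - wcomb psi La c x)].

End localized.

Definition Mnorm (tau : R) f : \bar R :=
  ereal_sup (range (fun x =>
    ((1 + enorm x) `^ (2 * n%:R + tau) * cabs (f x))%:E)).

Definition Dnorm (sigma : R) f : \bar R :=
  (\int[mu]_x ((1 + enorm x `^ sigma) * cabs (f x))%:E)%E.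

Definition Kkernel (sigma : R) f : \bar R :=
  ereal_sup (range (fun x => ((1 + enorm x) `^ sigma * cabs (f x))%:E)).

(* For m = 0 the constraint is void, so this is the supremum of |f|. *)
Definition envelope f (m : nat) : \bar R :=
  ereal_sup [set (cabs (f z))%:E | z in [set z | m%:R - 1 <= `|z|]].

End complex_valued.

Section constants.
Context {R : realType}.
Local Open Scope ereal_scope.

(* K_U(h) and K_L(h) are [envelope_series g (envelope h)] for g = n + n/p' and
   g = n + n/p. *)
Definition envelope_series (gamma : R) (beta : nat -> \bar R) : \bar R :=
  \sum_(0 <= i <oo) (beta i - beta i.+1) * ((2 * i + 1)%:R `^ gamma)%:E.

Definition emax_ord (L : nat) (F : 'I_L -> \bar R) : \bar R :=
  \big[maxe/-oo]_(e < L) F e.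

Definition conjugate_exponent (p : R) : R := (p / (p - 1))%R.

Definition gammaU (n : nat) (p : R) : R :=
  (n%:R + n%:R / conjugate_exponent p)%R.

Definition gammaL (n : nat) (p : R) : R := (n%:R + n%:R / p)%R.

Definition theta (p : R) : R := (2^-1 * Num.max 1 (p - 1)^-1)%R.

Definition log2 (x : R) : R := (ln x / ln 2)%R.

Definition band_depth (a b c1 c2 : R) : nat :=
  absz (Num.ceil (Num.max (Num.max (log2 (b / c1)) (log2 (c2 / a))) 0))%R.

Definition C_band (s : R) (M : nat) : R :=
  (\sum_(0 <= i < (2 * M).+1) 2 `^ ((i%:R - M%:R) * s))%R.

Definition prefactor (n L : nat) (s : R) (M : nat) : R :=
  (L%:R * (2 * L%:R) `^ (s / n%:R) / (1 - 2 `^ (- s)) * C_band s M)%R.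

(* The generators enter only through their envelopes beta and tbeta. *)
Definition C0 (n L : nat) (p s : R) (M : nat)
    (beta tbeta : 'I_L -> nat -> \bar R) : \bar R :=
  (prefactor n L s M)%:E
  * emax_ord (fun e => envelope_series (gammaU n p) (beta e))
  * emax_ord (fun e => envelope_series (gammaL n p) (tbeta e)).

Definition zeta (z : R) : \bar R :=
  \sum_(1 <= i <oo) (i%:R `^ (- z))%:E.

Definition C0_majorant (n L : nat) (p s : R) (M : nat)
    (tau : R) (Mmax : \bar R) (sigma : R) (Dmax KPhi : \bar R) : \bar R :=
  let g := gammaU n p in let g' := gammaL n p in
  (prefactor n L s M)%:E
  * (Mmax * (1 + (2 * g * 3 `^ (g - 1))%:E * zeta (1 + tau + n%:R / p)))
  * ((2 `^ sigma)%:E * KPhi * Dmax *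
     (1 + (2 * g' * 3 `^ (g' - 1))%:E * zeta (1 + sigma - n%:R - n%:R / p))).

End constants.

(* Main.v *)
(** For a generator h with envelope beta, the layer-cake bound
    |h| <= sum_i (beta_i - beta_(i+1)) 1_([-i, i+1)^n) reduces every estimate to
    indicators of the enlarged cubes Q_k^(i) of side (2i+1) 2^(-j).  On those, Hoelder's
    inequality together with the A_p condition gives the doubling of w and the bound
    (int_Q g)^p w(Q) <= [w] |Q|^p int_Q g^p w.  Jensen's inequality over i, with weights
    (2i+1)^gamma, and the overlap (2i+1)^n of the cubes Q_k^(i) give, on a single level j, a
    synthesis bound with constant K_U [w]^(1/p) and an analysis bound with constant
    K_L [w]^(1/p).  Since the dual generators are band-limited, the level j coefficients of f
    only see sum_(|i| <= M) Delta_(j+i) f, whose norm is at most C_M 2^(-js) times the Besov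
    norm of f.  Keeping every wavelet of Q_0 below the first level m with N < 2L 2^(mn) costs
    at most N terms, and the remaining levels sum to a geometric series.  The closed form
    follows from beta_i <= D i^(-sigma), which for the dual generators comes from
    reproducing h = h * Phi and Peetre's inequality. *)

Require Import Defs.
From HB Require Import structures.
From mathcomp Require Import all_boot all_order all_algebra.
From mathcomp Require Import finmap.
From mathcomp Require Import all_classical all_reals all_analysis.
From mathcomp Require Import complex.
From mathcomp Require Import measurable_realfun zify ring lra.

Set Implicit Arguments.
Unset Strict Implicit.
Unset Printing Implicit Defensive.
Import Order.TTheory GRing.Theory Num.Theory.
Import numFieldNormedType.Exports.
Local Open Scope classical_set_scope.
Local Open Scope ring_scope.

(** * Lebesgue measure on R^n *)

(** The coefficients of [f] must be expressed through Littlewood-Paley blocks for [f] in L^p_w,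
    where no L^2 theory applies. The kernel is therefore moved across the pairing by Fubini's
    theorem. Peetre's inequality makes the double integral converge absolutely once [f] is
    integrable against (1+|y|)^(-sigma), and this in turn is the analysis bound for a single cube.
    Reproduction itself rests on the injectivity of the Fourier transform on continuous integrable
    functions, obtained by testing against bumps built from cosines. The exponents n + n/p' and n +
    n/p are forced. In p-th powers, layer i costs (2i+1)^(np) for the weight, and its overlap costs
    a further (2i+1)^(n(p-1)) in the synthesis and (2i+1)^n in the analysis. When gamma p equals the
    total, the weights of Jensen's inequality reappear and sum to K_U or K_L. Each of the two bounds
    contributes [w]^(1/p), hence the power 2/p. The tail never becomes an infinite sum of functions:
    since T_J f tends to f, it suffices to bound the levels from m to J uniformly in J. *)

Section affine_real.
Context {R : realType}.
Local Open Scope ereal_scope.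
Local Notation lam := (@lebesgue_measure R).

(** By uniqueness of Lebesgue measure it is enough to compare both sides on the intervals []c, d]].
    For negative [r] the preimage is closed on the left and open on the right, which does not change
    its length. *)
Lemma lebesgue_measure_affine (r a : R) (A : set R) : r != 0%R -> measurable A ->
  lam A = `|r|%:E * lam ((fun x => r * x + a)%R @^-1` A).
Proof.
move=> r0 mA.
pose phi := (fun x : measurableTypeR R => (r * x + a)%R : measurableTypeR R).
have mphi : measurable_fun setT phi.
  by apply: measurable_realfun.measurable_funD => //; exact: measurable_funM.
pose nu := mscale (NngNum (normr_ge0 r)) (pushforward lam phi).
rewrite (@lebesgue_measure_unique R (nu mphi))// => _ [[c d] _ <-].
transitivity (`|r|%:E * lam (phi @^-1` `]c, d])); last by [].
have [rgt0|rlt0|req0] := ltgtP r 0%R; last by rewrite req0 eqxx in r0.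
- have -> : phi @^-1` `]c, d] = `[((d - a) / r)%R, ((c - a) / r)%R[%classic.
    apply/seteqP; split => x /=; rewrite !in_itv/= ltr_ndivlMr// ler_ndivrMr//;
    by rewrite /phi ltrBlDr lerBrDr mulrC andbC.
  rewrite !lebesgue_measure_itv/= !lte_fin ltr_nM2r ?invr_lt0// ltrD2r.
  case: ifPn => _; rewrite ?mule0//.
  by rewrite -!EFinB -EFinM (ltr0_norm rgt0); congr EFin; field.
- have -> : phi @^-1` `]c, d] = `]((c - a) / r)%R, ((d - a) / r)%R]%classic.
    apply/seteqP; split => x /=; rewrite !in_itv/= ltr_pdivrMr// ler_pdivlMr//;
    by rewrite /phi ltrBlDr lerBrDr mulrC.
  rewrite !lebesgue_measure_itv/= !lte_fin ltr_pM2r ?invr_gt0// ltrD2r.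
  case: ifPn => _; rewrite ?mule0//.
  by rewrite -!EFinB -EFinM (gtr0_norm rlt0); congr EFin; field.
Qed.

Lemma ge0_integral_affine_real (r a : R) (f : R -> \bar R) : r != 0%R ->
  measurable_fun [set: measurableTypeR R] f -> (forall x, 0 <= f x) ->
  \int[lam]_x f x = `|r|%:E * \int[lam]_x f (r * x + a)%R.
Proof.
move=> r0 mf f0.
pose phi := (fun x : measurableTypeR R => (r * x + a)%R : measurableTypeR R).
have mphi : measurable_fun setT phi.
  by apply: measurable_realfun.measurable_funD => //; exact: measurable_funM.
pose nu := mscale (NngNum (normr_ge0 r)) (pushforward lam phi).
rewrite (eq_measure_integral (nu mphi)); last first.
  by move=> A mA _; exact: lebesgue_measure_affine.
rewrite ge0_integral_mscale//; congr (_ * _).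
by rewrite ge0_integral_pushforward.
Qed.

End affine_real.

Section rV_measure.
Context {R : realType}.
Local Open Scope ereal_scope.

Lemma ge0_integral_rV_recl n (f : 'rV[R]_n.+1 -> \bar R) :
  measurable_fun setT f -> (forall x, 0 <= f x) ->
  \int[lebesgue_rV]_x f x =
  \int[lebesgue_measure]_x \int[lebesgue_rV]_v f (rV_cons (x, v)).
Proof.
move=> mf f0.
transitivity (\int[lebesgue_measure \x lebesgue_rV]_z f (@rV_cons R n z)).
  rewrite -[LHS]/(\int[pushforward (@lebesgue_measure R \x lebesgue_rV) (@rV_cons R n)]_x f x).
  by rewrite (ge0_integral_pushforward (@measurable_rV_cons R n)).
by rewrite fubini_tonelli1//; apply: measurableT_comp => //; exact: measurable_rV_cons.
Qed.

Lemma measurable_rV_affine n (r : R) (a : 'rV[R]_n) :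
  measurable_fun setT (fun x : 'rV[R]_n => (r *: x + a)%R).
Proof.
apply: measurable_fun_rV => i.
under eq_fun do rewrite !mxE.
apply: measurable_realfun.measurable_funD => //; apply: measurable_funM => //.
exact: measurable_rV_coord.
Qed.

Lemma rV_cons_affine n (r : R) (x : R) (v : 'rV[R]_n) (a : 'rV[R]_n.+1) :
  (r *: rV_cons (x, v) + a =
   rV_cons ((r * x + a ord0 ord0), (r *: v + rsubmx (a : 'rV_(1 + n)))))%R.
Proof.
apply/rowP => i; rewrite !mxE; case: (split_ordP (i : 'I_(1 + n))) => j ->.
  by rewrite !mxE (ord1 j); congr (_ + a _ _)%R; exact/val_inj.
by rewrite !mxE.
Qed.

(** Tonelli peels off the coordinates one at a time, and each contributes one factor [|r|]. *)
Lemma ge0_integral_affine n (r : R) (a : 'rV[R]_n) (f : 'rV[R]_n -> \bar R) :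
  r != 0%R -> measurable_fun setT f -> (forall x, 0 <= f x) ->
  \int[lebesgue_rV]_x f x = (`|r| ^+ n)%:E * \int[lebesgue_rV]_x f (r *: x + a)%R.
Proof.
elim: n a f => [|n IH] a f r0 mf f0.
  rewrite expr0 mul1e; apply: eq_integral => x _; congr f.
  by apply/rowP => -[].
have mf' : measurable_fun setT (fun z : measurableTypeR R * 'rV[R]_n => f (rV_cons z)).
  by apply: measurableT_comp => //; exact: measurable_rV_cons.
rewrite !ge0_integral_rV_recl//; last first.
  by apply: measurableT_comp => //; exact: measurable_rV_affine.
rewrite (ge0_integral_affine_real (a ord0 ord0) r0); last 2 first.
- exact: (measurable_fun_fubini_tonelli_F (m2 := lebesgue_rV) _ mf').
- by move=> x; apply: integral_ge0.
rewrite exprS EFinM -muleA; congr (_ * _).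
have mfa (x : R) : measurable_fun setT (fun v : 'rV[R]_n => f (rV_cons (x, v))).
  exact: (measurableT_comp mf').
under eq_integral => x _.
  rewrite (IH (rsubmx (a : 'rV_(1 + n)))%R)//.
  under eq_integral do rewrite -rV_cons_affine.
  over.
rewrite /= ge0_integralZl_EFin//.
- by move=> x _; apply: integral_ge0.
- pose g z := f (r *: rV_cons z + a)%R.
  have mg : measurable_fun [set: measurableTypeR R * 'rV[R]_n] g.
    apply: (measurableT_comp mf).
    apply: (measurableT_comp (measurable_rV_affine _ _)).
    exact: measurable_rV_cons.
  by apply: (measurable_fun_fubini_tonelli_F (m2 := lebesgue_rV) _ mg) => z; exact: f0.
Qed.
End rV_measure.

Section rV_norm.
Context {R : realType} {n : nat}.
Implicit Types v : 'rV[R]_n.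

Lemma coord_le_norm v i : `|v ord0 i| <= `|v|.
Proof.
rewrite [leRHS]/Num.norm/= mx_normrE.
by rewrite (le_bigmax _ (fun ij => `|v ij.1 ij.2|) (ord0, i)).
Qed.

Lemma norm_le_coord v e : 0 <= e -> (forall i, `|v ord0 i| <= e) -> `|v| <= e.
Proof.
move=> e0 ve; rewrite [leLHS]/Num.norm/= mx_normrE.
by apply/bigmax_leP; split => // -[i j] _ /=; rewrite (ord1 i).
Qed.

Lemma norm_ge_coord v e : 0 < e -> e <= `|v| -> exists i, e <= `|v ord0 i|.
Proof.
move=> e0 ev; apply/not_existsP => ve; move: ev; apply/negP; rewrite -ltNge.
rewrite [ltLHS]/Num.norm/= mx_normrE.
apply/bigmax_ltP; split => // -[i j] _ /=; rewrite (ord1 i) ltNge.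
exact/negP/ve.
Qed.
End rV_norm.

Section continuous_measurable.
Context {R : realType} {n : nat}.
Local Notation V := 'rV[R]_n.

Let rfloor (m : nat) (x : V) : V := \row_i ((Num.floor (x ord0 i * m.+1%:R))%:~R / m.+1%:R).

Let rfloor_cvg (x : V) : rfloor m x @[m --> \oo] --> x.
Proof.
apply/cvgrPdist_le => e e0; near=> m.
apply: norm_le_coord; first exact: ltW.
move=> i; rewrite !mxE.
have m0 : (0 : R) < m.+1%:R by [].
have /andP[le1 lt1] := floor_itv (x ord0 i * m.+1%:R).
rewrite -[x ord0 i in X in `|X - _|](mulfK (lt0r_neq0 m0)) -mulrBl normrM.
rewrite ger0_norm ?subr_ge0// gtr0_norm ?invr_gt0//.
rewrite (@le_trans _ _ (1 / m.+1%:R))//.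
  rewrite ler_pM2r ?invr_gt0// lerBlDl; apply/ltW; move: lt1.
  by rewrite intrD.
rewrite mul1r ltW//; near: m; exact: (near_infty_natSinv_lt (PosNum e0)).
Unshelve. all: by end_near. Qed.

Let measurable_rfloor_comp (f : V -> R) m : measurable_fun setT (f \o rfloor m).
Proof.
move=> _ Y mY; rewrite setTI.
pose G (k : 'rV[int]_n) : set V := \bigcap_(i in [set: 'I_n])
    [set x : V | ((k ord0 i)%:~R <= x ord0 i * m.+1%:R < (k ord0 i + 1)%:~R)].
pose Z := [set k : 'rV[int]_n | Y (f (\row_i ((k ord0 i)%:~R / m.+1%:R)))].
rewrite (_ : _ @^-1` _ = \bigcup_(k in Z) G k); last first.
  apply/seteqP; split => [x/= Yx|x [k Yk xk]].
    exists (\row_i Num.floor (x ord0 i * m.+1%:R)) => /=.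
      move: Yx; rewrite /rfloor /Z/=; congr (Y (f _)).
      by apply/rowP => i; rewrite !mxE.
    by move=> i _ /=; rewrite -floor_eq mxE.
  rewrite /= /rfloor (_ : \row_i _ = \row_i ((k ord0 i)%:~R / m.+1%:R))//.
  apply/rowP => i; rewrite !mxE; congr (_%:~R / _); apply/eqP.
  by rewrite floor_eq; exact: xk.
rewrite bigcup_mkcond; apply: countable_bigcupT_measurable; first exact: countableP.
move=> k; case: ifPn => // _.
apply: fin_bigcap_measurable => // i _.
have mx : measurable_fun setT (fun x : V => x ord0 i * m.+1%:R).
  by apply: measurable_funM => //; exact: measurable_rV_coord.
have := mx measurableT `[(k ord0 i)%:~R, (k ord0 i + 1)%:~R[%classic.
rewrite setTI (_ : _ @^-1` _ = [set x : V | ((k ord0 i)%:~R <= x ord0 i * m.+1%:R < (k ord0 i + 1)%:~R)]).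
  by apply; exact: measurable_itv.
by apply/seteqP; split => x /=; rewrite in_itv.
Qed.

(** The sigma-algebra is generated by coordinates rather than by open sets. [f] is the pointwise
    limit of its values at the grid points of mesh 1/(m+1) below x, and each such function is
    constant on countably many products of half-open intervals. *)
Lemma continuous_measurable_rV (f : V -> R) : continuous f -> measurable_fun setT f.
Proof.
move=> cf; apply: (measurable_fun_cvg (fun m => measurable_rfloor_comp f m)) => x _.
by apply: continuous_cvg; [exact: cf|exact: rfloor_cvg].
Qed.

End continuous_measurable.

Section cubes.
Context {R : realType}.

Lemma rV_cons0 n (p : measurableTypeR R * 'rV[R]_n) : rV_cons p ord0 ord0 = p.1.
Proof.
rewrite /rV_cons (_ : ord0 = lshift n (ord0 : 'I_1)); last exact/val_inj.
by rewrite [LHS]row_mxEl mxE.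
Qed.

Lemma rV_consS n (p : measurableTypeR R * 'rV[R]_n) j :
  rV_cons p ord0 (rshift 1 j) = p.2 ord0 j.
Proof. exact: row_mxEr. Qed.

Lemma cubeE n (x : 'rV[R]_n) r :
  cube x r = \bigcap_(i in [set: 'I_n]) [set y : 'rV[R]_n | x ord0 i <= y ord0 i < x ord0 i + r].
Proof. by apply/seteqP; split => y yx i; [move=> _|]; exact: yx. Qed.

Lemma measurable_cube n (x : 'rV[R]_n) r : measurable (cube x r).
Proof.
rewrite cubeE; apply: fin_bigcap_measurable => // i _.
have := @measurable_rV_coord R n i measurableT `[x ord0 i, x ord0 i + r[%classic.
rewrite setTI (_ : _ @^-1` _ = [set y : 'rV[R]_n | x ord0 i <= y ord0 i < x ord0 i + r]).
  by apply; exact: measurable_itv.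
by apply/seteqP; split => y /=; rewrite in_itv.
Qed.

Lemma lebesgue_rV_cube n (x : 'rV[R]_n) r : 0 <= r -> lebesgue_rV (cube x r) = (r ^+ n)%:E.
Proof.
move=> r0; elim: n x => [|n IH] x.
  by rewrite /lebesgue_rV/= diracE expr0 mem_set// => -[].
rewrite -[LHS]/((lebesgue_measure \x lebesgue_rV)%E ((@rV_cons R n) @^-1` cube x r)).
pose x' := (rsubmx (x : 'rV_(1 + n))).
rewrite (_ : _ @^-1` _ = `[x ord0 ord0, x ord0 ord0 + r[%classic `*` cube x' r); last first.
  apply/seteqP; split => -[t v]/=.
    move=> H; split; first by have := H ord0; rewrite in_itv/= rV_cons0.
    by move=> i; have := H (rshift 1 i); rewrite rV_consS !mxE.
  move=> [xt xv] i; case: (split_ordP (i : 'I_(1 + n))) => j ->.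
    rewrite (ord1 j) (_ : lshift n ord0 = ord0) ?rV_cons0//; last exact/val_inj.
  by have := xv j; rewrite rV_consS !mxE.
rewrite product_measure1E//; last exact: measurable_cube.
rewrite [X in (X * _)%E](_ : _ = lebesgue_measure `[x ord0 ord0, x ord0 ord0 + r[%classic)//.
rewrite lebesgue_measure_itv/= lte_fin ltrDl.
case: ltP => [r1|]; last first.
  by move=> rle; rewrite mul0e (_ : r = 0) ?expr0n//; apply/le_anti; rewrite r0 rle.
rewrite [X in (_ * X)%E](_ : _ = (r ^+ n)%:E); last exact: IH.
by rewrite -EFinB -EFinM exprS; congr (_ * _)%:E; rewrite addrC addKr.
Qed.
End cubes.

Section real_integrands.
Context {R : realType} {n : nat}.
Local Notation V := 'rV[R]_n.
Local Notation mu := (@lebesgue_rV R n).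
Implicit Types f g : V -> R.

Lemma le_integral_EFin f g : measurable_fun setT f -> measurable_fun setT g ->
  (forall x, 0 <= f x) -> (forall x, f x <= g x) ->
  (\int[mu]_x (f x)%:E <= \int[mu]_x (g x)%:E)%E.
Proof.
move=> mf mg f0 fg; apply: ge0_le_integral; first exact: measurableT.
- by move=> x _; rewrite lee_fin.
- exact/measurable_EFinP.
- exact/measurable_EFinP.
- by move=> x _; rewrite lee_fin.
Qed.

Lemma integralZl_EFin (k : R) f : 0 <= k -> measurable_fun setT f -> (forall x, 0 <= f x) ->
  (\int[mu]_x (k * f x)%:E = k%:E * \int[mu]_x (f x)%:E)%E.
Proof.
move=> k0 mf f0; under eq_integral do rewrite EFinM.
by rewrite ge0_integralZl_EFin// => [x _|]; [rewrite lee_fin|exact/measurable_EFinP].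
Qed.

Lemma le_integral_scale (k : R) f g : 0 <= k ->
  measurable_fun setT f -> measurable_fun setT g ->
  (forall x, 0 <= f x) -> (forall x, 0 <= g x) -> (forall x, f x <= k * g x) ->
  (\int[mu]_x (f x)%:E <= k%:E * \int[mu]_x (g x)%:E)%E.
Proof.
move=> k0 mf mg f0 g0 fg; rewrite -(integralZl_EFin k0 mg g0).
by apply: le_integral_EFin => //; exact: measurable_funM.
Qed.

Lemma integral_scale_lty (k : R) f g : 0 <= k ->
  measurable_fun setT f -> measurable_fun setT g ->
  (forall x, 0 <= f x) -> (forall x, 0 <= g x) -> (forall x, f x <= k * g x) ->
  (\int[mu]_x (g x)%:E < +oo)%E -> (\int[mu]_x (f x)%:E < +oo)%E.
Proof.
move=> k0 mf mg f0 g0 fg goo; apply: (le_lt_trans (le_integral_scale k0 mf mg f0 g0 fg)).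
by apply: lte_mul_pinfty => //; rewrite lee_fin.
Qed.

End real_integrands.

Lemma le_of_eq d (T : porderType d) (x y : T) : x = y -> (x <= y)%O.
Proof. by move=> ->. Qed.

(** * Complex-valued integrals *)

Section complex_functions.
Context {R : realType}.
Local Open Scope complex_scope.
Local Notation Re := complex.Re.
Local Notation Im := complex.Im.
Local Notation C := R[i].

Lemma cReD (x y : C) : Re (x + y) = Re x + Re y. Proof. by case: x y => [? ?] [? ?]. Qed.
Lemma cImD (x y : C) : Im (x + y) = Im x + Im y. Proof. by case: x y => [? ?] [? ?]. Qed.
Lemma cReN (x : C) : Re (- x) = - Re x. Proof. by case: x. Qed.
Lemma cImN (x : C) : Im (- x) = - Im x. Proof. by case: x. Qed.
Lemma cReM (x y : C) : Re (x * y) = Re x * Re y - Im x * Im y.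
Proof. by case: x y => [? ?] [? ?]. Qed.
Lemma cImM (x y : C) : Im (x * y) = Re x * Im y + Im x * Re y.
Proof. by case: x y => [? ?] [? ?]. Qed.
Lemma cReJ (x : C) : Re x^* = Re x. Proof. by case: x. Qed.
Lemma cImJ (x : C) : Im x^* = - Im x. Proof. by case: x. Qed.

Lemma complex_ext (x y : C) : Re x = Re y -> Im x = Im y -> x = y.
Proof. by case: x y => [a b] [c d] /= -> ->. Qed.

Lemma cabsE (x : C) : cabs x = Num.sqrt (Re x ^+ 2 + Im x ^+ 2).
Proof. by case: x. Qed.

Lemma cabs_ge0 (x : C) : 0 <= cabs x. Proof. by rewrite cabsE sqrtr_ge0. Qed.

Lemma cabs_ge_Re (x : C) : `|Re x| <= cabs x.
Proof. by rewrite cabsE -sqrtr_sqr ler_wsqrtr// lerDl sqr_ge0. Qed.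

Lemma cabs_ge_Im (x : C) : `|Im x| <= cabs x.
Proof. by rewrite cabsE -sqrtr_sqr ler_wsqrtr// lerDr sqr_ge0. Qed.

Lemma cabsJ (x : C) : cabs x^* = cabs x.
Proof. by rewrite !cabsE cReJ cImJ sqrrN. Qed.

Lemma cabsN (x : C) : cabs (- x) = cabs x.
Proof. by rewrite !cabsE cReN cImN !sqrrN. Qed.

Lemma cabsM (x y : C) : cabs (x * y) = cabs x * cabs y.
Proof. exact: Normc.normcM. Qed.

Lemma cabsD (x y : C) : cabs (x + y) <= cabs x + cabs y.
Proof. exact: le_normcD. Qed.

Lemma cabs0 : cabs (0 : C) = 0. Proof. exact: Normc.normc0. Qed.

Lemma cabs_real (x : R) : cabs x%:C = `|x|.
Proof. by rewrite cabsE /= expr0n addr0 sqrtr_sqr. Qed.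

Lemma cabs_eq0 (x : C) : cabs x = 0 -> x = 0.
Proof. exact: Normc.eq0_normc. Qed.

Lemma cabs_sum I (r : seq I) (F : I -> C) :
  cabs (\sum_(i <- r) F i) <= \sum_(i <- r) cabs (F i).
Proof.
elim: r => [|i r IH]; first by rewrite !big_nil cabs0.
by rewrite !big_cons (le_trans (cabsD _ _))// lerD2l.
Qed.

Lemma cabs_le_ReIm (x : C) : cabs x <= `|Re x| + `|Im x|.
Proof.
rewrite {1}(_ : x = (Re x)%:C + 'i * (Im x)%:C); last exact: complexE.
rewrite (le_trans (cabsD _ _))// cabsM !cabs_real (_ : cabs 'i = 1) ?mul1r//.
by rewrite cabsE /= expr0n expr1n add0r sqrtr1.
Qed.

(* exp(-i t), with the sign of the Fourier kernel. *)
Definition cexp (t : R) : C := cos t -i* sin t.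

Lemma cabs_cexp t : cabs (cexp t) = 1.
Proof. by rewrite cabsE /= sqrrN cos2Dsin2 sqrtr1. Qed.

Lemma cexpD s t : cexp (s + t) = cexp s * cexp t.
Proof.
apply: complex_ext; rewrite /= ?cosD ?sinD; first by rewrite mulrNN.
by rewrite opprD mulrN mulNr addrC.
Qed.

Context d (T : measurableType d).
Implicit Types f g : T -> C.

Definition cmfun f :=
  measurable_fun setT (fun x => Re (f x)) /\ measurable_fun setT (fun x => Im (f x)).

Lemma cmfun_cst c : cmfun (fun=> c). Proof. by split. Qed.

Lemma cmfunD f g : cmfun f -> cmfun g -> cmfun (fun x => f x + g x).
Proof.
move=> [f1 f2] [g1 g2]; split.
  by under eq_fun do rewrite cReD; exact: measurable_funD.
by under eq_fun do rewrite cImD; exact: measurable_funD.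
Qed.

Lemma cmfunN f : cmfun f -> cmfun (fun x => - f x).
Proof.
move=> [f1 f2]; split.
  by under eq_fun do rewrite cReN; exact: measurableT_comp.
by under eq_fun do rewrite cImN; exact: measurableT_comp.
Qed.

Lemma cmfunB f g : cmfun f -> cmfun g -> cmfun (fun x => f x - g x).
Proof. by move=> mf mg; apply: cmfunD => //; exact: cmfunN. Qed.

Lemma cmfunJ f : cmfun f -> cmfun (fun x => (f x)^*).
Proof.
move=> [f1 f2]; split; first by under eq_fun do rewrite cReJ.
by under eq_fun do rewrite cImJ; exact: measurableT_comp.
Qed.

Lemma cmfunM f g : cmfun f -> cmfun g -> cmfun (fun x => f x * g x).
Proof.
move=> [f1 f2] [g1 g2]; split.
  by under eq_fun do rewrite cReM; apply: measurable_funB; exact: measurable_funM.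
by under eq_fun do rewrite cImM; apply: measurable_funD; exact: measurable_funM.
Qed.

Lemma cmfun_sum I (r : seq I) (F : I -> T -> C) : (forall i, cmfun (F i)) ->
  cmfun (fun x => \sum_(i <- r) F i x).
Proof.
move=> mF; elim: r => [|i r IH].
  by under eq_fun do rewrite big_nil; exact: cmfun_cst.
by under eq_fun do rewrite big_cons; exact: cmfunD.
Qed.

Lemma measurable_cabs f : cmfun f -> measurable_fun setT (fun x => cabs (f x)).
Proof.
move=> [f1 f2]; under eq_fun do rewrite cabsE.
have ms : measurable_fun [set: R] (@Num.sqrt R).
  by apply: continuous_measurable_fun => x; exact: sqrt_continuous.
by apply: (measurableT_comp ms); apply: measurable_funD; exact: measurable_funX.
Qed.

Lemma cmfun_comp d' (T' : measurableType d') (f : T' -> C) (g : T -> T') :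
  (measurable_fun setT (fun x => Re (f x)) /\ measurable_fun setT (fun x => Im (f x))) ->
  measurable_fun setT g -> cmfun (fun x => f (g x)).
Proof.
move=> [f1 f2] mg; split.
  exact: (measurableT_comp f1 mg).
exact: (measurableT_comp f2 mg).
Qed.

Lemma measurable_cos : measurable_fun [set: R] (@cos R).
Proof. exact: continuous_measurable_fun (@continuous_cos R). Qed.

Lemma measurable_sin : measurable_fun [set: R] (@sin R).
Proof. exact: continuous_measurable_fun (@continuous_sin R). Qed.

Lemma cmfun_cexp (u : T -> R) : measurable_fun setT u -> cmfun (fun x => cexp (u x)).
Proof.
move=> mu; split; first exact: (measurableT_comp measurable_cos).
by apply: measurableT_comp => //; exact: (measurableT_comp measurable_sin).
Qed.

End complex_functions.

Section complex_integral.
Context {R : realType} {n : nat}.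
Local Open Scope complex_scope.
Local Notation Re := complex.Re.
Local Notation Im := complex.Im.
Local Notation C := R[i].
Local Notation V := 'rV[R]_n.
Local Notation mu := (@lebesgue_rV R n).
Implicit Types f g : V -> C.

Lemma cintegrableP f : cintegrable f <->
  cmeasurable f /\ (\int[mu]_x (cabs (f x))%:E < +oo)%E.
Proof.
split=> [[f1 f2]|[mf foo]].
  have mf1 := measurable_int _ f1; have mf2 := measurable_int _ f2.
  have mf : cmfun f by split; exact/measurable_EFinP.
  split => //; apply: (@le_lt_trans _ _ (\int[mu]_x (`|(Re (f x))%:E| + `|(Im (f x))%:E|))%E).
    apply: ge0_le_integral => //.
    - by move=> x _; rewrite lee_fin cabs_ge0.
    - exact/measurable_EFinP/measurable_cabs.
    - by apply: emeasurable_funD; exact: measurableT_comp.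
    - by move=> x _; rewrite -EFinD lee_fin cabs_le_ReIm.
  rewrite ge0_integralD//; [|exact: measurableT_comp..].
  by case/integrableP : f1 => _ ?; case/integrableP : f2 => _ ?; exact: lte_add_pinfty.
have [mf1 mf2] := mf.
split; apply/integrableP; split; try exact/measurable_EFinP.
- apply: le_lt_trans foo; apply: ge0_le_integral => //.
  + exact/measurableT_comp/measurable_EFinP.
  + exact/measurable_EFinP/measurable_cabs.
  + by move=> x _; rewrite lee_fin cabs_ge_Re.
- apply: le_lt_trans foo; apply: ge0_le_integral => //.
  + exact/measurableT_comp/measurable_EFinP.
  + exact/measurable_EFinP/measurable_cabs.
  + by move=> x _; rewrite lee_fin cabs_ge_Im.
Qed.

Lemma le_cintegrable f g : cmeasurable f -> cintegrable g ->
  (forall x, cabs (f x) <= cabs (g x)) -> cintegrable f.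
Proof.
move=> mf /cintegrableP[mg goo] fg; apply/cintegrableP; split => //.
apply: le_lt_trans goo; apply: le_integral_EFin => // [||x]; try exact: measurable_cabs.
exact: cabs_ge0.
Qed.

Let integrableZ (c : R) (u : V -> R) : mu.-integrable setT (fun x => (u x)%:E) ->
  mu.-integrable setT (EFin \o (fun x => c * u x)).
Proof.
move=> ui; have := integrableZl measurableT c ui.
by apply: eq_integrable => // x _ /=; rewrite EFinM.
Qed.

Lemma cintegrableD f g : cintegrable f -> cintegrable g ->
  cintegrable (fun x => f x + g x).
Proof.
move=> [f1 f2] [g1 g2]; split.
  by under eq_fun do rewrite cReD EFinD; exact: integrableD.
by under eq_fun do rewrite cImD EFinD; exact: integrableD.
Qed.

Lemma cintegrableZ (c : C) f : cintegrable f -> cintegrable (fun x => c * f x).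
Proof.
move=> [f1 f2]; split.
  under eq_fun do rewrite cReM EFinB; apply: integrableB => //; exact: integrableZ.
by under eq_fun do rewrite cImM EFinD; apply: integrableD => //; exact: integrableZ.
Qed.

Lemma cintD f g : cintegrable f -> cintegrable g ->
  cint (fun x => f x + g x) = cint f + cint g.
Proof.
move=> [f1 f2] [g1 g2]; apply: complex_ext => /=.
  by under eq_Rintegral do rewrite cReD; rewrite RintegralD.
by under eq_Rintegral do rewrite cImD; rewrite RintegralD.
Qed.

Lemma cintZ (c : C) f : cintegrable f -> cint (fun x => c * f x) = c * cint f.
Proof.
move=> [f1 f2]; apply: complex_ext => /=.
  under eq_Rintegral do rewrite cReM; rewrite RintegralB//.
  - by rewrite !RintegralZl// cReM.
  - exact: integrableZ.
  - exact: integrableZ.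
under eq_Rintegral do rewrite cImM; rewrite RintegralD//.
- by rewrite !RintegralZl// cImM.
- exact: integrableZ.
- exact: integrableZ.
Qed.

Lemma cintegrable0 : cintegrable (fun _ : V => 0 : C).
Proof. by split => /=; exact: integrable0. Qed.

Lemma cint0 : cint (fun _ : V => 0 : C) = 0.
Proof. by apply: complex_ext; rewrite /= /Rintegral integral0. Qed.

Lemma cintegrable_sum I (r : seq I) (F : I -> V -> C) :
  (forall i, cintegrable (F i)) -> cintegrable (fun x => \sum_(i <- r) F i x).
Proof.
move=> iF; elim: r => [|i r IH].
  by under eq_fun do rewrite big_nil; exact: cintegrable0.
by under eq_fun do rewrite big_cons; exact: cintegrableD.
Qed.

Lemma cint_sum I (r : seq I) (F : I -> V -> C) :
  (forall i, cintegrable (F i)) ->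
  cint (fun x => \sum_(i <- r) F i x) = \sum_(i <- r) cint (F i).
Proof.
move=> iF; elim: r => [|i r IH].
  by under eq_fun do rewrite big_nil; rewrite big_nil cint0.
under eq_fun do rewrite big_cons.
by rewrite cintD//; [rewrite IH big_cons|exact: cintegrable_sum].
Qed.

Lemma cintJ f : cintegrable f -> cint (fun x => (f x)^*) = (cint f)^*.
Proof.
move=> [f1 f2]; apply: complex_ext; rewrite ?cReJ ?cImJ /=.
  by under eq_Rintegral do rewrite cReJ.
under eq_Rintegral do rewrite cImJ -mulN1r.
by rewrite RintegralZl// mulN1r.
Qed.

Let cabs_unimodular (x : C) : exists z, cabs z = 1 /\ z * x = (cabs x)%:C.
Proof.
have [->|x0] := eqVneq x 0; first by exists 1; rewrite mulr0 cabs0 Normc.normc1.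
have nx0 : cabs x != 0 by apply: contra x0 => /eqP/cabs_eq0 ->.
have cx0 : (cabs x)%:C != 0 by apply: contra nx0 => /eqP /complexI ->.
exists (x^* / (cabs x)%:C); split.
  by rewrite cabsM cabsJ Normc.normcV cabs_real ger0_norm ?cabs_ge0// mulfV.
rewrite mulrAC [_^* * _]mulrC (_ : x * x^* = (cabs x)%:C * (cabs x)%:C) ?mulfK//.
rewrite -rmorphM -expr2 cabsE sqr_sqrtr ?addr_ge0 ?sqr_ge0//.
by apply: complex_ext; rewrite ?cReM ?cImM ?cReJ ?cImJ/= mulrN; [rewrite opprK -!expr2|rewrite mulrC addNr].
Qed.

(** A unimodular factor [z] rotates the integral onto the positive real axis, where its modulus is
    the integral of [Re (z * f)]. If [|f|] is not integrable the right-hand side is [+oo]. *)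
Lemma le_cabs_cint f : cmeasurable f ->
  ((cabs (cint f))%:E <= \int[mu]_x (cabs (f x))%:E)%E.
Proof.
move=> mf.
have [foo|] := ltP (\int[mu]_x (cabs (f x))%:E)%E +oo%E; last first.
  by rewrite leye_eq => /eqP ->; rewrite leey.
have fi : cintegrable f by apply/cintegrableP.
have [z [nz zf]] := cabs_unimodular (cint f).
have zi := cintegrableZ z fi.
have -> : cabs (cint f) = \int[mu]_x Re (z * f x).
  by rewrite -[RHS]/(Re (cint (fun x => z * f x))) cintZ// zf.
have [zi1 _] := zi.
rewrite /Rintegral fineK; last exact: integrable_fin_num.
apply: le_integral => //.
  apply/integrableP; split; first exact/measurable_EFinP/measurable_cabs.
  by under eq_integral do rewrite gee0_abs ?lee_fin ?cabs_ge0//.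
move=> x _; rewrite lee_fin (le_trans (ler_norm _))// (le_trans (cabs_ge_Re _))//.
by rewrite cabsM nz mul1r.
Qed.

Lemma integrable_affine (r : R) (a : V) (u : V -> R) : r != 0 ->
  mu.-integrable setT (fun x => (u x)%:E) ->
  mu.-integrable setT (fun x => (u (r *: x + a))%:E).
Proof.
move=> r0 /integrableP[mu_ uoo]; apply/integrableP; split.
  exact: (measurableT_comp mu_ (measurable_rV_affine r a)).
move: uoo; rewrite (ge0_integral_affine a r0)//; last exact: measurableT_comp.
rewrite !ltey; apply: contra => /eqP ->.
by rewrite gt0_muley// lte_fin exprn_gt0 ?normr_gt0.
Qed.

Lemma Rintegral_affine (r : R) (a : V) (u : V -> R) : r != 0 ->
  mu.-integrable setT (fun x => (u x)%:E) ->
  \int[mu]_x u x = `|r| ^+ n * \int[mu]_x u (r *: x + a).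
Proof.
move=> r0 ui.
have mu_ := measurable_int _ ui.
have ui' := integrable_affine a r0 ui.
have mu' := measurable_int _ ui'.
have k0 : (0 <= `|r| ^+ n)%R by rewrite exprn_ge0.
apply: EFin_inj; rewrite EFinM /Rintegral !fineK; try exact: integrable_fin_num.
rewrite integralE [in RHS]integralE.
rewrite (ge0_integral_affine a r0)//; last exact: measurable_funepos.
rewrite [X in (_ - X)%E](ge0_integral_affine a r0)//; last exact: measurable_funeneg.
rewrite [RHS]muleBr//; last first.
  apply: fin_num_adde_defl; rewrite fin_numN.
  rewrite ge0_fin_numE; last exact: integral_ge0.
  exact: (integral_funeneg_lt_pinfty measurableT ui').
congr (_ - _)%E; congr (_ * _)%E; apply: eq_integral => x _.
  by rewrite (funepos_comp (fun x => (u x)%:E) (fun x => r *: x + a)).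
by rewrite (funeneg_comp (fun x => (u x)%:E) (fun x => r *: x + a)).
Qed.

Lemma cintegrable_affine (r : R) (a : V) f : r != 0 -> cintegrable f ->
  cintegrable (fun x => f (r *: x + a)).
Proof. by move=> r0 [f1 f2]; split; [exact: (integrable_affine a r0 f1)|exact: (integrable_affine a r0 f2)]. Qed.

Lemma cint_affine (r : R) (a : V) f : r != 0 -> cintegrable f ->
  cint f = (`|r| ^+ n)%:C * cint (fun x => f (r *: x + a)).
Proof.
move=> r0 [f1 f2]; apply: complex_ext; rewrite ?cReM ?cImM /= !mul0r ?subr0 ?addr0.
  exact: (Rintegral_affine a r0 f1).
exact: (Rintegral_affine a r0 f2).
Qed.

Local Notation VV := (V * V)%type.

(** Asking that every section be integrable, not just almost every one, makes all inner integrals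
    finite, so [fine] can be removed pointwise around Fubini's theorem. *)
Lemma Rintegral_fubini (F : V -> V -> R) :
  measurable_fun setT (fun z : VV => F z.1 z.2) ->
  (forall x, mu.-integrable setT (fun y => (F x y)%:E)) ->
  (forall y, mu.-integrable setT (fun x => (F x y)%:E)) ->
  (\int[mu]_x \int[mu]_y `|(F x y)%:E| < +oo)%E ->
  \int[mu]_x (\int[mu]_y F x y) = \int[mu]_y (\int[mu]_x F x y).
Proof.
move=> mF F1 F2 Foo.
pose G (z : VV) := (F z.1 z.2)%:E.
have mG : measurable_fun setT G by exact/measurable_EFinP.
have iG : ((mu \x mu).-integrable setT G)%E by apply/(integrable12ltyP _ _ mG).
have := Fubini iG; rewrite /G /= => FG.
rewrite /Rintegral; congr fine; rewrite (_ : (fun x => _) = (fun x => \int[mu]_y (F x y)%:E)%E); last first.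
  by apply/funext => x; rewrite fineK//; exact: integrable_fin_num.
rewrite FG; apply: eq_integral => y _.
by rewrite fineK//; exact: integrable_fin_num.
Qed.

Lemma cint_fubini (F : V -> V -> C) : cmfun (fun z : VV => F z.1 z.2) ->
  (forall x, cintegrable (F x)) -> (forall y, cintegrable (F^~ y)) ->
  (\int[mu]_x \int[mu]_y (cabs (F x y))%:E < +oo)%E ->
  cint (fun x => cint (F x)) = cint (fun y => cint (F^~ y)).
Proof.
move=> mF F1 F2 Foo; have [mF1 mF2] := mF.
have mc := measurable_cabs mF.
have mcabs x : measurable_fun setT (fun y => (cabs (F x y))%:E).
  by apply/measurable_EFinP/measurable_cabs; case/cintegrableP : (F1 x).
have mcF : measurable_fun setT (fun x => \int[mu]_y (cabs (F x y))%:E)%E.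
  apply: (measurable_fun_fubini_tonelli_F (m2 := mu) (fun z : VV => (cabs (F z.1 z.2))%:E)).
    exact/measurable_EFinP.
  by move=> z; rewrite lee_fin cabs_ge0.
have H (P : C -> R) : measurable_fun setT (fun z : VV => P (F z.1 z.2)) ->
    (forall x, mu.-integrable setT (fun y => (P (F x y))%:E)) -> (forall c, `|P c| <= cabs c) ->
    (\int[mu]_x \int[mu]_y `|(P (F x y))%:E| < +oo)%E.
  move=> mP iP Pc; apply: le_lt_trans Foo; apply: ge0_le_integral => //.
  - by move=> x _; exact: integral_ge0.
  - apply: (measurable_fun_fubini_tonelli_F (m2 := mu) (fun z : VV => `|(P (F z.1 z.2))%:E|%E)).
      exact/measurableT_comp/measurable_EFinP.
    by [].
  - move=> x _; apply: ge0_le_integral => //.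
      exact: (measurableT_comp _ (measurable_int _ (iP x))).
    by move=> y _; rewrite lee_fin Pc.
apply: complex_ext => /=.
- apply: (Rintegral_fubini mF1); [by move=> x; case: (F1 x)|by move=> x; case: (F2 x)|].
  by apply: H => //; [move=> x; case: (F1 x)|exact: cabs_ge_Re].
- apply: (Rintegral_fubini mF2); [by move=> x; case: (F1 x)|by move=> x; case: (F2 x)|].
  by apply: H => //; [move=> x; case: (F1 x)|exact: cabs_ge_Im].
Qed.

End complex_integral.

(** * Injectivity of the Fourier transform *)

(* Newton's scheme for sqrt(u^2): polynomials in u increasing to |u| on [-1, 1]. *)
Fixpoint abs_approx {R : realType} (k : nat) (u : R) : R :=
  if k is j.+1 then
    abs_approx j u + 2^-1 * (u * u + -1 * (abs_approx j u * abs_approx j u))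
  else 0.

Section fourier_uniqueness.
Context {R : realType} {n : nat}.
Local Notation V := 'rV[R]_n.
Local Notation mu := (@lebesgue_rV R n).
Implicit Types (g m : V -> R) (x xi : V).

Lemma dotpDr x (y z : V) : dotp x (y + z) = dotp x y + dotp x z.
Proof. by rewrite /dotp -big_split; apply: eq_bigr => i _; rewrite mxE mulrDr. Qed.

Lemma dotpNr x (y : V) : dotp x (- y) = - dotp x y.
Proof. by rewrite /dotp -sumrN; apply: eq_bigr => i _; rewrite mxE mulrN. Qed.

Lemma dotpZr x (y : V) (r : R) : dotp x (r *: y) = r * dotp x y.
Proof. by rewrite /dotp mulr_sumr; apply: eq_bigr => i _; rewrite mxE mulrCA. Qed.

Lemma dotpC x (y : V) : dotp x y = dotp y x.
Proof. by apply: eq_bigr => i _; rewrite mulrC. Qed.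

Lemma dotp_delta x i : dotp x (delta_mx ord0 i) = x ord0 i.
Proof.
rewrite /dotp (bigD1 i)//= big1 ?addr0 ?mxE ?eqxx ?mulr1// => j ji.
by rewrite mxE eqxx/= (negbTE ji) mulr0.
Qed.

Lemma measurable_dotp xi : measurable_fun setT (fun x => dotp x xi).
Proof.
rewrite (_ : (fun x => _) = (fun x => \sum_(i < n) (x ord0 i * xi ord0 i)))//.
apply: measurable_sum => i.
by apply: measurable_funM => //; exact: measurable_rV_coord.
Qed.

(** Real form of a vanishing Fourier transform. The free phase [t] covers cosine and sine at once
    and keeps the family stable under products of cosines. *)
Definition cos_orth g := mu.-integrable setT (fun x => (g x)%:E) /\
  forall xi t, \int[mu]_x (g x * cos (2 * pi * dotp x xi + t)) = 0.

(* The multipliers preserving orthogonality to all phases form an algebra closed under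
   bounded limits, so it contains |m| for each of its members m, hence the bumps below. *)
Definition cos_mult m := [/\ measurable_fun setT m,
  (exists K : R, forall x, `|m x| <= K) &
  forall g, cos_orth g -> cos_orth (fun x => g x * m x)].

Let measurable_phase xi t : measurable_fun setT (fun x => cos (2 * pi * dotp x xi + t)).
Proof.
apply: (measurableT_comp measurable_cos); apply: measurable_funD => //.
by apply: measurable_funM => //; exact: measurable_dotp.
Qed.

Let integrable_bounded g m (K : R) : mu.-integrable setT (fun x => (g x)%:E) ->
  measurable_fun setT m -> (forall x, `|m x| <= K) ->
  mu.-integrable setT (fun x => (g x * m x)%:E).
Proof.
move=> gi mm mK.
have mg := measurable_int _ gi.
have := integrableZl measurableT K (integrable_abse gi).
apply: le_integrable => //.
  by apply/measurable_EFinP/measurable_funM => //; exact/measurable_EFinP.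
move=> x _ /=; rewrite lee_fin normrM mulrC.
by rewrite (le_trans _ (ler_norm _))// ler_wpM2r.
Qed.

Let integrable_phase g xi t : mu.-integrable setT (fun x => (g x)%:E) ->
  mu.-integrable setT (fun x => (g x * cos (2 * pi * dotp x xi + t))%:E).
Proof. by move=> gi; apply: integrable_bounded => // x; exact: cos_max. Qed.

Lemma cos_mult_cst (c : R) : cos_mult (fun=> c).
Proof.
split=> //; first by exists `|c|.
move=> g [gi g0]; split; first exact: (@integrable_bounded _ _ `|c|).
move=> xi t; under eq_Rintegral do rewrite mulrAC.
by rewrite RintegralZr ?g0 ?mul0r//; exact: integrable_phase.
Qed.

Lemma cos_multD m1 m2 : cos_mult m1 -> cos_mult m2 -> cos_mult (fun x => m1 x + m2 x).
Proof.
move=> [mm1 [K1 mK1] H1] [mm2 [K2 mK2] H2]; split.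
- exact: measurable_funD.
- by exists (K1 + K2) => x; rewrite (le_trans (ler_normD _ _))// lerD.
- move=> g gZ; have [i1 z1] := H1 _ gZ; have [i2 z2] := H2 _ gZ; split.
    by under eq_fun do rewrite mulrDr EFinD; exact: integrableD.
  move=> xi t; under eq_Rintegral do rewrite mulrDr mulrDl.
  by rewrite RintegralD ?z1 ?z2 ?addr0//; exact: integrable_phase.
Qed.

Lemma cos_multM m1 m2 : cos_mult m1 -> cos_mult m2 -> cos_mult (fun x => m1 x * m2 x).
Proof.
move=> [mm1 [K1 mK1] H1] [mm2 [K2 mK2] H2]; split.
- exact: measurable_funM.
- by exists (K1 * K2) => x; rewrite normrM ler_pM.
- by move=> g /H1/H2; under [X in cos_orth X -> _]eq_fun do rewrite -mulrA.
Qed.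

(** The product formula for two cosines turns the extra factor into a change of frequency and
    phase. *)
Lemma cos_mult_cos xi t : cos_mult (fun x => cos (2 * pi * dotp x xi + t)).
Proof.
split; [exact: measurable_phase|by exists 1 => x; exact: cos_max|].
move=> g [gi g0]; split; first exact: integrable_phase.
move=> eta u.
have E x : g x * cos (2 * pi * dotp x xi + t) * cos (2 * pi * dotp x eta + u) =
    2^-1 * (g x * cos (2 * pi * dotp x (xi + eta) + (t + u))) +
    2^-1 * (g x * cos (2 * pi * dotp x (xi - eta) + (t - u))).
  have prodE (a b : R) : cos a * cos b = 2^-1 * cos (a + b) + 2^-1 * cos (a - b).
    by rewrite cosD cosB; field.
  rewrite -mulrA prodE mulrDr !(mulrCA (g x)) !dotpDr dotpNr.
  have E1 (p q v w : R) : 2 * pi * p + v + (2 * pi * q + w) = 2 * pi * (p + q) + (v + w).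
    by move: pi => P; ring.
  by rewrite opprD -mulrN !E1.
under eq_Rintegral do rewrite E.
have ph (z : V) v := integrable_phase z v gi.
have phZ (z : V) v : mu.-integrable setT (EFin \o (fun x => 2^-1 * (g x * cos (2 * pi * dotp x z + v)))).
  by have := integrableZl measurableT 2^-1 (ph z v); apply: eq_integrable => // x _ /=; rewrite EFinM.
rewrite RintegralD// !RintegralZl//; try exact: ph.
by rewrite !g0 !mulr0 addr0.
Qed.

(** Dominated convergence with majorant [K |g|]; hence the uniform bound on the sequence. *)
Lemma cos_mult_lim (m_ : nat -> V -> R) m (K : R) : (forall k, cos_mult (m_ k)) ->
  (forall k x, `|m_ k x| <= K) -> (forall x, m_ k x @[k --> \oo] --> m x) ->
  cos_mult m.
Proof.
move=> cm mK mlim.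
have mm : measurable_fun setT m.
  by apply: (@measurable_fun_cvg _ _ _ _ m_) => [k|x _]; [case: (cm k)|exact: mlim].
have mKm x : `|m x| <= K.
  have : `|m_ k x| @[k --> \oo] --> `|m x| by apply: cvg_norm; exact: mlim.
  by move=> /cvgr_to_le; apply; apply: nearW => k; exact: mK.
split => //; first by exists K.
move=> g gZ; have [gi g0] := gZ.
have gmi := integrable_bounded gi mm mKm.
split => // xi t.
have mg : measurable_fun setT g by apply/measurable_EFinP; exact: (measurable_int _ gi).
have ik k : mu.-integrable setT (fun x => (g x * m_ k x * cos (2 * pi * dotp x xi + t))%:E).
  by apply: integrable_phase; case: (cm k) => _ _ /(_ _ gZ)[].
have Kg := integrableZl measurableT K (integrable_abse gi).
have [||_ _ dc] := @dominated_convergence _ _ _ mu setT measurableT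
  (fun k x => (g x * m_ k x * cos (2 * pi * dotp x xi + t))%:E)
  (fun x => (g x * m x * cos (2 * pi * dotp x xi + t))%:E)
  (fun x => K%:E * `|(g x)%:E|)%E
  (fun k => measurable_int _ (ik k))
  (measurable_int _ (integrable_phase xi t gmi)) _
  Kg _.

- apply: nearW => x _; apply: cvg_EFin; first exact: nearW.
  by apply: cvgMl; apply: cvgMr; exact: mlim.
- apply: nearW => x k _; rewrite -EFinM lee_fin normrM -[leRHS]mulr1.
  by rewrite ler_pM ?cos_max// normrM mulrC ler_wpM2r.
rewrite /Rintegral (_ : (\int[mu]_x _)%E = 0%E)//.
have E0 k : (\int[mu]_x (g x * m_ k x * cos (2 * pi * dotp x xi + t))%:E = 0)%E.
  have [_ _ /(_ _ gZ)[_ /(_ xi t)]] := cm k.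
  rewrite /Rintegral => E0; rewrite -[LHS]fineK ?E0//; exact: integrable_fin_num.
move: dc; under eq_fun do rewrite E0.
by move/cvg_lim => <-//; rewrite lim_cst.
Qed.

(** The iterates of [abs_approx] are polynomials in [m], hence multipliers, and converge boundedly
    to [|m|] when [|m| <= 1]. A general bounded [m] is rescaled into this range. *)
Lemma cos_mult_abs m : cos_mult m -> cos_mult (fun x => `|m x|).
Proof.
have H (u : V -> R) : cos_mult u -> (forall x, `|u x| <= 1) -> cos_mult (fun x => `|u x|).
  move: m => _; move: u => m cm mK.
  pose p := @abs_approx R.
  have cmp k : cos_mult (fun x => p k (m x)).
    elim: k => [|k IH] /=; first exact: cos_mult_cst.
    apply: cos_multD => //; apply: cos_multM; first exact: cos_mult_cst.
    apply: cos_multD; first exact: cos_multM.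
    by apply: cos_multM; [exact: cos_mult_cst|exact: cos_multM].
  have pb k u : `|u| <= 1 -> 0 <= p k u /\ p k u <= `|u| /\
      `|u| - p k u <= `|u| * (1 - `|u| / 2) ^+ k.
    move=> u1; elim: k => [|k [p0 [pu IH]]] ; first by rewrite /p/= subr0 expr0 mulr1; split; [|split].
    rewrite {1 2 3}/p /= -/(p k u).
    have u0 := normr_ge0 u.
    have -> : u * u = `|u| * `|u| by rewrite -normrM ger0_norm// -expr2 sqr_ge0.
    set a := `|u| in u1 pu IH u0 *; set q := p k u in p0 pu IH *.
    (* One Newton step multiplies the error [a - q] by [1 - (a + q) / 2], which is at most
       [1 - a / 2]; this yields both monotonicity and the geometric rate. *)
    have E : a - (q + 2^-1 * (a * a + -1 * (q * q))) = (a - q) * (1 - (a + q) / 2) by field.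
    split; first by nra.
    split; first by rewrite -subr_ge0 E; apply: mulr_ge0; lra.
    rewrite E exprS mulrCA mulrC; apply: ler_pM => //; lra.
  apply: (@cos_mult_lim (fun k x => p k (m x)) _ 1) => //.
    by move=> k x; have [p0 [pu _]] := pb k _ (mK x); rewrite ger0_norm// (le_trans pu).
  (* At a zero of [m] the ratio [1 - |m x| / 2] equals 1 and gives no convergence, but there all
     iterates vanish. *)
  move=> x; have [m0|m0] := eqVneq (`|m x|) 0.
    rewrite (_ : (fun k => _) = (fun=> `|m x|)); first exact: cvg_cst.
    apply/funext => k; have [p0 [pu _]] := pb k _ (mK x).
    by apply/le_anti; rewrite pu m0 p0.
  have a0 : 0 < `|m x| by rewrite lt_def m0 /=.
  apply: (squeeze_cvgr (f := fun k => `|m x| - `|m x| * (1 - `|m x| / 2) ^+ k) (h := fun=> `|m x|)).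
  - apply: nearW => k; have [p0 [pu pk]] := pb k _ (mK x).
    by rewrite pu andbT lerBlDr -lerBlDl.
  - rewrite -[X in _ --> X]subr0 -[X in _ --> _ - X](mulr0 `|m x|).
    apply: cvgB; first exact: cvg_cst.
    apply: cvgMr; apply: cvg_expr; have := mK x; move: a0; set a := `|m x| => a0 a1.
    by rewrite ger0_norm; lra.
  - exact: cvg_cst.
move=> cm; have [_ [K mK] _] := cm.
pose K' := `|K| + 1.
have K0 : 0 < K' by rewrite ltr_wpDl.
have -> : (fun x => `|m x|) = (fun x => K' * `|K'^-1 * m x|).
  by apply/funext => x; rewrite normrM gtr0_norm ?invr_gt0// mulVKf// gt_eqF.
apply: cos_multM; first exact: cos_mult_cst.
apply: H; first by apply: cos_multM => //; exact: cos_mult_cst.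
move=> x; rewrite normrM gtr0_norm ?invr_gt0// ler_pdivrMl// mulr1.
by rewrite (le_trans (mK x))// (le_trans (ler_norm K))// lerDl.
Qed.

Lemma cos_mult_max m1 m2 : cos_mult m1 -> cos_mult m2 ->
  cos_mult (fun x => Num.max (m1 x) (m2 x)).
Proof.
move=> c1 c2.
rewrite (_ : (fun x => _) = (fun x => 2^-1 * ((m1 x + m2 x) + `|m1 x + -1 * m2 x|))).
  apply: cos_multM; first exact: cos_mult_cst.
  apply: cos_multD; first exact: cos_multD.
  by apply/cos_mult_abs/cos_multD => //; apply: cos_multM => //; exact: cos_mult_cst.
apply/funext => x; rewrite mulN1r.
case: (leP (m1 x) (m2 x)) => m12.
  by rewrite ler0_norm ?subr_le0//; field.
by rewrite gtr0_norm ?subr_gt0//; field.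
Qed.

Lemma cos_multN m : cos_mult m -> cos_mult (fun x => - m x).
Proof.
move=> cm; under eq_fun do rewrite -mulN1r.
by apply: cos_multM => //; exact: cos_mult_cst.
Qed.

Lemma cos_mult_prod (F : 'I_n -> V -> R) : (forall i, cos_mult (F i)) ->
  cos_mult (fun x => \prod_(i < n) F i x).
Proof.
move=> cF; elim: (index_enum _) => [|i s IH].
  by under eq_fun do rewrite big_nil; exact: cos_mult_cst.
by under eq_fun do rewrite big_cons; exact: cos_multM.
Qed.

(** The derivative of sine at 0 along a null sequence. It recovers a coordinate, which is not a
    bounded function, from sines, which are cosines with a shifted phase. *)
Let cvg_sin_scale (y : R) : k.+1%:R * sin (y / k.+1%:R) @[k --> \oo] --> y.
Proof.
have [->|y0] := eqVneq y 0.
  by under eq_fun do rewrite mul0r sin0 mulr0; exact: cvg_cst.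
have ds : is_derive (0 : R) 1 (@sin R) (cos 0) by exact: is_derive_sin.
have dv := @ex_derive _ _ _ _ _ _ _ ds.
have H : h^-1 *: ((@sin R \o shift 0) (h *: 1) - sin 0) @[h --> (0 : R)^'] --> 'D_1 (@sin R) 0.
  exact: dv.
rewrite derive_val cos0 in H.
have {}H := (cvgr_dnbhsP _ _ _).1 H (fun k => y / k.+1%:R) _.
rewrite -[X in _ --> X]mulr1.
rewrite (_ : (fun k => _) = (fun k => y * ((y / k.+1%:R)^-1 *: ((@sin R \o shift 0) ((y / k.+1%:R) *: 1) - sin 0)))).
  apply: cvgMr; apply: H; split => [k|]; first by rewrite mulf_neq0 ?invr_eq0.
  by rewrite -[X in _ --> X](mulr0 y); apply: cvgMr; exact: cvg_harmonic.
apply/funext => k; rewrite /= sin0 subr0 /shift/= addr0 [_%:A]mulr1.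
by rewrite [_ *: _]/(_ * _) mulrA invfM invrK mulrA mulfV// mul1r.
Qed.

(** Truncation of [u] to [[-d, d]], written with maxima and signs because multipliers are closed
    under these. *)
Definition clamp (d u : R) : R := Num.max (- d) (- Num.max (- d) (- u)).

Lemma clampE (d u : R) : 0 <= d -> `|u| <= d -> clamp d u = u.
Proof.
by rewrite /clamp ler_norml => d0 /andP[u1 u2]; rewrite !max_r ?opprK// ?lerN2.
Qed.

Lemma clamp_bound (d u : R) : 0 <= d -> `|clamp d u| <= d.
Proof.
move=> d0; rewrite /clamp ler_norml le_max lexx/= ge_max.
by apply/andP; split; [lra|rewrite lerNl le_max lexx].
Qed.

Lemma clamp_ge (d u : R) : 0 <= d -> d <= `|u| -> d <= `|clamp d u|.
Proof.
move=> d0; rewrite /clamp; case: (leP 0 u) => u0; rewrite ?(ger0_norm u0) ?(ltr0_norm u0) => du.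
  by rewrite (max_l (_ : - u <= - d)) ?lerN2// opprK max_r ?ger0_norm// (le_trans _ d0)// oppr_le0.
by rewrite (max_r (_ : - d <= - u)) ?opprK; [rewrite max_l ?normrN ?ger0_norm//; lra|lra].
Qed.

(** The rescaled sines converge to the coordinate without a uniform bound; clamping supplies the
    bound [d] needed for the limit and commutes with it by continuity. *)
Lemma cos_mult_clamp d c i : 0 <= d -> cos_mult (fun x => clamp d (x ord0 i - c)).
Proof.
move=> d0.
apply: (@cos_mult_lim (fun k x => clamp d (k.+1%:R * sin ((x ord0 i - c) / k.+1%:R))) _ d).
- move=> k; rewrite /clamp.
  apply: cos_mult_max; first exact: cos_mult_cst.
  apply/cos_multN/cos_mult_max; first exact: cos_mult_cst.
  apply/cos_multN/cos_multM; first exact: cos_mult_cst.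
  (* This frequency makes the phase equal to x_i/(k+1); the shift by pi/2 then turns the cosine into
     a sine. *)
  pose r := (2 * pi * k.+1%:R : R)^-1.
  rewrite (_ : (fun x => _) = (fun x => cos (2 * pi * dotp x (r *: delta_mx ord0 i) + (- (c / k.+1%:R) - pi / 2)))).
    exact: cos_mult_cos.
  apply/funext => x; rewrite dotpZr dotp_delta /r addrA cosB cos_pihalf sin_pihalf mulr0 add0r mulr1.
  congr sin; rewrite mulrBl; congr (_ - _).
  have := @pi_gt0 R; move: (@pi R) => P P0; field.
  by rewrite nat1r pnatr_eq0/= gt_eqF.
- by move=> k x; exact: clamp_bound.
- move=> x.
  have H := @cvg_sin_scale (x ord0 i - c).
  have cl : continuous (clamp d).
    move=> u; rewrite /clamp; apply: (@continuous_max R R (cst (- d)) (fun u => - Num.max (- d) (- u)) u).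
      exact: cst_continuous.
    apply: continuousN; apply: (@continuous_max R R (cst (- d)) (fun u => - u) u).
      exact: cst_continuous.
    exact: opp_continuous.
  by apply: continuous_cvg => //; exact: cl.
Qed.

(** The product of the tents (d - |x_i - c_i|)_+. The clamp does not change its values, but makes
    every factor a multiplier. *)
Definition bump d (c : V) (x : V) : R :=
  \prod_(i < n) Num.max 0 (d - `|clamp d (x ord0 i - c ord0 i)|).

Lemma cos_mult_bump (d : R) (c : V) : 0 <= d -> cos_mult (bump d c).
Proof.
move=> d0; apply: cos_mult_prod => i; apply: cos_mult_max; first exact: cos_mult_cst.
apply: cos_multD; first exact: cos_mult_cst.
by apply/cos_multN/cos_mult_abs; exact: cos_mult_clamp.
Qed.

Lemma bump_ge0 (d : R) (c x : V) : 0 <= bump d c x.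
Proof. by apply: prodr_ge0 => i _; rewrite le_max lexx. Qed.

Lemma bump_gt0 (d : R) (c x : V) : (forall i, `|x ord0 i - c ord0 i| < d) -> 0 < bump d c x.
Proof.
move=> xc; apply: prodr_gt0 => i _; rewrite lt_max subr_gt0 clampE ?xc ?orbT//.
  exact: (le_trans (normr_ge0 _) (ltW (xc i))).
exact: ltW.
Qed.

Lemma bump_neq0 (d : R) (c x : V) : 0 < d -> bump d c x != 0 -> `|x - c| < d.
Proof.
move=> d0; apply: contraNT; rewrite -leNgt => xc; have [k] := norm_ge_coord d0 xc; rewrite !mxE => di.
by apply/prodf_eq0; exists k => //; rewrite max_l// subr_le0 clamp_ge// ltW.
Qed.

(** If [g c > 0], a bump supported where [g] is positive gives a nonnegative product with zero
    integral, so the product vanishes almost everywhere. Yet it is positive on the cube with corner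
    [c] and side [d], whose measure is [d ^+ n]. *)
Lemma cos_orth_le0 g : continuous g -> cos_orth g -> forall c, g c <= 0.
Proof.
move=> cg gZ c; rewrite leNgt; apply/negP => gc0.
have /nbhs_ballP[d /= d0 gd] : \forall x \near c, 0 < g x.
  exact: (cvgr_gt _ (cg c) _ gc0).
(* Frequency 0 and phase 0: the integral of [g] times the bump itself is zero. *)
have [hi /(_ 0 0) h0] := (let: And3 _ _ H := cos_mult_bump c (ltW d0) in H) _ gZ.
have gb0 x : 0 <= g x * bump d c x.
  have [->|/(bump_neq0 d0) xc] := eqVneq (bump d c x) 0; first by rewrite mulr0.
  rewrite mulr_ge0 ?bump_ge0// ltW//; apply: gd.
  by rewrite -ball_normE /ball_/= distrC.
have h00 : (\int[mu]_x `|(g x * bump d c x)%:E| = 0)%E.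
  under eq_integral do rewrite gee0_abs ?lee_fin//.
  move: h0; rewrite /Rintegral => h0; rewrite -[LHS]fineK; last exact: integrable_fin_num.
  congr EFin; rewrite -[RHS]h0; congr fine; apply: eq_integral => x _.
  by rewrite /dotp big1 ?mulr0 ?add0r ?cos0 ?mulr1// => i _; rewrite mxE mulr0.
have [N [mN N0 cN]] := (ae_eq_integral_abs mu measurableT (measurable_int _ hi)).1 h00.
have : (mu (cube c d) <= mu N)%E.
  apply: le_measure; rewrite ?inE//; first exact: measurable_cube.
  move=> x xc; apply: cN => /= H; case: (H I) => /eqP; apply/negP; rewrite mulf_neq0//.
    rewrite gt_eqF//; apply: gd.
    rewrite -ball_normE /ball_/= distrC.
    rewrite ltNge; apply/negP => dxc; have [k] := norm_ge_coord d0 dxc; apply/negP; rewrite -ltNge !mxE.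
    by have /andP[ci di] := xc k; rewrite ger0_norm ?subr_ge0// ltrBlDl.
  rewrite gt_eqF//; apply: bump_gt0 => k.
  by have /andP[ci di] := xc k; rewrite ger0_norm ?subr_ge0// ltrBlDl.
have -> : mu N = 0%E by exact: N0.
have -> : mu (cube c d) = (d ^+ n)%:E by exact: lebesgue_rV_cube (ltW d0).
rewrite lee_fin; apply/negP; rewrite -ltNge.
exact: exprn_gt0.
Qed.

Lemma cos_orth_eq0 g : continuous g -> cos_orth g -> forall c, g c = 0.
Proof.
move=> cg gZ c; apply/le_anti/andP; split; first exact: cos_orth_le0.
have [_ _ /(_ _ gZ) gN] := cos_mult_cst (-1).
have := @cos_orth_le0 (fun x => g x * -1) _ gN c; rewrite mulrN1 oppr_le0; apply.
move=> x; under eq_fun do rewrite mulrN1.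
by apply: continuousN; exact: cg.
Qed.

(** The transform at [xi] and at [- xi] separates even from odd parts, so the cosine and sine
    integrals of the real and imaginary parts vanish one by one. *)
Lemma fourier_inj0 (f : V -> R[i]) : ccontinuous f -> cintegrable f ->
  (forall xi, fourier f xi = 0) -> forall x, f x = 0.
Proof.
move=> [cf1 cf2] [f1 f2] F0.
pose u x := complex.Re (f x); pose v x := complex.Im (f x).
pose th xi x := 2 * pi * dotp x xi.
have iph (g : V -> R) xi t : mu.-integrable setT (fun x => (g x)%:E) ->
    mu.-integrable setT (fun x => (g x * cos (th xi x + t))%:E) by exact: integrable_phase.
have iphc (g : V -> R) xi : mu.-integrable setT (fun x => (g x)%:E) ->
    mu.-integrable setT (EFin \o (fun x => g x * cos (th xi x))).
  by move=> /(iph _ xi 0); apply: eq_integrable => // x _; rewrite addr0.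
have iphs (g : V -> R) xi : mu.-integrable setT (fun x => (g x)%:E) ->
    mu.-integrable setT (EFin \o (fun x => g x * sin (th xi x))).
  move=> /(iph _ xi (- (pi / 2))); apply: eq_integrable => // x _ /=.
  by rewrite cosB cos_pihalf sin_pihalf mulr0 add0r mulr1.
have H1 xi : \int[mu]_x (u x * cos (th xi x)) + \int[mu]_x (v x * sin (th xi x)) = 0.
  have := F0 xi; rewrite /fourier /cint => -[+ _].
  rewrite -RintegralD//; [|exact: iphc|exact: iphs].
  by move=> <-; apply: eq_Rintegral => x _; rewrite cReM /= mulrN opprK.
have H2 xi : \int[mu]_x (v x * cos (th xi x)) - \int[mu]_x (u x * sin (th xi x)) = 0.
  have := F0 xi; rewrite /fourier /cint => -[_ +].
  rewrite -RintegralB//; [|exact: iphc|exact: iphs].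
  by move=> <-; apply: eq_Rintegral => x _; rewrite cImM /= mulrN addrC.
have thN xi x : th (- xi) x = - th xi x by rewrite /th dotpNr mulrN.
have cN (g : V -> R) xi : \int[mu]_x (g x * cos (th (- xi) x)) = \int[mu]_x (g x * cos (th xi x)).
  by apply: eq_Rintegral => x _; rewrite thN cosN.
have sN (g : V -> R) xi : mu.-integrable setT (fun x => (g x)%:E) ->
   \int[mu]_x (g x * sin (th (- xi) x)) = - \int[mu]_x (g x * sin (th xi x)).
  move=> gi; rewrite -mulN1r -RintegralZl//; last exact: iphs.
  by apply: eq_Rintegral => x _; rewrite thN sinN mulN1r mulrN.
have K1 xi : \int[mu]_x (u x * cos (th xi x)) = 0.
  by have := H1 xi; have := H1 (- xi); rewrite cN sN//; lra.
have K2 xi : \int[mu]_x (v x * sin (th xi x)) = 0.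
  by have := H1 xi; rewrite K1; lra.
have K3 xi : \int[mu]_x (v x * cos (th xi x)) = 0.
  by have := H2 xi; have := H2 (- xi); rewrite cN sN//; lra.
have K4 xi : \int[mu]_x (u x * sin (th xi x)) = 0.
  by have := H2 xi; rewrite K3; lra.
have Z (g : V -> R) : mu.-integrable setT (fun x => (g x)%:E) ->
    (forall xi, \int[mu]_x (g x * cos (th xi x)) = 0) ->
    (forall xi, \int[mu]_x (g x * sin (th xi x)) = 0) -> cos_orth g.
  move=> gi c0 s0; split => // xi t.
  transitivity (\int[mu]_x (g x * cos (th xi x) * cos t - g x * sin (th xi x) * sin t)).
    by apply: eq_Rintegral => x _; rewrite -/(th xi x) cosD; ring.
  have cc := iphc _ xi gi; have ss := iphs _ xi gi.
  have cZ (h : V -> R) (k : R) : mu.-integrable setT (EFin \o h) -> mu.-integrable setT (EFin \o (fun x => h x * k)).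
    by move=> hi; have := integrableZr measurableT k hi; apply: eq_integrable => // x _ /=; rewrite EFinM.
  rewrite RintegralB//; [|exact: cZ|exact: cZ].
  by rewrite !RintegralZr// c0 s0 !mul0r subr0.
move=> x; apply: complex_ext => /=.
  exact: (cos_orth_eq0 cf1 (Z _ f1 K1 K4)).
exact: (cos_orth_eq0 cf2 (Z _ f2 K3 K2)).
Qed.

End fourier_uniqueness.

(** * Envelopes and the zeta series *)

Section series_bounds.
Context {R : realType}.

Lemma nneseries_le (u : nat -> \bar R) (c : \bar R) (m : nat) :
  (forall i, (0 <= u i)%E) -> (forall N, (\sum_(m <= i < N) u i <= c)%E) ->
  (\sum_(m <= i <oo) u i <= c)%E.
Proof.
move=> u0 uc; apply: lime_le; first by apply: is_cvg_nneseries.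
by apply: nearW => N; exact: uc.
Qed.

(** Young's inequality for the product [t * 1] with exponents [g] and [g / (g - 1)]. *)
Lemma powR_bernoulli (t g : R) : 0 <= t -> 1 <= g -> g * t <= t `^ g + (g - 1).
Proof.
move=> t0; rewrite le_eqVlt => /predU1P[<-|g1].
  by rewrite mul1r powRr1// subrr addr0.
have g0 : 0 < g by rewrite (lt_trans _ g1).
have gn : g != 0 by rewrite gt_eqF.
have g1n : g - 1 != 0 by rewrite subr_eq0 gt_eqF.
have q0 : 0 < g / (g - 1) by rewrite divr_gt0// subr_gt0.
have := conjugate_powR t0 ler01 g0 q0.
rewrite powR1 mulr1 => H.
have {}H : t <= t `^ g / g + (g - 1) / g.
  rewrite (le_trans (H _))//; first by field; rewrite gn g1n.
  by rewrite mul1r invf_div.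
rewrite -ler_pdivlMl// (le_trans H)//.
by rewrite -mulrDl mulrC.
Qed.

(** Bernoulli's inequality at [y / x], multiplied by [x ^ g]; a mean value estimate that includes
    [y = 0]. *)
Lemma powR_diff_le (x y g : R) : 0 <= y -> y <= x -> 0 < x -> 1 <= g ->
  x `^ g - y `^ g <= g * x `^ (g - 1) * (x - y).
Proof.
move=> y0 yx x0 g1.
have PE : (y / x) `^ g = y `^ g / x `^ g.
  by rewrite powRM ?invr_ge0 ?(ltW x0)// -powR_inv1 ?(ltW x0)// -powRrM mulN1r powRN.
have := powR_bernoulli (divr_ge0 y0 (ltW x0)) g1; rewrite PE => H.
have xg : 0 < x `^ g by rewrite powR_gt0.
have E : x `^ g = x `^ (g - 1) * x.
  by rewrite -{3}(powRr1 (ltW x0)) -powRD ?subrK// (gt_eqF x0) implybT.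
have H2 : g * (y / x) * x `^ g <= y `^ g + (g - 1) * x `^ g.
  by have := ler_wpM2r (ltW xg) H; rewrite mulrDl -[X in _ <= X + _]mulrA mulVf ?gt_eqF// mulr1.
have E2 : g * (y / x) * x `^ g = g * y * x `^ (g - 1).
  by rewrite E; field; rewrite gt_eqF.
rewrite E2 in H2.
have -> : g * x `^ (g - 1) * (x - y) = g * x `^ g - g * y * x `^ (g - 1) by rewrite E; ring.
lra.
Qed.

(** A discrete form of the integral test: ln(1+x) <= x bounds a term of exponent 1+a by a difference
    that telescopes. *)
Lemma powR_telescope (a : R) (i : nat) : 0 < a ->
  a * (i.+2%:R : R) `^ (- (1 + a)) <= i.+1%:R `^ (- a) - i.+2%:R `^ (- a).
Proof.
move=> a0; pose x : R := i.+2%:R; pose y : R := i.+1%:R.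
have x0 : 0 < x by []. have y0 : 0 < y by [].
have xy : x = y + 1 by rewrite /x /y -natr1.
rewrite -/x -/y opprD powRD ?(gt_eqF x0) ?implybT// powR_inv1 ?(ltW x0)//.
have -> : y `^ (- a) = (y / x) `^ (- a) * x `^ (- a).
  by rewrite -powRM ?divr_ge0 ?(ltW x0) ?(ltW y0)// divfK// gt_eqF.
rewrite -[X in _ - X]mul1r -mulrBl mulrA ler_wpM2r ?powR_ge0// lerBrDl.
have yx0 : 0 < y / x by rewrite divr_gt0.
rewrite /powR gt_eqF// (le_trans _ (expR_ge1Dx _))// lerD2l mulNr -mulrN ler_wpM2l ?(ltW a0)//.
have -> : y / x = 1 + - x^-1 by rewrite (_ : y = x - 1) ?mulrBl ?mulfV ?mul1r ?gt_eqF// xy addrK.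
rewrite lerNr; apply: le_ln1Dx; rewrite ltrN2 invf_lt1// /x ltr1n; exact: isT.
Qed.

Lemma zeta_le (z : R) : 1 < z -> (zeta z <= (1 + (z - 1)^-1)%:E)%E.
Proof.
move=> z1; pose a := z - 1; have a0 : 0 < a by rewrite subr_gt0.
have zE : z = 1 + a by rewrite /a addrC subrK.
apply: nneseries_le => [i|N]; first by rewrite lee_fin powR_ge0.
rewrite sumEFin lee_fin.
have [|N1] := leqP N 1.
  by move=> N1; rewrite big_geq// addr_ge0// invr_ge0 ltW.
(* The remainder of the telescoping sum is kept, so that the induction closes. *)
suff : \sum_(1 <= i < N) (i%:R : R) `^ (- z) <= 1 + a^-1 * (1 - (N.-1)%:R `^ (- a)).
  move=> /le_trans; apply; rewrite lerD2l -[leRHS]mulr1 ler_wpM2l ?invr_ge0 ?(ltW a0)//.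
case: N N1 => // -[//|N] _; elim: N => [|N IH].
  by rewrite big_nat1 !powR1 subrr mulr0 addr0.
rewrite big_nat_recr//= (le_trans (lerD IH (lexx _)))// -addrA lerD2l.
have T := powR_telescope N a0.
rewrite /= in T *; rewrite zE; set P := _ `^ (- (1 + a)) in T *.
set Y := N.+1%:R `^ _ in T *; set X := _ `^ (- a) in T *.
have -> : P = a^-1 * (a * P) by rewrite mulKf// gt_eqF.
by rewrite -mulrDr ler_wpM2l ?invr_ge0 ?(ltW a0)//; lra.
Qed.

(** Summation by parts moves the differences from [b] to the powers (2i+1)^g. Their increments are
    at most 2g (2i+3)^(g-1), and 2i+3 <= 3(i+1) produces the factor 2g 3^(g-1); the decay of [b]
    turns what remains into a zeta series. *)
Lemma envelope_series_le (g si D : R) (b : nat -> R) : 1 <= g -> 0 <= D ->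
  (forall i, 0 <= b i) -> (forall i, b i.+1 <= b i) -> b 0%N <= D ->
  (forall i, b i.+1 <= D * i.+1%:R `^ (- si)) ->
  (envelope_series g (EFin \o b) <=
    D%:E * (1 + (2 * g * 3 `^ (g - 1))%:E * zeta (1 + si - g)))%E.
Proof.
move=> g1 D0 b0 bd bD bi; pose v (i : nat) : R := (2 * i + 1)%:R `^ g.
have v0 i : 0 <= v i by exact: powR_ge0.
pose c := 2 * g * 3 `^ (g - 1).
have c0 : 0 <= c by rewrite !mulr_ge0 ?powR_ge0// (le_trans _ g1).
pose Z (i : nat) : R := i%:R `^ (- (1 + si - g)).
have core N : b N.+1 * (v N.+1 - v N) <= D * c * Z N.+1.
  have vd : v N.+1 - v N <= c * N.+1%:R `^ (g - 1).
    have y0 : 0 <= (2 * N + 1)%:R :> R by [].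
    have yx : (2 * N + 1)%:R <= (2 * N.+1 + 1)%:R :> R.
      by rewrite ler_nat leq_add2r leq_mul2l leqnSn.
    have x0 : 0 < (2 * N.+1 + 1)%:R :> R by rewrite ltr0n addn1.
    rewrite (le_trans (powR_diff_le y0 yx x0 g1))//.
    have -> : ((2 * N.+1 + 1)%:R - (2 * N + 1)%:R : R) = 2.
      by rewrite -[RHS]/(2%:R) (_ : (2 * N.+1 + 1)%N = (2 + (2 * N + 1))%N) ?natrD ?addrK//; lia.
    rewrite [leLHS](_ : _ = 2 * g * (2 * N.+1 + 1)%:R `^ (g - 1)); last by ring.
    rewrite /c -[leRHS]mulrA ler_wpM2l ?mulr_ge0//; first exact: (le_trans _ g1).
    rewrite -powRM//; apply: ge0_ler_powR; rewrite ?nnegrE ?mulr_ge0 ?subr_ge0//.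
    by rewrite -natrM ler_nat; lia.
  rewrite (le_trans (ler_wpM2l (b0 _) vd))//.
  have cN0 : 0 <= c * N.+1%:R `^ (g - 1) by rewrite mulr_ge0 ?powR_ge0.
  rewrite (le_trans (ler_wpM2r cN0 (bi N)))// /Z.
  have -> : - (1 + si - g) = - si + (g - 1) by ring.
  have -> : (N.+1%:R : R) `^ (- si + (g - 1)) = N.+1%:R `^ (- si) * N.+1%:R `^ (g - 1).
    by rewrite [LHS]powRD// pnatr_eq0 implybT.
  by rewrite mulrACA.
(* The boundary term of the summation by parts is carried through the induction and dropped only at
   the end. *)
have key N : \sum_(0 <= i < N.+1) (b i - b i.+1) * v i <=
    D + D * c * \sum_(1 <= i < N.+1) Z i - b N.+1 * v N.
  elim: N => [|N IH].
    rewrite big_nat1 big_geq// mulr0 addr0 /v muln0 powR1 !mulr1.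
    by rewrite lerD2r.
  rewrite big_nat_recr//= [in leRHS]big_nat_recr//= mulrDr.
  have := core N; rewrite mulrBr [(b N.+1 - _) * _]mulrBl; lra.
have termE i : (((b i)%:E - (b i.+1)%:E) * ((2 * i + 1)%:R `^ g)%:E)%E = ((b i - b i.+1) * v i)%:E.
  by rewrite -EFinB -EFinM.
apply: nneseries_le => [i|N].
  by rewrite /= termE lee_fin mulr_ge0// subr_ge0.
under eq_bigr do rewrite /= termE.
rewrite sumEFin -/c.
have Zle : ((\sum_(1 <= i < N) Z i)%:E <= zeta (1 + si - g))%E.
  rewrite -sumEFin; apply: nneseries_lim_ge => i _ _.
  by rewrite lee_fin powR_ge0.
apply: (@le_trans _ _ (D * (1 + c * \sum_(1 <= i < N) Z i))%:E); last first.
  rewrite EFinM EFinD EFinM; apply: lee_wpmul2l; first by rewrite lee_fin.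
  by apply: leeD => //; apply: lee_wpmul2l; rewrite ?lee_fin.
case: N Zle => [|N] _; first by rewrite !big_geq// mulr0 addr0 mulr1 lee_fin.
rewrite lee_fin (le_trans (key N))// mulrDr mulr1 mulrA gerBl.
by rewrite mulr_ge0.
Qed.

Lemma envelope_series_lty (g si D : R) (b : nat -> R) : 1 <= g -> g < si -> 0 <= D ->
  (forall i, 0 <= b i) -> (forall i, b i.+1 <= b i) -> b 0%N <= D ->
  (forall i, b i.+1 <= D * i.+1%:R `^ (- si)) ->
  (envelope_series g (EFin \o b) < +oo)%E.
Proof.
move=> g1 gsi D0 b0 bd bD bi.
have z1 : 1 < 1 + si - g by lra.
apply: le_lt_trans (envelope_series_le g1 D0 b0 bd bD bi) _.
apply: (@le_lt_trans _ _ (D * (1 + (2 * g * 3 `^ (g - 1)) * (1 + (1 + si - g - 1)^-1)))%:E).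
  set c := 2 * g * _; rewrite [in leRHS]EFinM [in leRHS]EFinD [in leRHS]EFinM.
  apply: lee_wpmul2l; first by rewrite lee_fin.
  apply: leeD => //; apply: lee_wpmul2l; last exact: zeta_le.
  by rewrite lee_fin !mulr_ge0 ?powR_ge0// (le_trans _ g1).
exact: ltry.
Qed.

End series_bounds.

Section envelopes.
Context {R : realType} {n : nat}.
Local Notation V := 'rV[R]_n.
Local Notation C := R[i].
Hypothesis n_gt0 : (1 <= n)%N.
Implicit Types h : V -> C.

Lemma envelope_anti h i : (envelope h i.+1 <= envelope h i)%E.
Proof.
apply: ereal_sup_le => _ [z /= iz <-]; exists z => //=.
by rewrite (le_trans _ iz)// lerD2r ler_nat.
Qed.

(** The supremum of an empty set would be [-oo]; with at least one coordinate a constant vector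
    supplies a point of large enough norm. *)
Lemma envelope_ge0 h i : (0 <= envelope h i)%E.
Proof.
apply: ereal_sup_ge; exists (cabs (h (const_mx i%:R)))%:E; last by rewrite lee_fin cabs_ge0.
exists (const_mx i%:R) => //=.
have := coord_le_norm (const_mx i%:R : V) (Ordinal n_gt0); rewrite mxE => /(le_trans _); apply.
by rewrite ger0_norm// gerBl.
Qed.

Definition envr h i : R := fine (envelope h i).

Variables (h : V -> C) (D si : R).
Hypotheses (D0 : 0 <= D) (si0 : 0 < si)
  (hD : forall z, cabs (h z) <= D * (1 + `|z|) `^ (- si)).

Lemma envelope_le i : (envelope h i <= (D * (Num.max 1 i%:R) `^ (- si))%:E)%E.
Proof.
apply: ge_ereal_sup => _ [z /= iz <-]; rewrite lee_fin (le_trans (hD z))// ler_wpM2l//.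
rewrite !powRN lef_pV2 ?posrE ?powR_gt0// ?lt_max ?ltr01 ?ltr_wpDr//.
apply: ge0_ler_powR; rewrite ?nnegrE ?le_max ?ler01 ?addr_ge0 ?(ltW si0)//.
by rewrite ge_max lerDl normr_ge0/= addrC -lerBlDr.
Qed.

Lemma envrE i : envelope h i = (envr h i)%:E.
Proof.
rewrite /envr fineK// ge0_fin_numE ?envelope_ge0//.
exact: le_lt_trans (envelope_le i) (ltry _).
Qed.

Lemma envr_ge0 i : 0 <= envr h i.
Proof. by rewrite -lee_fin -envrE envelope_ge0. Qed.

Lemma envr_anti i : envr h i.+1 <= envr h i.
Proof. by rewrite -lee_fin -!envrE envelope_anti. Qed.

Lemma envr0 : envr h 0%N <= D.
Proof.
rewrite -lee_fin -envrE (le_trans (envelope_le 0))// lee_fin.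
by rewrite max_l// powR1 mulr1.
Qed.

Lemma envrS i : envr h i.+1 <= D * i.+1%:R `^ (- si).
Proof.
rewrite -lee_fin -envrE (le_trans (envelope_le _))// lee_fin max_r//.
by rewrite ler1n.
Qed.

Lemma envelopeE : envelope h = EFin \o envr h.
Proof. by apply/funext => i; rewrite envrE. Qed.

Lemma envr_small (e : R) : 0 < e -> exists N, forall i, (N <= i)%N -> envr h i <= e.
Proof.
move=> e0; pose D' := D + 1; have D'0 : 0 < D' by rewrite ltr_wpDl.
(* The solution of [D' * t ^ (- si) = e]; [D' = D + 1] keeps the quotient meaningful when [D] is
   0. *)
pose t := (e / D') `^ (- si^-1).
have t0 : 0 < t by rewrite powR_gt0// divr_gt0.
exists (Num.trunc t).+1 => -[//|i] Ni; rewrite (le_trans (envrS i))//.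
apply: (@le_trans _ _ (D' * t `^ (- si))).
  apply: ler_pM; rewrite ?powR_ge0 ?lerDl//.
  rewrite !powRN lef_pV2 ?posrE ?powR_gt0 ?divr_gt0//.
  apply: ge0_ler_powR; rewrite ?nnegrE ?(ltW si0) ?(ltW t0)//.
  by rewrite (le_trans (ltW (truncnS_gt t)))// ler_nat.
by rewrite /t -powRrM mulrNN mulVf ?gt_eqF// powRr1 ?divr_ge0 ?(ltW e0) ?(ltW D'0)// mulrC divfK ?gt_eqF.
Qed.

(** Take the least [m] with [z] in [-m, m+1)^n. For positive [m], [z] lies outside the previous
    cube, so [|z| >= m - 1], which is the shift in the definition of the envelope, and [|h z|] is at
    most its m-th value. The layers from [m] on telescope to that value because the envelope tends
    to 0. *)
Lemma envelope_pointwise (z : V) :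
  ((cabs (h z))%:E <= \sum_(0 <= i <oo)
    ((envr h i - envr h i.+1) * \1_(cube (const_mx (- i%:R)) (2 * i + 1)%:R) z)%:E)%E.
Proof.
pose Q (i : nat) : set V := cube (const_mx (- i%:R)) (2 * i + 1)%:R.
have QE i : Q i z <-> forall t, - i%:R <= z ord0 t < i%:R + 1.
  have E : - i%:R + (2 * i + 1)%:R = i%:R + 1 :> R by rewrite natrD natrM; ring.
  by split=> H t; have := H t; rewrite mxE E.
have term0 i : (0 <= ((envr h i - envr h i.+1) * \1_(Q i) z)%:E)%E.
  by rewrite lee_fin mulr_ge0 ?subr_ge0 ?envr_anti.
have ex : exists i, `[< Q i z >].
  exists (Num.trunc `|z|).+1; apply/asboolP/QE => t.
  have := coord_le_norm z t; rewrite ler_norml => /andP[z1 z2].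
  have zt := ltW (truncnS_gt `|z|).
  by rewrite (le_trans _ z1) ?lerN2//= (le_lt_trans z2)// (le_lt_trans zt)// ltrDl.
have [m /asboolP Qm mmin] := ex_minnP ex.
have hm : cabs (h z) <= envr h m.
  rewrite -lee_fin -envrE; apply: ereal_sup_ubound; exists z => //=.
  case: m Qm mmin => [|m] Qm mmin; first by rewrite sub0r (le_trans _ (normr_ge0 z))// lerN10.
  rewrite -natr1 addrK leNgt; apply/negP => zm.
  suff /asboolP /mmin : Q m z by rewrite ltnn.
  apply/QE => t; have := coord_le_norm z t; rewrite ler_norml => /andP[z1 z2].
  by rewrite (le_trans _ z1) ?lerN2 ?(ltW zm)//= (le_lt_trans z2)// (lt_trans zm)// ltrDl.
apply/lee_addgt0Pr => e e0; have [N Ne] := envr_small e0.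
apply: (@le_trans _ _ (envr h m)%:E); first by rewrite lee_fin.
pose K := maxn m N.
have H : ((envr h m - envr h K)%:E <= \sum_(0 <= i <oo) ((envr h i - envr h i.+1) * \1_(Q i) z)%:E)%E.
  apply: le_trans (nneseries_lim_ge K (fun i _ _ => term0 i)).
  rewrite sumEFin lee_fin (big_cat_nat (n := m))//= ?leq_maxl//.
  rewrite ler_wpDl ?sumr_ge0//; first by move=> i _; rewrite -lee_fin.
  have mK : (m <= K)%N by rewrite leq_maxl.
  have -> : envr h m - envr h K = \sum_(m <= i < K) (envr h i - envr h i.+1).
    rewrite -[LHS]opprK opprB -(telescope_sumr (envr h) mK) -sumrN.
    by apply: eq_bigr => i _; rewrite opprB.
  apply: ler_sum_nat => i /andP[mi _].
  rewrite indicE mem_set ?mulr1//; apply/QE => t; have /QE/(_ t)/andP[z1 z2] := Qm.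
  have mi' : (m%:R : R) <= i%:R by rewrite ler_nat.
  by rewrite (le_trans _ z1) ?lerN2//= (lt_le_trans z2)// lerD2r.
rewrite -leeBlDr//; apply: le_trans H; rewrite -EFinB lee_fin lerB//.
by apply: Ne; rewrite leq_maxr.
Qed.

End envelopes.

(** * Convolution and rapid decay *)

Section euclidean_norm.
Context {R : realType} {n : nat}.
Local Notation V := 'rV[R]_n.
Implicit Types x y : V.

Lemma dotp_ge0 x : 0 <= dotp x x.
Proof. by apply: sumr_ge0 => i _; rewrite -expr2 sqr_ge0. Qed.

Lemma enorm_ge0 x : 0 <= enorm x. Proof. exact: sqrtr_ge0. Qed.

Lemma enorm_sqr x : enorm x ^+ 2 = dotp x x.
Proof. by rewrite sqr_sqrtr// dotp_ge0. Qed.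

Lemma norm_le_enorm x : `|x| <= enorm x.
Proof.
apply: norm_le_coord => [|k]; first exact: enorm_ge0.
rewrite -sqrtr_sqr ler_wsqrtr// /dotp (bigD1 k)//= expr2 lerDl.
by apply: sumr_ge0 => j _; rewrite -expr2 sqr_ge0.
Qed.

(** Cauchy-Schwarz, from the nonnegative square of [enorm y *: x - enorm x *: y]; a vanishing norm
    is treated apart. *)
Lemma dotp_le x y : dotp x y <= enorm x * enorm y.
Proof.
have [ex ey] := (enorm_ge0 x, enorm_ge0 y).
have [xy0|xy0] := eqVneq (enorm x * enorm y) 0.
  rewrite xy0; suff -> : dotp x y = 0 by [].
  move/eqP: xy0; rewrite mulf_eq0 => /orP[] /eqP z0.
    have x0 k : x ord0 k = 0.
      apply/eqP; rewrite -normr_le0 (le_trans (coord_le_norm x k))//.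
      by rewrite (le_trans (norm_le_enorm x)) ?z0.
    by rewrite /dotp big1// => k _; rewrite x0 mul0r.
  have y0 k : y ord0 k = 0.
    apply/eqP; rewrite -normr_le0 (le_trans (coord_le_norm y k))//.
    by rewrite (le_trans (norm_le_enorm y)) ?z0.
  by rewrite /dotp big1// => k _; rewrite y0 mulr0.
have xy : 0 < enorm x * enorm y by rewrite lt_def xy0 mulr_ge0.
have := dotp_ge0 (enorm y *: x - enorm x *: y).
rewrite dotpDr dotpNr !dotpZr ![dotp _ x]dotpC ![dotp _ y]dotpC !dotpDr !dotpNr !dotpZr.
rewrite -!enorm_sqr (dotpC y x).
move: ex ey xy; set A := enorm x; set B := enorm y; set d := dotp x y => A0 B0 AB0 H.
have {H}H : 0 <= (A * B) * (A * B - d) by nra.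
by move: H; rewrite pmulr_rge0// subr_ge0.
Qed.

Lemma enormD x y : enorm (x + y) <= enorm x + enorm y.
Proof.
rewrite -(ler_pXn2r (n := 2))// ?nnegrE ?addr_ge0 ?enorm_ge0//.
rewrite enorm_sqr sqrrD !enorm_sqr dotpDr ![dotp (x + y) _]dotpC !dotpDr (dotpC y x).
have := dotp_le x y; lra.
Qed.

Lemma enormZ (r : R) x : enorm (r *: x) = `|r| * enorm x.
Proof.
rewrite /enorm dotpZr dotpC dotpZr mulrA -expr2 sqrtrM ?sqr_ge0//.
by rewrite sqrtr_sqr.
Qed.

Lemma enormN x : enorm (- x) = enorm x.
Proof. by rewrite -scaleN1r enormZ normrN normr1 mul1r. Qed.

Lemma peetre x y : 1 + enorm x <= (1 + enorm (x - y)) * (1 + enorm y).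
Proof.
have := enormD (x - y) y; rewrite subrK.
have := enorm_ge0 (x - y); have := enorm_ge0 y; have := enorm_ge0 x; nra.
Qed.

Lemma measurable_enorm : measurable_fun [set: V] enorm.
Proof.
have ms : measurable_fun [set: R] (@Num.sqrt R).
  by apply: continuous_measurable_fun => x; exact: sqrt_continuous.
apply: (measurableT_comp ms).
rewrite (_ : (fun x => _) = (fun x : V => \sum_(i < n) (x ord0 i * x ord0 i)))//.
apply: measurable_sum => k.
by apply: measurable_funM; exact: measurable_rV_coord.
Qed.

(** Dominated convergence is a statement about sequences; this criterion turns it into continuity of
    a convolution. *)
Lemma seq_continuous_rV (f : V -> R) (p : V) :
  (forall u : nat -> V, u k @[k --> \oo] --> p -> f (u k) @[k --> \oo] --> f p) ->
  {for p, continuous f}.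
Proof.
move=> H; apply/(@cvgrPdist_lt _ _ _ (nbhs p) (nbhs_filter p) f (f p)) => e e0.
apply: contrapT => nH.
have K (k : nat) : exists x : V, `|p - x| < k.+1%:R^-1 /\ e <= `|f p - f x|.
  apply: contrapT => /forallNP nx; apply: nH.
  apply/nbhs_ballP; exists k.+1%:R^-1 => /=; first by rewrite invr_gt0.
  move=> x; rewrite -ball_normE /= => px; rewrite ltNge; apply/negP => fx.
  by apply: (nx x).
have [u up] := choice K.
have uc : u k @[k --> \oo] --> p.
  apply/cvgrPdist_lt => d d0; near=> k.
  rewrite (lt_trans (up k).1)//; near: k; exact: (near_infty_natSinv_lt (PosNum d0)).
have /cvgrPdist_lt/(_ _ e0)[N _ /(_ N (leqnn _))] := H u uc.
by move=> /=; rewrite ltNge (up N).2.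
Unshelve. all: by end_near. Qed.

Lemma continuous_seq_rV (f : V -> R) (p : V) (u : nat -> V) : {for p, continuous f} ->
  u k @[k --> \oo] --> p -> f (u k) @[k --> \oo] --> f p.
Proof. by move=> cf up; apply: continuous_cvg. Qed.

End euclidean_norm.

Section decay.
Context {R : realType} {n : nat}.
Local Notation V := 'rV[R]_n.
Local Notation mu := (@lebesgue_rV R n).
Local Notation C := R[i].
Hypothesis n_gt0 : (1 <= n)%N.
Implicit Types f g h : V -> C.

Lemma integral_indic_rV (A : set V) : measurable A -> (\int[mu]_x (\1_A x)%:E = mu A)%E.
Proof. by move=> mA; rewrite integral_indic// setIT. Qed.

Lemma le_enorm_norm (x : V) (si : R) : 0 <= si ->
  (1 + enorm x) `^ (- si) <= (1 + `|x|) `^ (- si).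
Proof.
move=> s0; rewrite !powRN lef_pV2 ?posrE ?powR_gt0 ?ltr_wpDr ?enorm_ge0//.
by apply: ge0_ler_powR; rewrite ?nnegrE ?addr_ge0 ?enorm_ge0// lerD2l norm_le_enorm.
Qed.

(** The layer-cake bound is integrated term by term. The i-th cube has measure (2i+1)^n, which
    leaves the envelope series of exponent n, convergent because [n < si]. *)
Lemma decay_cintegrable h (D si : R) : cmeasurable h -> 0 <= D -> n%:R < si ->
  (forall z, cabs (h z) <= D * (1 + `|z|) `^ (- si)) -> cintegrable h.
Proof.
move=> mh D0 nsi hD; apply/cintegrableP; split => //.
have si0 : 0 < si by rewrite (le_lt_trans _ nsi).
pose Q (i : nat) : set V := cube (const_mx (- i%:R)) (2 * i + 1)%:R.
pose b := envr h.
have mQ i : measurable_fun setT (fun x => ((b i - b i.+1) * \1_(Q i) x)%:E).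
  apply/measurable_EFinP/measurable_funM => //.
  by apply: measurable_indic; exact: measurable_cube.
have b0 i : 0 <= b i - b i.+1 by rewrite subr_ge0; exact: (envr_anti n_gt0 D0 si0 hD).
apply: (@le_lt_trans _ _ (\int[mu]_x \sum_(0 <= i <oo) ((b i - b i.+1) * \1_(Q i) x)%:E)%E).
  apply: ge0_le_integral => //.
  - by move=> x _; rewrite lee_fin cabs_ge0.
  - exact/measurable_EFinP/measurable_cabs.
  - by apply: ge0_emeasurable_sum => // i x _ _; rewrite lee_fin mulr_ge0.
  - by move=> x _; exact: (envelope_pointwise n_gt0 D0 si0 hD).
rewrite integral_nneseries//; last by move=> i x _; rewrite lee_fin mulr_ge0.
have n1 : 1 <= n%:R :> R by rewrite ler1n.
apply: le_lt_trans (envelope_series_lty n1 nsi D0 (envr_ge0 n_gt0 D0 si0 hD)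
  (envr_anti n_gt0 D0 si0 hD) (envr0 n_gt0 D0 si0 hD) (envrS n_gt0 D0 si0 hD)).
apply: lee_nneseries => [i _ _|i _]; first by apply: integral_ge0 => x _; rewrite lee_fin mulr_ge0.
under eq_integral do rewrite EFinM.
rewrite ge0_integralZl_EFin//; last first.
  by apply/measurable_EFinP/measurable_indic; exact: measurable_cube.
rewrite integral_indic_rV; last exact: measurable_cube.
have -> : mu (Q i) = (((2 * i + 1)%:R : R) ^+ n)%:E by exact: lebesgue_rV_cube.
by rewrite powR_mulrn.
Qed.

Lemma cmeasurable_continuous f : ccontinuous f -> cmeasurable f.
Proof. by move=> [f1 f2]; split; exact: continuous_measurable_rV. Qed.

Lemma ccontinuousD f g : ccontinuous f -> ccontinuous g -> ccontinuous (fun x => f x + g x).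
Proof.
move=> [f1 f2] [g1 g2]; split=> y.
  rewrite (_ : (fun x => _) = (fun x => complex.Re (f x)) \+ (fun x => complex.Re (g x))).
    exact: (continuousD (f1 y) (g1 y)).
  by apply/funext => x; rewrite cReD.
rewrite (_ : (fun x => _) = (fun x => complex.Im (f x)) \+ (fun x => complex.Im (g x))).
  exact: (continuousD (f2 y) (g2 y)).
by apply/funext => x; rewrite cImD.
Qed.

Lemma ccontinuousZ (c : C) f : ccontinuous f -> ccontinuous (fun x => c * f x).
Proof.
move=> [f1 f2]; split=> y.
  under eq_fun do rewrite cReM.
  apply: (@continuousB _ _ _ (fun x => complex.Re c * complex.Re (f x)) (fun x => complex.Im c * complex.Im (f x))).
    exact: (continuousM (@cst_continuous _ _ (complex.Re c) y) (f1 y)).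
  exact: (continuousM (@cst_continuous _ _ (complex.Im c) y) (f2 y)).
under eq_fun do rewrite cImM.
apply: (@continuousD _ _ _ (fun x => complex.Re c * complex.Im (f x)) (fun x => complex.Im c * complex.Re (f x))).
  exact: (continuousM (@cst_continuous _ _ (complex.Re c) y) (f2 y)).
exact: (continuousM (@cst_continuous _ _ (complex.Im c) y) (f1 y)).
Qed.

Lemma measurable_rV_sub : measurable_fun setT (fun z : V * V => z.1 - z.2).
Proof.
apply: measurable_fun_rV => k; under eq_fun do rewrite !mxE.
apply: measurable_funB.
  exact: (measurableT_comp (measurable_rV_coord k) measurable_fst).
exact: (measurableT_comp (measurable_rV_coord k) measurable_snd).
Qed.

Definition fourier_kernel (xi x : V) : C := cexp (2 * pi * dotp x xi).

Lemma fourierE f xi : fourier f xi = cint (fun x => f x * fourier_kernel xi x)%R.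
Proof. by []. Qed.

Lemma cabs_kernel xi x : cabs (fourier_kernel xi x) = 1.
Proof. exact: cabs_cexp. Qed.

Lemma fourier_kernelD xi x y : fourier_kernel xi (x + y) = fourier_kernel xi x * fourier_kernel xi y.
Proof. by rewrite /fourier_kernel dotpC dotpDr mulrDr cexpD ![dotp xi _]dotpC. Qed.

Lemma cmfun_kernel xi : cmeasurable (fourier_kernel xi).
Proof. by apply: cmfun_cexp; apply: measurable_funM => //; exact: measurable_dotp. Qed.

Lemma cintegrableMb f g (K : R) : cintegrable f -> cmeasurable g ->
  (forall x, cabs (g x) <= K) -> cintegrable (fun x => f x * g x).
Proof.
move=> fi mg gK; have [mf _] := (cintegrableP f).1 fi.
have K0 : 0 <= K by rewrite (le_trans _ (gK 0))// cabs_ge0.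
apply: (@le_cintegrable _ _ _ (fun x => (real_complex _ K) * f x)) => [||x].
- exact: cmfunM.
- exact: cintegrableZ.
- by rewrite !cabsM cabs_real ger0_norm// mulrC ler_wpM2r ?cabs_ge0.
Qed.

Definition conv h Phi : V -> C := fun x => cint (fun y => h y * Phi (x - y)).

Section convolution.
Variables (h Phi : V -> C) (K : R).
Hypotheses (hi : cintegrable h) (Pi : cintegrable Phi) (Pc : ccontinuous Phi)
  (PK : forall x, cabs (Phi x) <= K).

Let mh : cmeasurable h. Proof. by case/cintegrableP : hi. Qed.
Let mP : cmeasurable Phi. Proof. by case/cintegrableP : Pi. Qed.

Let subE (x y : V) : -1 *: y + x = x - y. Proof. by rewrite scaleN1r addrC. Qed.

Let mPs (x : V) : cmeasurable (fun y => Phi (x - y)).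
Proof.
have := cmfun_comp mP (measurable_rV_affine (-1) x).
by under [X in cmfun X -> _]eq_fun do rewrite subE.
Qed.

Let conv_int (x : V) : cintegrable (fun y => h y * Phi (x - y)).
Proof. by apply: (@cintegrableMb _ _ K). Qed.

Lemma ccontinuous_conv : ccontinuous (conv h Phi).
Proof.
(* [P] stands for the real or the imaginary part; both are handled by the same majorant [K |h|]. *)
have key (P : C -> R) (Pc' : forall (u : nat -> V) (p : V), u k @[k --> \oo] --> p ->
     forall y, P (h y * Phi (u k - y)) @[k --> \oo] --> P (h y * Phi (p - y))) :
  (forall c, `|P c| <= cabs c) ->
  (forall x : V, mu.-integrable setT (fun y => (P (h y * Phi (x - y)))%:E)) ->
  continuous (fun x : V => \int[mu]_y P (h y * Phi (x - y))).
  move=> Pb Pi' p; apply: seq_continuous_rV => u up.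
  have gi : mu.-integrable setT (fun y => (K * cabs (h y))%:E).
    have [_ hoo] := (cintegrableP h).1 hi.
    apply/integrableP; split.
      by apply/measurable_EFinP/measurable_funM => //; exact: measurable_cabs.
    under eq_integral => y _.
      rewrite gee0_abs ?lee_fin ?mulr_ge0 ?cabs_ge0 ?(le_trans _ (PK 0)) ?cabs_ge0// EFinM.
      over.
    rewrite /= ge0_integralZl_EFin//.
    - by rewrite lte_mul_pinfty// lee_fin (le_trans _ (PK 0)) ?cabs_ge0.
    - by move=> y _; rewrite lee_fin cabs_ge0.
    - by apply/measurable_EFinP; exact: measurable_cabs.
    - by rewrite (le_trans _ (PK 0)) ?cabs_ge0.
  have [||_ _ dc] := @dominated_convergence _ _ _ mu setT measurableT
    (fun k y => (P (h y * Phi (u k - y)))%:E) (fun y => (P (h y * Phi (p - y)))%:E)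
    (fun y => (K * cabs (h y))%:E) (fun k => measurable_int _ (Pi' (u k)))
    (measurable_int _ (Pi' p)) _ gi _.
  - by apply: nearW => y _; apply: cvg_EFin; [exact: nearW|exact: Pc'].
  - apply: nearW => y k _; rewrite lee_fin (le_trans (Pb _))// cabsM mulrC.
    by rewrite ler_wpM2r ?cabs_ge0.
  by apply: fine_cvg; rewrite fineK; [exact: dc|exact: integrable_fin_num].
have [Pc1 Pc2] := Pc.
have P1 (u : nat -> V) (p y : V) : u k @[k --> \oo] --> p -> complex.Re (Phi (u k - y)) @[k --> \oo] --> complex.Re (Phi (p - y)).
  by move=> up; apply: (continuous_seq_rV (Pc1 (p - y))); apply: cvgB => //; exact: cvg_cst.
have P2 (u : nat -> V) (p y : V) : u k @[k --> \oo] --> p -> complex.Im (Phi (u k - y)) @[k --> \oo] --> complex.Im (Phi (p - y)).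
  by move=> up; apply: (continuous_seq_rV (Pc2 (p - y))); apply: cvgB => //; exact: cvg_cst.
split; apply: key.
- move=> u p up y; rewrite cReM; under eq_fun do rewrite cReM.
  by apply: cvgB; apply: cvgMr; [exact: P1|exact: P2].
- exact: cabs_ge_Re.
- by move=> x; case: (conv_int x).
- move=> u p up y; rewrite cImM; under eq_fun do rewrite cImM.
  by apply: cvgD; apply: cvgMr; [exact: P2|exact: P1].
- exact: cabs_ge_Im.
- by move=> x; case: (conv_int x).
Qed.

Lemma abs_conv_lty : (\int[mu]_x \int[mu]_y (cabs (h y * Phi (x - y)))%:E < +oo)%E.
Proof.
have [_ hoo] := (cintegrableP h).1 hi; have [_ Poo] := (cintegrableP Phi).1 Pi.
have mh' : measurable_fun setT (fun y => (cabs (h y))%:E) by exact/measurable_EFinP/measurable_cabs.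
have mP' : measurable_fun setT (fun y => (cabs (Phi y))%:E) by exact/measurable_EFinP/measurable_cabs.
pose F (z : V * V) := (cabs (h z.2 * Phi (z.1 - z.2)))%:E.
have mF : measurable_fun setT F.
  apply/measurable_EFinP/measurable_cabs/cmfunM.
    exact: (cmfun_comp mh measurable_snd).
  exact: (cmfun_comp mP measurable_rV_sub).
have F0 z : (0 <= F z)%E by rewrite lee_fin cabs_ge0.
rewrite -[ltLHS]/(\int[mu]_x \int[mu]_y F (x, y))%E (fubini_tonelli _ mF F0).
rewrite (_ : (\int[mu]_y _)%E = (\int[mu]_y ((cabs (h y))%:E * \int[mu]_x (cabs (Phi x))%:E))%E).
  rewrite ge0_integralZr//; last 2 first.
  - by move=> y _; rewrite lee_fin cabs_ge0.
  - by apply: integral_ge0 => x _; rewrite lee_fin cabs_ge0.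
  rewrite -(@fineK _ (\int[mu]_x (cabs (h x))%:E)%E); last first.
    by rewrite ge0_fin_numE//; apply: integral_ge0 => x _; rewrite lee_fin cabs_ge0.
  by rewrite lte_mul_pinfty// lee_fin fine_ge0//; apply: integral_ge0 => x _; rewrite lee_fin cabs_ge0.
apply: eq_integral => y _.
rewrite (@ge0_integral_affine _ _ 1 (- y) (fun x => (cabs (Phi x))%:E))//; last first.
  by move=> x; rewrite lee_fin cabs_ge0.
rewrite normr1 expr1n mul1e -ge0_integralZl_EFin//.
- by apply: eq_integral => x _; rewrite /F /= cabsM EFinM scale1r.
- by move=> x _; rewrite lee_fin cabs_ge0.
- have := measurable_rV_affine 1 (- y); exact: (measurableT_comp mP').
- exact: cabs_ge0.
Qed.

Let mcc : cmfun (fun z : V * V => h z.2 * Phi (z.1 - z.2)).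
Proof.
by apply: cmfunM; [exact: (cmfun_comp mh measurable_snd)|exact: (cmfun_comp mP measurable_rV_sub)].
Qed.

Lemma cintegrable_conv : cintegrable (conv h Phi).
Proof.
apply/cintegrableP; split; first exact/cmeasurable_continuous/ccontinuous_conv.
apply: le_lt_trans abs_conv_lty; apply: ge0_le_integral => //.
- by move=> x _; rewrite lee_fin cabs_ge0.
- exact/measurable_EFinP/measurable_cabs/cmeasurable_continuous/ccontinuous_conv.
- apply: (measurable_fun_fubini_tonelli_F (m2 := mu) (fun z : V * V => (cabs (h z.2 * Phi (z.1 - z.2)))%:E)).
    by apply/measurable_EFinP; exact: measurable_cabs.
  by move=> z; rewrite lee_fin cabs_ge0.
- by move=> x _; apply: le_cabs_cint; case/cintegrableP : (conv_int x).
Qed.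

Lemma fourier_conv xi : fourier (conv h Phi) xi = fourier h xi * fourier Phi xi.
Proof.
pose e := fourier_kernel xi.
have me : cmeasurable e by exact: cmfun_kernel.
have e1 x : cabs (e x) = 1 by exact: cabs_kernel.
have Ps y : cintegrable (fun x => Phi (x - y)).
  have := cintegrable_affine (- y) (oner_neq0 R) Pi.
  by under [X in cintegrable X -> _]eq_fun do rewrite scale1r.
have Pse y : cintegrable (fun x => Phi (x - y) * e x).
  by apply: (@cintegrableMb _ _ 1) => // x; rewrite e1.
transitivity (cint (fun x => cint (fun y => e x * (h y * Phi (x - y))))).
  by rewrite fourierE; congr cint; apply/funext => x; rewrite cintZ// mulrC.
rewrite (cint_fubini (F := fun x y => e x * (h y * Phi (x - y)))).
- have he : cintegrable (fun y => h y * e y) by apply: (@cintegrableMb _ _ 1) => // x; rewrite e1.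
  rewrite [RHS]mulrC -[RHS](cintZ _ he); congr cint; apply/funext => y.
  transitivity (cint (fun x => h y * (Phi (x - y) * e x))).
    by congr cint; apply/funext => x; rewrite mulrC mulrA.
  rewrite cintZ// (cint_affine y (oner_neq0 R) (Pse y)) normr1 expr1n mul1r.
  rewrite [RHS]mulrCA; congr (_ * _).
  have Pe : cintegrable (fun x => Phi x * e x) by apply: (@cintegrableMb _ _ 1) => // x; rewrite e1.
  rewrite [RHS]mulrC fourierE -(cintZ _ Pe); congr cint; apply/funext => x.
  by rewrite scale1r addrK /e fourier_kernelD mulrA mulrC.
- apply: cmfunM; first exact: (cmfun_comp me measurable_fst).
  exact: mcc.
- by move=> x; apply: cintegrableZ.
- move=> y; rewrite (_ : (fun x => _) = (fun x => h y * (Phi (x - y) * e x))); last first.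
    by apply/funext => x; rewrite mulrC mulrA.
  exact: cintegrableZ.
- under eq_integral do under eq_integral do rewrite cabsM e1 mul1r.
  exact: abs_conv_lty.
Qed.

(** The difference of [conv h Phi] and [h] is continuous and integrable, and its transform vanishes
    because that of [Phi] is 1 wherever that of [h] is not 0. *)
Lemma conv_reproduce : ccontinuous h ->
  (forall xi, fourier h xi != 0 -> fourier Phi xi = 1) ->
  forall x, conv h Phi x = h x.
Proof.
move=> ch hP x; apply/eqP; rewrite -subr_eq0; apply/eqP.
apply: (fourier_inj0 (f := fun x => conv h Phi x - h x)).
- have := ccontinuousD ccontinuous_conv (ccontinuousZ (-1) ch).
  by under [X in ccontinuous X -> _]eq_fun do rewrite mulN1r.
- have := cintegrableD cintegrable_conv (cintegrableZ (-1) hi).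
  by under [X in cintegrable X -> _]eq_fun do rewrite mulN1r.
- move=> xi; rewrite fourierE.
  transitivity (cint (fun x => conv h Phi x * fourier_kernel xi x + (-1) * (h x * fourier_kernel xi x))).
    by congr cint; apply/funext => y; rewrite mulrBl mulN1r.
  have ik f : cintegrable f -> cintegrable (fun x => f x * fourier_kernel xi x).
    by move=> fi; apply: (@cintegrableMb _ _ 1) => // [|y]; [exact: cmfun_kernel|rewrite cabs_kernel].
  rewrite cintD; [|exact/ik/cintegrable_conv|exact/cintegrableZ/ik].
  rewrite cintZ; last exact: ik.
  rewrite -!fourierE fourier_conv mulN1r.
  have [->|/hP ->] := eqVneq (fourier h xi) 0; first by rewrite mul0r subrr.
  by rewrite mulr1 subrr.
Qed.

End convolution.

End decay.

(** * Rapidly decreasing kernels under dilation and reflection *)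

Section rapid_decay.
Context {R : realType} {n : nat}.
Local Notation V := 'rV[R]_n.
Local Notation mu := (@lebesgue_rV R n).
Local Notation C := R[i].
Hypothesis n_gt0 : (1 <= n)%N.
Local Open Scope complex_scope.
Implicit Types f g h : V -> C.

Lemma weight_gt0 (x : V) : 0 < 1 + enorm x.
Proof. by rewrite ltr_wpDr// enorm_ge0. Qed.

(** A class stable under the sums and dilations that form Littlewood-Paley kernels, and strong
    enough for convolution and Fubini arguments. *)
Definition rapid f := ccontinuous f /\
  forall m : nat, exists K : R, forall x, (1 + enorm x) ^+ m * cabs (f x) <= K.

Lemma schwartz_rapid f : schwartz f -> rapid f.
Proof.
move=> [[s1 s2] sm]; split.
  by split; [exact: (s1 [::]).1|exact: (s2 [::]).1].
move=> m; exists (fine (schwartz_norm m f)) => x.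
have H : (((1 + enorm x) ^+ m * cabs (f x))%:E <= schwartz_norm m f)%E.
  apply: ereal_sup_ubound; exists [::], x; split => //.
  rewrite (_ : citer_partial [::] f x = f x)// /citer_partial /=.
  by case: (f x).
rewrite -lee_fin fineK// ge0_fin_numE//; apply: le_trans H.
by rewrite lee_fin mulr_ge0 ?cabs_ge0// exprn_ge0// ltW// weight_gt0.
Qed.

Lemma rapid_powR f (si : R) : rapid f ->
  exists K, forall x, (1 + enorm x) `^ si * cabs (f x) <= K.
Proof.
move=> [_ /(_ (Num.trunc si).+1)[K fK]]; exists K => x.
rewrite (le_trans _ (fK x))// ler_wpM2r ?cabs_ge0// -powR_mulrn ?(ltW (weight_gt0 _))//.
by rewrite ler_powR ?lerDl ?enorm_ge0// ltW// truncnS_gt.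
Qed.

Lemma rapid_bounded f : rapid f -> exists K, forall x, cabs (f x) <= K.
Proof. by move=> [_ /(_ 0%N)[K fK]]; exists K => x; have := fK x; rewrite expr0 mul1r. Qed.

Lemma rapid_cintegrable f : rapid f -> cintegrable f.
Proof.
move=> rf; have [cf _] := rf; have [K fK] := rapid_powR (n%:R + 1) rf.
have K0 : 0 <= K by rewrite (le_trans _ (fK 0))// mulr_ge0 ?powR_ge0 ?cabs_ge0.
have s0 : 0 <= n%:R + 1 :> R by rewrite addr_ge0.
apply: (@decay_cintegrable _ _ n_gt0 _ K (n%:R + 1)) => //.
- exact: cmeasurable_continuous.
- by rewrite ltrDl.
- move=> z; rewrite (le_trans _ (ler_wpM2l K0 (le_enorm_norm _ s0)))//.
  by rewrite powRN -ler_pdivrMr ?invr_gt0 ?powR_gt0 ?weight_gt0// invrK mulrC.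
Qed.

Lemma rapidD f g : rapid f -> rapid g -> rapid (fun x => f x + g x).
Proof.
move=> [cf rf] [cg rg]; split; first exact: ccontinuousD.
move=> m; have [K fK] := rf m; have [L gL] := rg m; exists (K + L) => x.
rewrite (le_trans _ (lerD (fK x) (gL x)))// -mulrDr ler_wpM2l ?cabsD//.
by rewrite exprn_ge0// ltW// weight_gt0.
Qed.

Lemma rapidZ (c : C) f : rapid f -> rapid (fun x => c * f x).
Proof.
move=> [cf rf]; split; first exact: ccontinuousZ.
move=> m; have [K fK] := rf m; exists (cabs c * K) => x.
by rewrite cabsM mulrCA ler_wpM2l ?cabs_ge0.
Qed.

Lemma rapid0 : rapid (fun=> 0).
Proof.
split; first by split => x; exact: cst_continuous.
by move=> m; exists 0 => x; rewrite cabs0 mulr0.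
Qed.

Lemma rapid_sum I (r : seq I) (F : I -> V -> C) : (forall i, rapid (F i)) ->
  rapid (fun x => \sum_(i <- r) F i x).
Proof.
move=> rF; elim: r => [|i r IH].
  by under eq_fun do rewrite big_nil; exact: rapid0.
by under eq_fun do rewrite big_cons; exact: rapidD.
Qed.

Lemma ccontinuous_scale (r : R) f : ccontinuous f -> ccontinuous (fun x => f (r *: x)).
Proof.
by move=> [f1 f2]; split=> x; [apply: (continuous_comp _ (f1 (r *: x)))|apply: (continuous_comp _ (f2 (r *: x)))];
  exact: scaler_continuous.
Qed.

Lemma rapid_scale (r : R) f : r != 0 -> rapid f -> rapid (fun x => f (r *: x)).
Proof.
move=> r0 [cf rf]; split; first exact: ccontinuous_scale.
move=> m; have [K fK] := rf m; exists ((1 + `|r|^-1) ^+ m * K) => x.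
have rpos : 0 < `|r| by rewrite normr_gt0.
have ri : 0 < `|r|^-1 by rewrite invr_gt0.
have e0 := enorm_ge0 x.
have W : 1 + enorm x <= (1 + `|r|^-1) * (1 + enorm (r *: x)).
  rewrite enormZ mulrDl mul1r mulrDr mulr1 mulKf ?gt_eqF//.
  have : 0 <= `|r| * enorm x by rewrite mulr_ge0.
  move: ri; set q := _^-1; lra.
rewrite (le_trans (ler_wpM2r (cabs_ge0 _) (lerXn2r m _ _ W)))// ?nnegrE ?addr_ge0//.
  by rewrite mulr_ge0 ?addr_ge0 ?enorm_ge0// ltW.
by rewrite exprMn -mulrA ler_wpM2l ?exprn_ge0 ?addr_ge0.
Qed.

Lemma rapid_lp_dilate f j : rapid f -> rapid (lp_dilate f j).
Proof. by move=> rf; apply/rapidZ/rapid_scale => //; rewrite expfz_neq0. Qed.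

Lemma pow2E (j : int) : (2 : R) ^ j = 2 `^ (j%:~R).
Proof. by rewrite powR_intmul. Qed.

Lemma lp_dilate_scale (j : int) : 2 `^ (j%:~R * n%:R) = `|(2 : R) ^ j| ^+ n.
Proof. by rewrite ger0_norm ?exprz_ge0// pow2E -powR_mulrn ?powR_ge0// powRrM. Qed.

Lemma fourier_lp_dilate f j xi : rapid f ->
  fourier (lp_dilate f j) xi = fourier f ((2 ^ (- j)) *: xi).
Proof.
move=> rf; have fi := rapid_cintegrable rf.
have r0 : (2 : R) ^ j != 0 by rewrite expfz_neq0.
have fki eta : cintegrable (fun x => f x * fourier_kernel eta x).
  by apply: (@cintegrableMb _ _ _ _ 1) => // [|y]; [exact: cmfun_kernel|rewrite cabs_kernel].
rewrite !fourierE (cint_affine 0 r0 (fki _)) -lp_dilate_scale.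
rewrite -cintZ; last exact: (cintegrable_affine 0 r0 (fki _)).
congr cint; apply/funext => x; rewrite addr0 mulrA; congr (_ * _).
rewrite /fourier_kernel [in RHS]dotpZr [dotp (_ *: x) xi]dotpC dotpZr [dotp xi x]dotpC.
by rewrite -invr_expz mulKf.
Qed.

(** The reflected conjugate of [f] has the conjugate transform, here the same one, so injectivity
    applies. This symmetry makes convolution with [f] self-adjoint for the pairing. *)
Lemma even_real f : rapid f -> (forall xi, complex.Im (fourier f xi) = 0) ->
  forall x : V, (f (- x))^* = f x.
Proof.
move=> rf fR x; have fi := rapid_cintegrable rf; have [cf _] := rf.
have n1 : (-1 : R) != 0 by rewrite oppr_eq0 oner_eq0.
pose g (x : V) := (f (-1 *: x))^*.
have cg : ccontinuous g.
  have [g1 g2] := ccontinuous_scale (-1) cf; split => y.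
    by under eq_fun do rewrite cReJ; exact: g1.
  rewrite (_ : (fun x => _) = (fun x => - complex.Im (f (-1 *: x)))).
    exact: (continuousN (g2 y)).
  by apply/funext => z; rewrite cImJ.
have fi' := rapid_cintegrable (rapid_scale n1 rf).
have gi : cintegrable g.
  have [f1 f2] := fi'; split; first by under eq_fun do rewrite cReJ.
  have := integrableN f2; apply: eq_integrable => // y _ /=.
  by rewrite cImJ EFinN.
have kJ (xi y : V) : (fourier_kernel xi y)^* = fourier_kernel xi (- y).
  rewrite /fourier_kernel [dotp (- y) _]dotpC dotpNr [dotp xi y]dotpC mulrN.
  by apply: complex_ext; rewrite /= ?cosN ?sinN.
have Fg xi : fourier g xi = (fourier f xi)^*.
  have fki : cintegrable (fun x => f x * fourier_kernel xi x).
    by apply: (@cintegrableMb _ _ _ _ 1) => // [|y]; [exact: cmfun_kernel|rewrite cabs_kernel].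
  rewrite !fourierE (cint_affine 0 n1 fki) normrN1 expr1n mul1r -cintJ; last exact: (cintegrable_affine 0 n1 fki).
  congr cint; apply/funext => y; rewrite addr0 rmorphM -/(g y); congr (_ * _).
  by rewrite -[RHS]/((fourier_kernel xi (-1 *: y))^*) kJ scaleN1r opprK.
suff : g x - f x = 0 by move/eqP; rewrite subr_eq0 /g scaleN1r => /eqP.
apply: (fourier_inj0 (f := fun x => g x - f x)).
- by have := ccontinuousD cg (ccontinuousZ (-1) cf); under [X in ccontinuous X -> _]eq_fun do rewrite mulN1r.
- by have := cintegrableD gi (cintegrableZ (-1) fi); under [X in cintegrable X -> _]eq_fun do rewrite mulN1r.
- move=> xi; rewrite fourierE.
  have ik h : cintegrable h -> cintegrable (fun x => h x * fourier_kernel xi x).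
    by move=> hi; apply: (@cintegrableMb _ _ _ _ 1) => // [|y]; [exact: cmfun_kernel|rewrite cabs_kernel].
  transitivity (cint (fun x => g x * fourier_kernel xi x + (-1) * (f x * fourier_kernel xi x))).
    by congr cint; apply/funext => y; rewrite mulrBl mulN1r.
  rewrite cintD; [|exact: ik|exact/cintegrableZ/ik].
  rewrite cintZ; last exact: ik.
  rewrite -!fourierE Fg mulN1r.
  by apply: complex_ext; rewrite ?cReD ?cImD ?cReN ?cImN ?cReJ ?cImJ ?fR/= ?subrr// oppr0 addr0.
Qed.

Lemma measurable_weight (t : R) : measurable_fun setT (fun y : V => (1 + enorm y) `^ t).
Proof.
apply: (measurableT_comp (measurable_powR t)).
by apply: measurable_funD => //; exact: measurable_enorm.
Qed.

Lemma measurable_dnorm_weight (t : R) :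
  measurable_fun setT (fun y : V => 1 + enorm y `^ t).
Proof.
apply: measurable_funD => //; apply: (measurableT_comp (measurable_powR t)).
exact: measurable_enorm.
Qed.

(** From 1 + t <= 2 max(1, t); the origin of the factor 2^sigma in the closed form. *)
Lemma weight_powR_le (y : V) (si : R) : 0 <= si ->
  (1 + enorm y) `^ si <= 2 `^ si * (1 + enorm y `^ si).
Proof.
move=> si0; have e0 := enorm_ge0 y.
apply: (@le_trans _ _ ((2 * Num.max 1 (enorm y)) `^ si)).
  apply: ge0_ler_powR; rewrite ?nnegrE ?mulr_ge0 ?le_max ?ler01 ?(ltW (weight_gt0 _))//.
  by case: (leP 1 (enorm y)) => ?; lra.
rewrite powRM// ?le_max ?ler01// ler_wpM2l ?powR_ge0//.
case: (leP 1 (enorm y)) => _; first by rewrite lerDr.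
by rewrite powR1 lerDl powR_ge0.
Qed.

End rapid_decay.

(** * Reproduction by finitely many Littlewood-Paley blocks *)

Lemma int_window (m : nat) (l : int) : - m%:Z <= l -> l <= m%:Z ->
  exists2 i : nat, (i < (2 * m).+1)%N & l = i%:Z - m%:Z.
Proof. by move=> l1 l2; exists (absz (l + m%:Z)); lia. Qed.

Section band.
Context {R : realType} {n : nat}.
Local Notation V := 'rV[R]_n.
Local Notation mu := (@lebesgue_rV R n).
Local Notation C := R[i].
Hypothesis n_gt0 : (1 <= n)%N.
Local Open Scope complex_scope.
Variables (a b c1 c2 : R) (phi : V -> C).
Hypotheses (a0 : 0 < a) (ab : a < b) (c10 : 0 < c1) (c12 : c1 < c2)
  (gphi : lp_generator c1 c2 phi).
Local Notation M := (band_depth a b c1 c2).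

Let rphi : rapid phi. Proof. by case: gphi => /schwartz_rapid. Qed.

(** The hypotheses give 2^j <= b/c1 and 2^(-j) <= c2/a; their logarithms are the two quantities in
    [band_depth]. *)
Lemma band_depth_ge (j : int) (t : R) : a <= t <= b -> c1 <= 2 ^ (- j) * t <= c2 ->
  - (M%:Z) <= j <= M%:Z.
Proof.
move=> /andP[at_ tb] /andP[ct tc].
have t0 : 0 < t by rewrite (lt_le_trans a0).
have c20 : 0 < c2 by rewrite (lt_trans c10).
have b0 : 0 < b by rewrite (lt_trans a0).
have l20 : 0 < ln 2 :> R by rewrite ln_gt0// ltr1n.
set X := Num.max (Num.max (log2 (b / c1)) (log2 (c2 / a))) 0.
have X0 : 0 <= X by rewrite /X le_max lexx orbT.
have ME : M%:Z = Num.ceil X.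
  by rewrite /band_depth -/X gez0_abs// ceil_ge0 (lt_le_trans _ X0)// ltrN10.
have XM : X <= (M%:Z)%:~R by rewrite ME ceil_ge.
have pj : (2 : R) ^ j * (2 ^ (- j) * t) = t.
  by rewrite mulrA -expfzDr// subrr expr0z mul1r.
have j0 : 0 < (2 : R) ^ j by rewrite exprz_gt0.
have lnj : ln ((2 : R) ^ j) = j%:~R * ln 2 by rewrite pow2E ln_powR.
have jN0 : 0 < (2 : R) ^ (- j) by rewrite exprz_gt0.
have lnNj : ln ((2 : R) ^ (- j)) = - j%:~R * ln 2 by rewrite pow2E ln_powR rmorphN.
have j1 : j%:~R <= (M%:Z)%:~R :> R.
  rewrite (le_trans _ XM)// (@le_trans _ _ (log2 (b / c1)))//; last first.
    by rewrite /X !le_max lexx.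
  rewrite /log2 ler_pdivlMr// -lnj ler_ln ?posrE ?divr_gt0// ler_pdivlMr//.
  by rewrite (le_trans _ tb)// -[leRHS]pj ler_wpM2l// ltW.
have j2 : - j%:~R <= (M%:Z)%:~R :> R.
  rewrite (le_trans _ XM)// (@le_trans _ _ (log2 (c2 / a)))//; last first.
    by rewrite /X !le_max lexx orbT.
  rewrite /log2 ler_pdivlMr// -lnNj ler_ln ?posrE ?divr_gt0// ler_pdivlMr//.
  by rewrite (le_trans _ tc)// ler_wpM2l// ltW.
rewrite ler_int in j1; rewrite -rmorphN ler_int in j2.
by rewrite lerNl j2 j1.
Qed.

Definition band_kernel (x : V) : C :=
  \sum_(0 <= i < (2 * M).+1) lp_dilate phi (i%:Z - M%:Z) x.

Lemma rapid_band_kernel : rapid band_kernel.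
Proof. by apply: rapid_sum => i; exact: rapid_lp_dilate. Qed.

(** On the annulus all terms of the partition of unity outside the window |j| <= M vanish, so the
    finite sum already equals the whole sum, which is 1. *)
Lemma fourier_band_kernel xi : a <= enorm xi <= b -> fourier band_kernel xi = 1.
Proof.
move=> xab; have [_ _ _ phis phi1] := gphi.
have xi0 : xi != 0.
  apply: contraTneq xab => ->.
  by rewrite (_ : enorm 0 = 0) ?leNgt ?a0// /enorm /dotp big1 ?sqrtr0// => k _; rewrite mxE mul0r.
have fki (f : V -> C) : cintegrable f -> cintegrable (fun x => f x * fourier_kernel xi x).
  by move=> fi; apply: (@cintegrableMb _ _ _ _ 1) => // [|y]; [exact: cmfun_kernel|rewrite cabs_kernel].
rewrite fourierE.
transitivity (cint (fun x => \sum_(0 <= i < (2 * M).+1) lp_dilate phi (i%:Z - M%:Z) x * fourier_kernel xi x)).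
  by congr cint; apply/funext => x; rewrite /band_kernel mulr_suml.
rewrite cint_sum => [|i]; last exact/fki/rapid_cintegrable/rapid_lp_dilate.
rewrite -(phi1 _ xi0).
under eq_bigr do rewrite -fourierE fourier_lp_dilate//.
pose F (j : int) := fourier phi (2 ^ (- j) *: xi).
pose r := [seq (i%:Z - M%:Z) | i <- index_iota 0 (2 * M).+1].
have ur : uniq r by rewrite map_inj_uniq ?iota_uniq// => i j /(addIr _) [].
rewrite -[LHS](big_map (fun i : nat => i%:Z - M%:Z) xpredT F) -/r (fsbig_seq _ _ ur)/=.
apply: fsbig_widen => // j [_] /= jr; apply: contrapT => Fj.
apply: jr; have := phis _ (introN eqP Fj); rewrite enormZ ger0_norm ?exprz_ge0// => H.
have := band_depth_ge xab H => /andP[j1 j2].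
have [i iM ->] := int_window j1 j2; apply/mapP; exists i => //.
by rewrite mem_index_iota/=.
Qed.

Lemma lp_dilate_even j x : (lp_dilate phi j (- x))^* = lp_dilate phi j x.
Proof.
have [_ phiR _ _ _] := gphi.
rewrite /lp_dilate rmorphM scalerN; congr (_ * _); first by rewrite /= oppr0.
exact: (even_real n_gt0 rphi phiR).
Qed.

(* The kernel of the operator f |-> sum_{|i| <= M} Delta_{j+i} f. *)
Definition band_kernel_at (j : int) (x : V) : C :=
  \sum_(0 <= i < (2 * M).+1) lp_dilate phi (j + (i%:Z - M%:Z)) x.

Lemma band_kernel_atE j x : band_kernel_at j x = (2 `^ (j%:~R * n%:R))%:C * band_kernel ((2 ^ j) *: x).
Proof.
rewrite /band_kernel /band_kernel_at mulr_sumr; apply: eq_bigr => i _.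
rewrite /lp_dilate mulrA -rmorphM; congr (_%:C * phi _).
  by rewrite -powRD ?pnatr_eq0 ?implybT// -mulrDl -intrD.
by rewrite scalerA -expfzDr// addrC.
Qed.

Lemma band_kernel_at_even j x : (band_kernel_at j (- x))^* = band_kernel_at j x.
Proof.
by rewrite /band_kernel_at rmorph_sum; apply: eq_bigr => i _; exact: lp_dilate_even.
Qed.

Section generator.
Variable h : V -> C.
Hypothesis hband : band_limited a b h.

Let hc : ccontinuous h. Proof. by case: hband. Qed.
Let hi : cintegrable h. Proof. by case: hband. Qed.

Lemma band_reproduce (Phi : V -> C) : rapid Phi ->
  (forall xi, a <= enorm xi <= b -> fourier Phi xi = 1) ->
  forall x, h x = cint (fun y => h y * Phi (x - y)).
Proof.
move=> rP P1 x; have [K PK] := rapid_bounded rP.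
have [_ _ _ hs] := hband.
apply/esym/(@conv_reproduce _ _ h Phi K) => //; first exact: rapid_cintegrable.
  by case: rP.
by move=> xi /hs; exact: P1.
Qed.

(* Peetre's inequality transfers the weighted L^1 bound on h to a pointwise one. *)
Lemma band_decay (Phi : V -> C) (si K : R) : 0 <= si -> rapid Phi ->
  (forall xi, a <= enorm xi <= b -> fourier Phi xi = 1) ->
  (forall z, (1 + enorm z) `^ si * cabs (Phi z) <= K) ->
  forall x, (((1 + enorm x) `^ si * cabs (h x))%:E <=
    (2 `^ si)%:E * K%:E * Dnorm si h)%E.
Proof.
move=> si0 rP P1 PK x.
have K0 : 0 <= K by rewrite (le_trans _ (PK 0))// mulr_ge0 ?powR_ge0 ?cabs_ge0.
have [mh hoo] := (cintegrableP h).1 hi.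
have mP : cmeasurable Phi by apply: cmeasurable_continuous; case: rP.
have mhP : cmeasurable (fun y => h y * Phi (x - y)).
  apply: cmfunM => //; have := cmfun_comp mP (measurable_rV_affine (-1) x).
  by under [X in cmfun X -> _]eq_fun do rewrite scaleN1r addrC.
have mch : measurable_fun setT (fun y => cabs (h y)) by exact: measurable_cabs.
have bound (y : V) : (1 + enorm x) `^ si * cabs (h y * Phi (x - y)) <= K * ((1 + enorm y) `^ si * cabs (h y)).
  rewrite cabsM.
  have W : (1 + enorm x) `^ si <= (1 + enorm (x - y)) `^ si * (1 + enorm y) `^ si.
    rewrite -powRM ?(ltW (weight_gt0 _))//.
    by apply: ge0_ler_powR; rewrite ?nnegrE ?mulr_ge0 ?(ltW (weight_gt0 _))// peetre.
  rewrite (le_trans (ler_wpM2r _ W)) ?mulr_ge0 ?cabs_ge0//.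
  rewrite [leLHS](_ : _ = ((1 + enorm (x - y)) `^ si * cabs (Phi (x - y))) * ((1 + enorm y) `^ si * cabs (h y))); last by ring.
  by rewrite ler_wpM2r// mulr_ge0 ?powR_ge0 ?cabs_ge0.
rewrite EFinM {1}(band_reproduce rP P1 x).
apply: (@le_trans _ _ (((1 + enorm x) `^ si)%:E * \int[mu]_y (cabs (h y * Phi (x - y))%R)%:E)%E).
  by apply: lee_wpmul2l; [rewrite lee_fin powR_ge0|exact: le_cabs_cint].
rewrite -integralZl_EFin ?powR_ge0//; last 2 first.
- exact: measurable_cabs.
- by move=> y; exact: cabs_ge0.
rewrite -EFinM; apply: le_integral_scale.
- by rewrite mulr_ge0 ?powR_ge0.
- by apply: measurable_funM => //; exact: measurable_cabs.
- by apply: measurable_funM => //; exact: measurable_dnorm_weight.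
- by move=> y; rewrite mulr_ge0 ?powR_ge0 ?cabs_ge0.
- by move=> y; rewrite mulr_ge0 ?cabs_ge0 ?addr_ge0 ?powR_ge0.
- move=> y; rewrite (le_trans (bound y))//.
  rewrite [leRHS](_ : _ = K * (2 `^ si * (1 + enorm y `^ si) * cabs (h y))); last by ring.
  by rewrite ler_wpM2l// ler_wpM2r ?cabs_ge0// weight_powR_le.
Qed.

End generator.

End band.

Section measurable_cint.
Context {R : realType} {n : nat}.
Local Notation V := 'rV[R]_n.
Local Notation mu := (@lebesgue_rV R n).

Lemma measurable_Rintegral (F : V * V -> R) : measurable_fun setT F ->
  measurable_fun setT (fun x => \int[mu]_y F (x, y)).
Proof.
move=> mF; apply: (measurableT_comp (fine_measurable measurableT)).
have mE : measurable_fun setT (EFin \o F) by exact/measurable_EFinP.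
under eq_fun do rewrite integralE.
apply: emeasurable_funB.
  have := measurable_fun_fubini_tonelli_F (m2 := mu) _ (measurable_funepos mE) (funepos_ge0 _).
  congr measurable_fun; apply/funext => x; apply: eq_integral => y _.
  by rewrite !funeposE.
have := measurable_fun_fubini_tonelli_F (m2 := mu) _ (measurable_funeneg mE) (funeneg_ge0 _).
congr measurable_fun; apply/funext => x; apply: eq_integral => y _.
by rewrite !funenegE.
Qed.

Lemma cmeasurable_cint (F : V * V -> R[i]) : cmfun F ->
  cmeasurable (fun x => cint (fun y => F (x, y))).
Proof.
by move=> [F1 F2]; split; [exact: (measurable_Rintegral F1)|exact: (measurable_Rintegral F2)].
Qed.

End measurable_cint.

(** * Wavelet coefficients as pairings with Littlewood-Paley blocks *)

Section pairing_identity.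
Context {R : realType} {n : nat}.
Local Notation V := 'rV[R]_n.
Local Notation mu := (@lebesgue_rV R n).
Local Notation C := R[i].
Local Open Scope complex_scope.

Lemma cintegrableJ (f : V -> C) : cintegrable f -> cintegrable (fun x => (f x)^*).
Proof.
move=> [f1 f2]; split; first by under eq_fun do rewrite cReJ.
have := integrableN f2; apply: eq_integrable => // y _ /=.
by rewrite cImJ EFinN.
Qed.

Section pairing_conv.
Variables (si : R) (f g : V -> C).
Hypotheses (si0 : 0 <= si) (mf : cmeasurable f) (mg : cmeasurable g)
  (fw : (\int[mu]_y (cabs (f y) * (1 + enorm y) `^ (- si))%:E < +oo)%E)
  (gw : (\int[mu]_y (cabs (g y) * (1 + enorm y) `^ si)%:E < +oo)%E).
Implicit Types Psi : V -> C.

(** Peetre's inequality for the exponent [- si]. It separates a weight in [x], absorbed by [g], from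
    a weight in [y], absorbed by [f]. *)
Let peetreN (x y : V) : (1 + enorm (x - y)) `^ (- si) <= (1 + enorm x) `^ si * (1 + enorm y) `^ (- si).
Proof.
rewrite !powRN ler_pdivlMr ?powR_gt0 ?weight_gt0// mulrC ler_pdivrMr ?powR_gt0 ?weight_gt0//.
rewrite -powRM ?(ltW (weight_gt0 _))//.
apply: ge0_ler_powR; rewrite ?nnegrE ?mulr_ge0 ?(ltW (weight_gt0 _))//.
by rewrite mulrC -(enormN (x - y)) opprB peetre.
Qed.

Let kernel_bound Psi : rapid Psi -> exists2 K : R, 0 <= K &
  forall x y : V, cabs (Psi (x - y)) <= K * ((1 + enorm x) `^ si * (1 + enorm y) `^ (- si)).
Proof.
move=> rP; have [K PK] := rapid_powR si rP; exists K.
  by rewrite (le_trans _ (PK 0))// mulr_ge0 ?powR_ge0 ?cabs_ge0.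
have K0 : 0 <= K by rewrite (le_trans _ (PK 0))// mulr_ge0 ?powR_ge0 ?cabs_ge0.
move=> x y; rewrite (le_trans _ (ler_wpM2l K0 (peetreN x y)))//.
by rewrite powRN -ler_pdivrMr ?invr_gt0 ?powR_gt0 ?weight_gt0// invrK mulrC.
Qed.

Let mPsi Psi : rapid Psi -> cmfun (fun z : V * V => Psi (z.1 - z.2)).
Proof.
by move=> [cP _]; apply: (cmfun_comp (cmeasurable_continuous cP) measurable_rV_sub).
Qed.

Let mFG Psi : rapid Psi -> cmfun (fun z : V * V => (g z.1)^* * (f z.2 * Psi (z.1 - z.2))).
Proof.
move=> rP; apply: cmfunM; first exact/cmfunJ/(cmfun_comp mg measurable_fst).
by apply: cmfunM; [exact: (cmfun_comp mf measurable_snd)|exact: mPsi].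
Qed.

Let bound Psi (K : R) : (forall x y : V, cabs (Psi (x - y)) <= K * ((1 + enorm x) `^ si * (1 + enorm y) `^ (- si))) ->
  forall x y, cabs ((g x)^* * (f y * Psi (x - y))) <=
    (K * (cabs (g x) * (1 + enorm x) `^ si)) * (cabs (f y) * (1 + enorm y) `^ (- si)).
Proof.
move=> PK x y; rewrite !cabsM cabsJ mulrA (le_trans (ler_wpM2l _ (PK x y))) ?mulr_ge0 ?cabs_ge0//.
by apply: le_of_eq; ring.
Qed.

Let mfw : measurable_fun setT (fun y : V => (cabs (f y) * (1 + enorm y) `^ (- si))%:E).
Proof. by apply/measurable_EFinP/measurable_funM; [exact: measurable_cabs|exact: measurable_weight]. Qed.

Let mgw : measurable_fun setT (fun y : V => (cabs (g y) * (1 + enorm y) `^ si)%:E).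
Proof. by apply/measurable_EFinP/measurable_funM; [exact: measurable_cabs|exact: measurable_weight]. Qed.

Lemma cintegrable_section1 Psi : rapid Psi -> forall x, cintegrable (fun y => f y * Psi (x - y)).
Proof.
move=> rP x; have [K K0 PK] := kernel_bound rP; apply/cintegrableP.
have mF : cmeasurable (fun y => f y * Psi (x - y)).
  by apply: cmfunM => //; exact: (cmfun_comp (mPsi rP) (pair1_measurable x)).
split => //.
apply: (integral_scale_lty (k := K * (1 + enorm x) `^ si) _ _ _ _ _ _ fw).
- by rewrite mulr_ge0 ?powR_ge0.
- exact: measurable_cabs.
- exact/measurable_EFinP.
- by move=> y; exact: cabs_ge0.
- by move=> y; rewrite mulr_ge0 ?cabs_ge0 ?powR_ge0.
- move=> y; rewrite cabsM (le_trans (ler_wpM2l _ (PK x y))) ?cabs_ge0//.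
  by apply: le_of_eq; ring.
Qed.

Lemma cintegrable_section2 Psi : rapid Psi -> forall y, cintegrable (fun x => (g x)^* * Psi (x - y)).
Proof.
move=> rP y; have [K K0 PK] := kernel_bound rP; apply/cintegrableP.
have mF : cmeasurable (fun x => (g x)^* * Psi (x - y)).
  by apply: cmfunM; [exact: cmfunJ|exact: (cmfun_comp (mPsi rP) (pair2_measurable y))].
split => //.
apply: (integral_scale_lty (k := K * (1 + enorm y) `^ (- si)) _ _ _ _ _ _ gw).
- by rewrite mulr_ge0 ?powR_ge0.
- exact: measurable_cabs.
- exact/measurable_EFinP.
- by move=> x; exact: cabs_ge0.
- by move=> x; rewrite mulr_ge0 ?cabs_ge0 ?powR_ge0.
- move=> x; rewrite cabsM cabsJ (le_trans (ler_wpM2l _ (PK x y))) ?cabs_ge0//.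
  by apply: le_of_eq; ring.
Qed.

Let double Psi : rapid Psi ->
  (\int[mu]_x \int[mu]_y (cabs ((g x)^* * (f y * Psi (x - y))))%:E < +oo)%E.
Proof.
move=> rP; have mIF : measurable_fun setT (fun x => \int[mu]_y (cabs ((g x)^* * (f y * Psi (x - y))))%:E)%E.
  apply: (measurable_fun_fubini_tonelli_F (m2 := mu) (fun z : V * V => (cabs ((g z.1)^* * (f z.2 * Psi (z.1 - z.2))))%:E)).
    exact/measurable_EFinP/measurable_cabs/mFG.
  by move=> z; rewrite lee_fin cabs_ge0.
have [K K0 PK] := kernel_bound rP.
pose I := (\int[mu]_y (cabs (f y) * (1 + enorm y) `^ (- si))%:E)%E.
have I0 : (0 <= I)%E.
  by apply: integral_ge0 => y _; rewrite lee_fin mulr_ge0 ?cabs_ge0 ?powR_ge0.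
have IE : I = (fine I)%:E by rewrite fineK// ge0_fin_numE//; exact: fw.
have F0 x : 0 <= K * (cabs (g x) * (1 + enorm x) `^ si).
  by rewrite mulr_ge0// mulr_ge0 ?cabs_ge0 ?powR_ge0.
have inner x : (\int[mu]_y (cabs ((g x)^* * (f y * Psi (x - y))))%:E <=
    (K * fine I * (cabs (g x) * (1 + enorm x) `^ si))%:E)%E.
  rewrite mulrAC EFinM -IE; apply: le_integral_scale => //.
  - by apply: measurable_cabs; exact: (cmfun_comp (mFG rP) (pair1_measurable x)).
  - exact/measurable_EFinP.
  - by move=> y; exact: cabs_ge0.
  - by move=> y; rewrite mulr_ge0 ?cabs_ge0 ?powR_ge0.
  - by move=> y; exact: bound.
apply: (@le_lt_trans _ _ (\int[mu]_x (K * fine I * (cabs (g x) * (1 + enorm x) `^ si))%:E)%E).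
  apply: ge0_le_integral; first exact: measurableT.
  - by move=> x _; apply: integral_ge0 => y _; rewrite lee_fin cabs_ge0.
  - exact: mIF.
  - by apply/measurable_EFinP; apply: measurable_funM => //; exact/measurable_EFinP.
  - by move=> x _; exact: inner.
rewrite integralZl_EFin ?mulr_ge0 ?fine_ge0//; last 2 first.
- exact/measurable_EFinP.
- by move=> x; rewrite mulr_ge0 ?cabs_ge0 ?powR_ge0.
by apply: lte_mul_pinfty => //; rewrite lee_fin mulr_ge0 ?fine_ge0.
Qed.

Lemma cmeasurable_convf Psi : rapid Psi -> cmeasurable (fun x => cint (fun y => f y * Psi (x - y))).
Proof.
move=> rP; apply: (@cmeasurable_cint _ _ (fun z => f z.2 * Psi (z.1 - z.2))).
by apply: cmfunM; [exact: (cmfun_comp mf measurable_snd)|exact: mPsi].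
Qed.

(** Fubini's theorem; with the kernel bounded by separated weights, the double integral is dominated
    by the product of the weighted integrals of [f] and [g]. *)
Lemma pairing_convf Psi : rapid Psi ->
  cint (fun x => cint (fun y => f y * Psi (x - y)) * (g x)^*) =
  cint (fun y => f y * cint (fun x => (g x)^* * Psi (x - y))).
Proof.
move=> rP; transitivity (cint (fun x => cint (fun y => (g x)^* * (f y * Psi (x - y))))).
  by congr cint; apply/funext => x; rewrite (cintZ _ (cintegrable_section1 rP x)) mulrC.
rewrite (cint_fubini (mFG rP)).
- congr cint; apply/funext => y; rewrite -(cintZ _ (cintegrable_section2 rP y)).
  by congr cint; apply/funext => x; rewrite mulrCA.
- by move=> x; apply/cintegrableZ/cintegrable_section1.
- move=> y; rewrite (_ : (fun x => _) = (fun x => f y * ((g x)^* * Psi (x - y)))).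
    exact/cintegrableZ/cintegrable_section2.
  by apply/funext => x; rewrite mulrCA.
- exact: double.
Qed.

End pairing_conv.

Lemma dilate_scale_sub (j : int) (k : 'rV[int]_n) (h : V -> C) x :
  dilate j k h x = (2 `^ (j%:~R * n%:R / 2))%:C * h ((2 ^ j) *: x + - map_mx intr k).
Proof. by []. Qed.

Lemma cmeasurable_dilate (j : int) (k : 'rV[int]_n) (h : V -> C) :
  cmeasurable h -> cmeasurable (dilate j k h).
Proof.
move=> mh; apply: cmfunM; first exact: cmfun_cst.
exact: (cmfun_comp mh (measurable_rV_affine (2 ^ j) (- map_mx intr k))).
Qed.

(** After the affine change of variables the two weights are comparable: 1+|y| is at most [K] times
    the weight at 2^j y - k, with K = (1+2^(-j))(1+|k|). *)
Lemma dilate_weight_lty (j : int) (k : 'rV[int]_n) (h : V -> C) (si : R) :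
  0 <= si -> cmeasurable h ->
  (\int[mu]_y (cabs (h y) * (1 + enorm y) `^ si)%:E < +oo)%E ->
  (\int[mu]_y (cabs (dilate j k h y) * (1 + enorm y) `^ si)%:E < +oo)%E.
Proof.
move=> si0 mh hoo; set r : R := 2 ^ j; set a : V := - map_mx intr k.
have r0 : 0 < r by rewrite exprz_gt0.
have ri : 0 < r^-1 by rewrite invr_gt0.
set u : R := 2 `^ (j%:~R * n%:R / 2).
set K := (1 + r^-1) * (1 + enorm a).
have K0 : 0 <= K by rewrite mulr_ge0 ?addr_ge0 ?enorm_ge0// ltW.
have mw : measurable_fun setT (fun y : V => (cabs (h y) * (1 + enorm y) `^ si)%:E).
  by apply/measurable_EFinP/measurable_funM; [exact: measurable_cabs|exact: measurable_weight].
have W (y : V) : 1 + enorm y <= K * (1 + enorm (r *: y + a)).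
  have -> : enorm y = r^-1 * enorm (r *: y).
    by rewrite enormZ gtr0_norm// mulKf ?gt_eqF.
  have := enormD (r *: y + a) (- a); rewrite addrK enormN => H.
  have := ler_wpM2l (ltW ri) H; rewrite /K.
  have := enorm_ge0 (r *: y + a); have := enorm_ge0 a; move: ri.
  set q := r^-1; set e1 := enorm a; set e2 := enorm (_ + _) => q0 e10 e20 {}H.
  have := mulr_ge0 (ltW q0) e10; have := mulr_ge0 (ltW q0) e20; have := mulr_ge0 e10 e20.
  have := mulr_ge0 (ltW q0) (mulr_ge0 e10 e20); nra.
have I := ge0_integral_affine a (negbT (gt_eqF r0)) mw.
have I0 y : (0 <= (cabs (h y) * (1 + enorm y) `^ si)%:E)%E.
  by rewrite lee_fin mulr_ge0 ?cabs_ge0 ?powR_ge0.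
move: hoo; rewrite (I I0) => hoo.
have ma : measurable_fun setT (fun y : V => (cabs (h (r *: y + a)) * (1 + enorm (r *: y + a)) `^ si)%:E).
  exact: (measurableT_comp mw (measurable_rV_affine r a)).
have Joo : (\int[mu]_y (cabs (h (r *: y + a)) * (1 + enorm (r *: y + a)) `^ si)%:E < +oo)%E.
  have : (0 <= \int[mu]_y (cabs (h (r *: y + a)) * (1 + enorm (r *: y + a)) `^ si)%:E)%E by exact: integral_ge0.
  rewrite le_eqVlt => /orP[/eqP <-//|J0]; rewrite ltNge leye_eq; apply/eqP => Je.
  by move: hoo; rewrite Je gt0_muley// lte_fin exprn_gt0// normr_gt0 gt_eqF.
apply: (integral_scale_lty (k := u * K `^ si) _ _ _ _ _ _ Joo).
- by rewrite mulr_ge0 ?powR_ge0.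
- apply: measurable_funM; last exact: measurable_weight.
  by apply: measurable_cabs; exact: cmeasurable_dilate.
- exact/measurable_EFinP.
- by move=> y; rewrite mulr_ge0 ?cabs_ge0 ?powR_ge0.
- by move=> y; rewrite mulr_ge0 ?cabs_ge0 ?powR_ge0.
- move=> y; rewrite dilate_scale_sub cabsM cabs_real ger0_norm ?powR_ge0//.
  rewrite -/u -/r -/a -!mulrA ler_wpM2l ?powR_ge0// mulrCA ler_wpM2l ?cabs_ge0//.
  rewrite -powRM ?(ltW (weight_gt0 _))//.
  apply: ge0_ler_powR (W y) => //; rewrite nnegrE; first exact/ltW/weight_gt0.
  by apply: mulr_ge0 => //; exact/ltW/weight_gt0.
Qed.

Section blocks.
Hypothesis n_gt0 : (1 <= n)%N.
Variables (a b c1 c2 : R) (phi : V -> C).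
Hypotheses (a0 : 0 < a) (ab : a < b) (c10 : 0 < c1) (c12 : c1 < c2)
  (gphi : lp_generator c1 c2 phi).
Local Notation M := (band_depth a b c1 c2).

(** Reproduction of [h] at level 0, rescaled: the Jacobian of the change of variables is exactly the
    L^1 normalisation of the kernel at level [j]. *)
Lemma dilate_reproduce (h : V -> C) (j : int) (k : 'rV[int]_n) y : band_limited a b h ->
  dilate j k h y = cint (fun x => dilate j k h x * band_kernel_at a b c1 c2 phi j (y - x)).
Proof.
move=> hb; have [_ hi _ _] := hb.
have rphi : rapid phi by case: gphi => /schwartz_rapid.
have rb := rapid_band_kernel a b gphi.
have [K PK] := rapid_bounded rb.
set r : R := 2 ^ j; set e : V := - map_mx intr k.
have r0 : r != 0 by rewrite expfz_neq0.
set c : C := (2 `^ (j%:~R * n%:R / 2) : R)%:C.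
pose G z := h z * band_kernel a b c1 c2 phi ((r *: y + e) - z).
have Gi : cintegrable G.
  apply: (@cintegrableMb _ _ _ _ K) => //.
  have [cb _] := rb; have := cmfun_comp (cmeasurable_continuous cb) (measurable_rV_affine (-1) (r *: y + e)).
  by under [X in cmfun X -> _]eq_fun do rewrite scaleN1r addrC.
rewrite dilate_scale_sub -/c -/r -/e.
rewrite (band_reproduce n_gt0 hb rb (fourier_band_kernel n_gt0 a0 ab c10 c12 gphi)).
rewrite (cint_affine e r0 Gi) -lp_dilate_scale -/r.
rewrite mulrA -cintZ; last exact: (cintegrable_affine e r0 Gi).
congr cint; apply/funext => x; rewrite band_kernel_atE /G dilate_scale_sub -/c -/r -/e.
rewrite (_ : r *: y + e - (r *: x + e) = r *: (y - x)); first by ring.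
by rewrite scalerBr opprD addrACA subrr addr0.
Qed.

(** The reproducing kernel passes from the dual wavelet to [f], and its symmetry makes the result a
    sum of blocks of [f]. Only weighted integrability of [f] enters, so the identity is available
    for [f] in L^p_w. *)
Lemma pairing_blocks (si : R) (f h : V -> C) (j : int) (k : 'rV[int]_n) : 0 <= si ->
  cmeasurable f ->
  (\int[mu]_y (cabs (f y) * (1 + enorm y) `^ (- si))%:E < +oo)%E ->
  band_limited a b h ->
  (\int[mu]_y (cabs (h y) * (1 + enorm y) `^ si)%:E < +oo)%E ->
  pairing f (dilate j k h) =
  cint (fun x => (\sum_(0 <= i < (2 * M).+1) lp_block phi (j + (i%:Z - M%:Z)) (dist_of f) x) *
     (dilate j k h x)^*).
Proof.
move=> si0 mf fw hb hw; set g := dilate j k h.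
have [ch hi _ _] := hb.
have mh : cmeasurable h by exact: cmeasurable_continuous.
have mg : cmeasurable g by exact: cmeasurable_dilate.
have gw : (\int[mu]_y (cabs (g y) * (1 + enorm y) `^ si)%:E < +oo)%E by exact: dilate_weight_lty.
have rphi : rapid phi by case: gphi => /schwartz_rapid.
have rJ i : rapid (lp_dilate phi (j + (i%:Z - M%:Z))) by exact: rapid_lp_dilate.
have rB : rapid (band_kernel_at a b c1 c2 phi j).
  by apply: rapid_sum => i.
have E x : \sum_(0 <= i < (2 * M).+1) lp_block phi (j + (i%:Z - M%:Z)) (dist_of f) x =
  cint (fun y => f y * band_kernel_at a b c1 c2 phi j (x - y)).
  rewrite /lp_block /dist_of -cint_sum.
    by congr cint; apply/funext => y; rewrite -mulr_sumr.
  by move=> i; exact: (cintegrable_section1 si0 mf fw (rJ i)).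
under [in RHS]eq_fun do rewrite E.
have ev (x y : V) : conjc (band_kernel_at a b c1 c2 phi j (y - x)) = band_kernel_at a b c1 c2 phi j (x - y).
  by rewrite -(opprB x y); exact: (band_kernel_at_even n_gt0 a b gphi).
rewrite (pairing_convf si0 mf mg fw gw rB); congr cint; apply/funext => y; congr (_ * _).
rewrite -[LHS]/(conjc (g y)) [g y]dilate_reproduce// -cintJ.
  congr cint; apply/funext => x; rewrite rmorphM; congr (_ * _).
  exact: ev.
have := cintegrable_section2 si0 mg gw rB y.
move=> /(cintegrableJ); congr cintegrable; apply/funext => x.
rewrite rmorphM; congr (_ * _); first exact: conjcK.
by rewrite -[LHS]/(conjc _) -ev -[LHS]/(conjc (conjc _)) conjcK.
Qed.

End blocks.

End pairing_identity.

(** * Muckenhoupt weights *)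

Section power_inequalities.
Context {R : realType}.

(** The tangent to u^p at [m] lies below the graph; in this form it is Young's inequality. *)
Lemma powR_tangent (p u m : R) : 1 < p -> 0 <= u -> 0 <= m ->
  p * (m `^ (p - 1) * u) <= u `^ p + (p - 1) * m `^ p.
Proof.
move=> p1 u0 m0; have p0 : 0 < p by rewrite (lt_trans _ p1).
have pp : 0 < p - 1 by rewrite subr_gt0.
have q0 : 0 < p / (p - 1) by rewrite divr_gt0.
have E : p^-1 + (p / (p - 1))^-1 = 1 by rewrite invf_div; field; rewrite !gt_eqF.
have := @conjugate_powR R u (m `^ (p - 1)) p (p / (p - 1)) u0 (powR_ge0 _ _) p0 q0 E.
rewrite -powRrM (_ : (p - 1) * (p / (p - 1)) = p); last by rewrite mulrC divfK ?gt_eqF.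
move=> /(ler_wpM2l (ltW p0)); rewrite [u * _]mulrC => /le_trans; apply.
apply: le_of_eq; field.
by rewrite !gt_eqF.
Qed.

Lemma powR_pred (p m : R) : 0 < p -> 0 <= m -> m `^ p = m `^ (p - 1) * m.
Proof.
move=> p0 m0; have [->|mn] := eqVneq m 0; first by rewrite mulr0 powR0 ?gt_eqF.
by rewrite -[X in _ = _ * X](powRr1 m0) -powRD ?subrK// mn implybT.
Qed.

(** The tangent inequalities at the weighted mean [m = s / K], summed with the weights [d]; the
    weights are not normalised, hence the power [p - 1] of their total. *)
Lemma jensen_sum (p : R) I (r : seq I) (d u : I -> R) : 1 < p ->
  (forall i, 0 <= d i) -> (forall i, 0 <= u i) ->
  (\sum_(i <- r) d i * u i) `^ p <=
  (\sum_(i <- r) d i) `^ (p - 1) * \sum_(i <- r) d i * u i `^ p.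
Proof.
move=> p1 d0 u0; have p0 : 0 < p by rewrite (lt_trans _ p1).
set K := \sum_(i <- r) d i; set s := \sum_(i <- r) d i * u i.
have K0 : 0 <= K by exact: sumr_ge0.
have s0 : 0 <= s by apply: sumr_ge0 => i _; exact: mulr_ge0.
have S0 : 0 <= \sum_(i <- r) d i * u i `^ p.
  by apply: sumr_ge0 => i _; rewrite mulr_ge0 ?powR_ge0.
have [Kz|Kn] := eqVneq K 0.
  suff -> : s = 0 by rewrite powR0 ?gt_eqF// mulr_ge0 ?powR_ge0.
  move: Kz; rewrite /K /s; elim: r {K s K0 s0 S0} => [|i r IH]; first by rewrite !big_nil.
  rewrite !big_cons => /eqP; rewrite paddr_eq0 ?sumr_ge0// => /andP[/eqP -> /eqP /IH ->].
  by rewrite mul0r addr0.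
have {K0 Kn}K0 : 0 < K by rewrite lt_def Kn.
pose m := s / K; have m0 : 0 <= m by rewrite divr_ge0// ltW.
have T : p * (m `^ (p - 1) * s) <= \sum_(i <- r) d i * u i `^ p + (p - 1) * (m `^ p * K).
  rewrite /s /K mulrA mulr_sumr [m `^ p * _]mulr_sumr mulr_sumr -big_split/=.
  apply: ler_sum => i _; have := ler_wpM2l (d0 i) (powR_tangent p1 (u0 i) m0).
  by rewrite (_ : d i * (p * _) = p * m `^ (p - 1) * (d i * u i)) ?mulrDr; [move/le_trans; apply; rewrite lerD2l [m `^ p * _]mulrC [leRHS]mulrCA|ring].
have sE : s = m * K by rewrite divfK ?gt_eqF.
have mE := powR_pred p0 m0.
have H : m `^ p * K <= \sum_(i <- r) d i * u i `^ p.
  move: T; rewrite sE mulrA -(mulrA p) [m `^ (p - 1) * (m * K)]mulrA -mE; lra.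
rewrite sE powRM ?(ltW K0)// (powR_pred p0 (ltW K0)) mulrCA; apply: ler_wpM2l => //.
exact: powR_ge0.
Qed.

Lemma poweR_le (p : R) (x y : \bar R) : 0 <= p -> (0 <= x)%E -> (x <= y)%E -> (x `^ p <= y `^ p)%E.
Proof.
move=> p0 x0 xy; apply: gt0_ler_poweR => //; rewrite in_itv/= leey andbT//.
exact: le_trans xy.
Qed.

Lemma poweRK (p : R) (x : \bar R) : 0 < p -> (0 <= x)%E -> ((x `^ p^-1) `^ p = x)%E.
Proof. by move=> p0 x0; rewrite -poweRrM mulVf ?gt_eqF// poweRe1. Qed.

Lemma poweRVK (p : R) (x : \bar R) : 0 < p -> (0 <= x)%E -> ((x `^ p) `^ p^-1 = x)%E.
Proof. by move=> p0 x0; rewrite -poweRrM mulfV ?gt_eqF// poweRe1. Qed.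

(** Jensen with weights [d i * v i] and values [t i / v i], which explains the power [1 - p] of
    [v i]. The factors [v i] are free, to be chosen so that later costs restore [d i * v i]. *)
Lemma jensen_series (p K : R) (F : \bar R) (d t v : nat -> R) : 1 < p ->
  (forall i, 0 <= d i) -> (forall i, 0 <= t i) -> (forall i, 0 < v i) ->
  (0 <= F)%E -> (F <= \sum_(0 <= i <oo) (d i * t i)%:E)%E ->
  (\sum_(0 <= i <oo) (d i * v i)%:E <= K%:E)%E ->
  (F `^ p <= \sum_(0 <= i <oo) (K `^ (p - 1) * (d i * v i `^ (1 - p) * t i `^ p))%:E)%E.
Proof.
move=> p1 d0 t0 v0 F0 Fle Kle; have p0 : 0 < p by rewrite (lt_trans _ p1).
set X := (\sum_(0 <= i <oo) _)%E.
have X0 : (0 <= X)%E by apply: nneseries_ge0 => i _ _; rewrite lee_fin !mulr_ge0 ?powR_ge0.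
have K0 : 0 <= K.
  rewrite -lee_fin (le_trans _ Kle)//; apply: nneseries_ge0 => i _ _.
  by rewrite lee_fin mulr_ge0// ltW.
have part m : \sum_(0 <= i < m) d i * v i <= K.
  rewrite -lee_fin (le_trans _ Kle)// -sumEFin; apply: nneseries_lim_ge => i _ _.
  by rewrite lee_fin mulr_ge0// ltW.
(* After taking p-th roots the claim bounds a limit and may be checked on partial sums. *)
suff H : (F <= X `^ p^-1)%E by rewrite -(poweRK p0 X0); apply: poweR_le => //; exact: ltW.
apply: (le_trans Fle); apply: lime_le.
  by apply: is_cvg_nneseries => i _ _; rewrite lee_fin mulr_ge0.
apply: nearW => m; rewrite /= sumEFin.
have sm0 : 0 <= \sum_(0 <= i < m) d i * t i by apply: sumr_ge0 => i _; exact: mulr_ge0.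
rewrite -(@poweRVK p (_%:E) p0) ?lee_fin//; apply: poweR_le; rewrite ?poweR_ge0 ?invr_ge0 ?(ltW p0)//.
rewrite poweR_EFin.
have E i : d i * t i = (d i * v i) * (t i / v i) by rewrite -mulrA [v i * _]mulrC divfK ?gt_eqF.
apply: (@le_trans _ _ (\sum_(0 <= i < m) (K `^ (p - 1) * (d i * v i `^ (1 - p) * t i `^ p))%:E)%E); last first.
  by apply: nneseries_lim_ge => i _ _; rewrite lee_fin !mulr_ge0 ?powR_ge0.
rewrite sumEFin lee_fin; under eq_bigr do rewrite E.
apply: (le_trans (jensen_sum _ p1 _ _)) => [i|i|].
- by rewrite mulr_ge0// ltW.
- by rewrite divr_ge0// ltW.
rewrite -mulr_sumr; apply: ler_pM; rewrite ?powR_ge0//.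
- by apply: sumr_ge0 => i _; rewrite !mulr_ge0 ?powR_ge0// ltW.
- apply: ge0_ler_powR; rewrite ?nnegrE ?subr_ge0 ?(ltW p1)//.
  by apply: sumr_ge0 => i _; rewrite mulr_ge0// ltW.
apply: ler_sum => i _; apply: le_of_eq.
have iv : 0 <= (v i)^-1 by rewrite invr_ge0 ltW.
rewrite powRM// -mulrA -[RHS]mulrA; congr (_ * _).
rewrite [X in _ * X]mulrC mulrA; congr (_ * _).
rewrite -powR_inv1 ?(ltW (v0 i))// -powRrM mulN1r -[X in X * _ = _](powRr1 (ltW (v0 i))) -powRD//.
by rewrite (gt_eqF (v0 i)) implybT.
Qed.

End power_inequalities.

Section weights.
Context {R : realType} {n : nat}.
Local Notation V := 'rV[R]_n.
Local Notation mu := (@lebesgue_rV R n).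

Lemma integral_indicE (Q : set V) (u : V -> R) :
  (\int[mu]_(x in Q) (u x)%:E = \int[mu]_x (u x * \1_Q x)%:E)%E.
Proof.
rewrite integral_mkcond; apply: eq_integral => x _; rewrite patchE indicE.
by case: ifP => _; rewrite ?mulr1 ?mulr0.
Qed.

Variables (p : R) (w : V -> R) (A : R).
Hypotheses (p1 : 1 < p) (mw : measurable_fun setT w) (w0 : forall x, 0 < w x).

Let p0 : 0 < p. Proof. by rewrite (lt_trans _ p1). Qed.
Let pp : 0 < p - 1. Proof. by rewrite subr_gt0. Qed.

Lemma hoelder_power (f g : V -> R) : measurable_fun setT f -> measurable_fun setT g ->
  (forall x, 0 <= f x) -> (forall x, 0 <= g x) ->
  ((\int[mu]_x (f x * g x)%:E) `^ p <=
   (\int[mu]_x (f x `^ p)%:E) * (\int[mu]_x (g x `^ (p / (p - 1)))%:E) `^ (p - 1))%E.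
Proof.
move=> mf mg f0 g0; have q0 : 0 < p / (p - 1) by rewrite divr_gt0.
have E : p^-1 + (p / (p - 1))^-1 = 1 by rewrite invf_div; field; rewrite !gt_eqF.
have H := hoelder mu mf mg p0 q0 E.
have N1 : (0 <= 'N[mu]_1[EFin \o (f \* g)%R])%E by exact: Lnorm_ge0.
have := poweR_le (ltW p0) N1 H; rewrite poweRM ?Lnorm_ge0//.
rewrite poweR_Lnorm ?gt_eqF// -{1}(poweRe1 N1) poweR_Lnorm ?oner_neq0//.
have -> : ('N[mu]_(p / (p - 1))%:E[EFin \o g] `^ p =
    (\int[mu]_x `|(EFin \o g) x| `^ (p / (p - 1))) `^ (p - 1))%E.
  by rewrite -poweR_Lnorm ?gt_eqF// -poweRrM divfK ?gt_eqF.
have -> : (\int[mu]_x `|(EFin \o (f \* g)%R) x| `^ 1 = \int[mu]_x (f x * g x)%:E)%E.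
  by apply: eq_integral => x _ /=; rewrite ger0_norm ?mulr_ge0// powRr1 ?mulr_ge0.
have abs (u : V -> R) t : (forall x, 0 <= u x) ->
    (\int[mu]_x `|(EFin \o u) x| `^ t = \int[mu]_x (u x `^ t)%:E)%E.
  by move=> u0; apply: eq_integral => x _ /=; rewrite ger0_norm.
by rewrite !abs.
Qed.

(** The dual weight w^(1-p') of the A_p condition. *)
Let sg (y : V) := w y `^ (- (p - 1)^-1).

Let mpow t : measurable_fun setT (fun y => w y `^ t).
Proof. exact: (measurableT_comp (measurable_powR t)). Qed.

(** Hoelder for the splitting of [g] into g w^(1/p) and w^(-1/p); the p'-th power of the second
    factor is the dual weight. *)
Lemma hoelder_weight (Q : set V) (g : V -> R) : measurable Q -> measurable_fun setT g ->
  (forall x, 0 <= g x) ->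
  ((\int[mu]_x (g x * \1_Q x)%:E) `^ p <=
   (\int[mu]_x (g x `^ p * w x * \1_Q x)%:E) * (\int[mu]_x (sg x * \1_Q x)%:E) `^ (p - 1))%E.
Proof.
move=> mQ mg g0; have mI : measurable_fun setT (\1_Q : V -> R) by exact: measurable_indic.
pose f1 x := g x * w x `^ p^-1 * \1_Q x.
pose f2 x := w x `^ (- p^-1) * \1_Q x.
have I0 x : (0 : R) <= \1_Q x by [].
have := @hoelder_power f1 f2 _ _ _ _.
have -> : (\int[mu]_x (f1 x * f2 x)%:E = \int[mu]_x (g x * \1_Q x)%:E)%E.
  apply: eq_integral => x _; congr EFin; rewrite /f1 /f2 powRN.
  have wn : w x `^ p^-1 != 0 by rewrite gt_eqF// powR_gt0.
  rewrite indicE; case: (x \in Q); rewrite ?mulr0 ?mulr1//.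
  by rewrite -mulrA divff ?mulr1.
have -> : (\int[mu]_x (f1 x `^ p)%:E = \int[mu]_x (g x `^ p * w x * \1_Q x)%:E)%E.
  apply: eq_integral => x _; congr EFin; rewrite /f1 indicE; case: (x \in Q); last by rewrite !mulr0 powR0// gt_eqF.
  by rewrite !mulr1 powRM ?powR_ge0// -powRrM mulVf ?gt_eqF// powRr1// ltW.
have -> : (\int[mu]_x (f2 x `^ (p / (p - 1)))%:E = \int[mu]_x (sg x * \1_Q x)%:E)%E.
  apply: eq_integral => x _; congr EFin; rewrite /f2 /sg indicE; case: (x \in Q).
    by rewrite !mulr1 -powRrM mulNr mulrA mulVf ?gt_eqF// mul1r.
  by rewrite !mulr0 powR0// gt_eqF// divr_gt0.
apply.
- by apply: measurable_funM => //; apply: measurable_funM.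
- exact: measurable_funM.
- by move=> x; rewrite !mulr_ge0 ?powR_ge0.
- by move=> x; rewrite !mulr_ge0 ?powR_ge0.
Qed.

Hypothesis hA : forall (c : V) (d : R), 0 < d ->
  (average w (cube c d) * average sg (cube c d) `^ (p - 1) <= A%:E)%E.

Definition wmass (Q : set V) : R := fine (\int[mu]_x (w x * \1_Q x)%:E)%E.
Definition smass (Q : set V) : R := fine (\int[mu]_x (sg x * \1_Q x)%:E)%E.

Let mwQ (Q : set V) : measurable Q -> measurable_fun setT (fun x => (w x * \1_Q x)%:E).
Proof. by move=> mQ; apply/measurable_EFinP/measurable_funM => //; exact: measurable_indic. Qed.
Let msQ (Q : set V) : measurable Q -> measurable_fun setT (fun x => (sg x * \1_Q x)%:E).
Proof. by move=> mQ; apply/measurable_EFinP/measurable_funM; [exact: mpow|exact: measurable_indic]. Qed.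

Let wQ0 (Q : set V) : (0 <= \int[mu]_x (w x * \1_Q x)%:E)%E.
Proof. by apply: integral_ge0 => x _; rewrite lee_fin mulr_ge0 ?(ltW (w0 x)). Qed.
Let sQ0 (Q : set V) : (0 <= \int[mu]_x (sg x * \1_Q x)%:E)%E.
Proof. by apply: integral_ge0 => x _; rewrite lee_fin mulr_ge0 ?powR_ge0. Qed.

(** Hoelder with [g = 1] gives the lower bound, which forces both masses to be positive; the A_p
    bound, a product of factors now known to be positive, then forces both to be finite. *)
Lemma cube_masses (c : V) (d : R) (Q := cube c d) : 0 < d ->
  [/\ (\int[mu]_x (w x * \1_Q x)%:E = (wmass Q)%:E)%E,
      (\int[mu]_x (sg x * \1_Q x)%:E = (smass Q)%:E)%E,
      0 < wmass Q, 0 <= smass Q &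
      (d ^+ n) `^ p <= wmass Q * smass Q `^ (p - 1) <= A * (d ^+ n) `^ p].
Proof.
move=> d0; have mQ : measurable Q by exact: measurable_cube.
have m0 : 0 < d ^+ n by rewrite exprn_gt0.
have muQ : mu Q = (d ^+ n)%:E by exact: lebesgue_rV_cube (ltW d0).
have avE u : (average u Q = (d ^+ n)^-1%:E * \int[mu]_x (u x * \1_Q x)%:E)%E.
  by rewrite -integral_indicE -[X in (X^-1)%:E]/(fine (d ^+ n)%:E) -muQ.
have := hA c d0; rewrite -/Q !avE.
have := @hoelder_weight Q (cst 1) mQ (measurable_cst _) (fun=> ler01).
have -> : (\int[mu]_x (cst 1 x * \1_Q x)%:E = mu Q)%E.
  by rewrite -integral_indic_rV//; apply: eq_integral => x _; rewrite /= mul1r.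
have -> : (\int[mu]_x (cst 1 x `^ p * w x * \1_Q x)%:E = \int[mu]_x (w x * \1_Q x)%:E)%E.
  by apply: eq_integral => x _; rewrite /= powR1 mul1r.
rewrite muQ poweR_EFin /wmass /smass.
set W := (\int[mu]_x (w x * _)%:E)%E; set S := (\int[mu]_x (sg x * _)%:E)%E.
have W0 : (0 <= W)%E by exact: wQ0.
have S0 : (0 <= S)%E by exact: sQ0.
have mi0 : 0 < (d ^+ n)^-1 by rewrite invr_gt0.
move=> H1 H2.
have mp0 : 0 < (d ^+ n) `^ p by rewrite powR_gt0.
have Wp : (0 < W)%E.
  rewrite lt_def W0 andbT; apply/eqP => Wz; move: H1; rewrite Wz mul0e lee_fin.
  by rewrite leNgt mp0.
have Sp : (0 < S)%E.
  rewrite lt_def S0 andbT; apply/eqP => Sz; move: H1; rewrite Sz poweR0r ?gt_eqF//.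
  by rewrite mule0 lee_fin leNgt mp0.
have mSp : (0 < ((d ^+ n)^-1%:E * S) `^ (p - 1))%E.
  by apply: poweR_gt0; rewrite mule_gt0.
have Wf : W \is a fin_num.
  rewrite ge0_fin_numE// ltNge leye_eq; apply/eqP => Wy.
  by move: H2; rewrite Wy gt0_muley ?lte_fin// gt0_mulye// leye_eq.
have Sf : S \is a fin_num.
  rewrite ge0_fin_numE// ltNge leye_eq; apply/eqP => Sy.
  move: H2; rewrite Sy gt0_muley ?lte_fin// poweRyr ?gt_eqF// gt0_muley ?leye_eq//.
  by rewrite mule_gt0.
have Wr : 0 < fine W by rewrite fine_gt0// Wp ltey_eq Wf.
have Sr : 0 < fine S by rewrite fine_gt0// Sp ltey_eq Sf.
split; rewrite ?fineK ?(ltW Sr)//.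
have Wa : W = (fine W)%:E by rewrite fineK.
have Sb : S = (fine S)%:E by rewrite fineK.
rewrite Wa Sb in H1 H2; move: H1 H2 Wr Sr; set a := fine W; set b := fine S => H1 H2 Wr Sr.
move: H1 H2; rewrite -!EFinM !lee_fin => -> /=.
rewrite powRM ?(ltW mi0)// ?(ltW Sr)// => H2.
rewrite -ler_pdivrMr// (le_trans _ H2)//; apply: le_of_eq.
rewrite -[in RHS]powR_inv1 ?(ltW m0)// -!powRrM mulN1r.
rewrite [in RHS]mulrACA -powRD ?(gt_eqF m0) ?implybT//.
by rewrite mulrC -powRN; congr (_ `^ _ * _); ring.
Qed.

Lemma wmass_gt0 (c : V) (d : R) : 0 < d -> 0 < wmass (cube c d).
Proof. by move=> /(cube_masses c)[]. Qed.

(** The two bounds on the masses, compared on the unit cube. *)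
Lemma Ap_const_ge1 : 1 <= A.
Proof.
have [_ _ _ _ /andP[H1 H2]] := cube_masses 0 ltr01.
by have := le_trans H1 H2; rewrite expr1n powR1 mulr1.
Qed.

Lemma weighted_average (c : V) (d : R) (g : V -> R) (Q := cube c d) : 0 < d ->
  measurable_fun setT g -> (forall x, 0 <= g x) ->
  ((wmass Q)%:E * (\int[mu]_x (g x * \1_Q x)%:E) `^ p <=
   (A * (d ^+ n) `^ p)%:E * \int[mu]_x (g x `^ p * w x * \1_Q x)%:E)%E.
Proof.
move=> d0 mg g0; have mQ : measurable Q by exact: measurable_cube.
have [WE SE W0 S0 /andP[_ H]] := cube_masses c d0.
have := hoelder_weight mQ mg g0; rewrite -/Q SE => /(lee_wpmul2l (x := (wmass Q)%:E)).
rewrite lee_fin => /(_ (ltW W0)) /le_trans; apply.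
rewrite muleCA muleC poweR_EFin -EFinM; apply: lee_wpmul2r; last by rewrite lee_fin.
by apply: integral_ge0 => x _; rewrite lee_fin !mulr_ge0 ?powR_ge0 ?(ltW (w0 x)).
Qed.

(** The lower bound of [cube_masses] on the small cube and the upper bound on the large one are
    linked by monotonicity of the dual mass. *)
Lemma wmass_doubling (c c' : V) (d d' : R) : 0 < d -> 0 < d' -> cube c d `<=` cube c' d' ->
  wmass (cube c' d') * (d ^+ n) `^ p <= A * (d' ^+ n) `^ p * wmass (cube c d).
Proof.
move=> d0 d0' sQ.
have [WE SE W0 S0 /andP[H _]] := cube_masses c d0.
have [WE' SE' W0' S0' /andP[_ H']] := cube_masses c' d0'.
have SS : smass (cube c d) <= smass (cube c' d').
  rewrite -lee_fin -SE -SE'; apply: le_integral_EFin.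
  - by apply/measurable_EFinP; apply: msQ; exact: measurable_cube.
  - by apply/measurable_EFinP; apply: msQ; exact: measurable_cube.
  - by move=> x; rewrite mulr_ge0 ?powR_ge0.
  - move=> x; rewrite ler_wpM2l ?powR_ge0// !indicE.
    case: (boolP (x \in cube c d)) => // /set_mem /sQ xQ.
    by rewrite (mem_set xQ).
have key (W S W' S' D D' : R) : 0 < W -> 0 <= S -> 0 < W' -> S <= S' ->
    D <= W * S `^ (p - 1) -> W' * S' `^ (p - 1) <= A * D' -> W' * D <= A * D' * W.
  move=> Wp Sp Wp' SS' D1 D2; rewrite (le_trans (ler_wpM2l (ltW Wp') D1))//.
  rewrite mulrCA [leRHS]mulrC ler_wpM2l ?(ltW Wp)// (le_trans _ D2)// ler_wpM2l ?(ltW Wp')//.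
  by apply: ge0_ler_powR; rewrite ?nnegrE ?(ltW pp)// (le_trans Sp).
exact: key W0 S0 W0' SS H H'.
Qed.

End weights.

(** * Synthesis and analysis on one level *)

Section layers.
Context {R : realType} {n : nat}.
Local Notation V := 'rV[R]_n.
Local Notation mu := (@lebesgue_rV R n).
Local Notation C := R[i].

(** [-i, i+1)^n: the unit cube at the origin surrounded by i rings of unit cubes. *)
Definition layer (i : nat) : set V := cube (const_mx (- i%:R)) (2 * i + 1)%:R.

(** If [y - k] lies in the layer, each coordinate of [k] differs from the integer part of that of
    [y] by at most i. This leaves 2i+1 choices per coordinate, encoded by the injective [f]. *)
Lemma layer_overlap (i : nat) (y : V) (s : seq 'rV[int]_n) : uniq s ->
  \sum_(k <- s) \1_(layer i) (y - map_mx intr k) <= ((2 * i + 1)%:R : R) ^+ n.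
Proof.
move=> us; under eq_bigr do rewrite indicE.
rewrite -natr_sum -natrX ler_nat -big_mkcond/= sum1_count.
set P := fun k => _; rewrite -size_filter.
pose f (k : 'rV[int]_n) : {ffun 'I_n -> 'I_(2 * i).+1} :=
  [ffun l => inord (absz (k ord0 l - Num.floor (y ord0 l) + i%:Z))].
have kP k l : P k -> - i%:Z <= k ord0 l - Num.floor (y ord0 l) <= i%:Z.
  move=> /set_mem /(_ l); rewrite !mxE => /andP[k1 k2].
  have := floor_le_tmp (y ord0 l); have := floorD1_gt (y ord0 l).
  set z := Num.floor _; set q := k ord0 l => z1 z2.
  have a1 : (z - q - i%:Z)%:~R < (1 : int)%:~R :> R.
    move: k2 z2; rewrite !rmorphB natrD natrM/= -!pmulrn /=; lra.
  have a2 : (- 1 : int)%:~R < (z + i%:Z - q)%:~R :> R.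
    move: k1 z1; rewrite !(rmorphB, rmorphD)/= ?rmorphN/= -!pmulrn/=; lra.
  move: a1 a2; rewrite !ltr_int; lia.
have fi : {in [seq k <- s | P k] &, injective f}.
  move=> k k'; rewrite !mem_filter => /andP[Pk _] /andP[Pk' _] /ffunP E.
  apply/rowP => l; have := congr1 val (E l); rewrite !ffunE.
  move: (kP k l Pk) (kP k' l Pk'); set a := k ord0 l; set b := k' ord0 l; set z := Num.floor _.
  move=> ka kb; rewrite /= !inordK; lia.
rewrite -(size_map f) -(card_uniqP _); last by rewrite map_inj_in_uniq ?filter_uniq.
by rewrite (leq_trans (max_card _))// card_ffun !card_ord addn1.
Qed.

Variable rho : R.
Hypothesis rho0 : 0 < rho.

(** Preimage of the layer under x -> rho x - k; for rho = 2^j and i = 0 it is the dyadic cube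
    Q_{j,k}. *)
Definition layer_at (k : 'rV[int]_n) (i : nat) : set V :=
  cube (rho^-1 *: (map_mx intr k - const_mx i%:R)) ((2 * i + 1)%:R * rho^-1).

Lemma layer_atE k i (x : V) :
  \1_(layer_at k i) x = \1_(layer i) (rho *: x - map_mx intr k) :> R.
Proof.
rewrite !indicE; congr (_%:R); congr nat_of_bool; apply/idP/idP => /set_mem H; apply: mem_set => l;
  have := H l; rewrite !mxE => /andP[H1 H2]; apply/andP; split.
- move: H1; rewrite ler_pdivrMl//; lra.
- move: H2; rewrite -(ltr_pM2l rho0) mulrDr mulrA divff ?gt_eqF// mul1r mulrCA divff ?gt_eqF//; lra.
- by rewrite ler_pdivrMl//; lra.
- by rewrite -(ltr_pM2l rho0) mulrDr mulrA divff ?gt_eqF// mul1r mulrCA divff ?gt_eqF//; lra.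
Qed.

Lemma layer_side_gt0 i : 0 < (2 * i + 1)%:R * rho^-1.
Proof. by rewrite mulr_gt0 ?invr_gt0// ltr0n addn1. Qed.

Lemma measurable_layer_at k i : measurable (layer_at k i).
Proof. exact: measurable_cube. Qed.

Lemma layer_at_sub k i : layer_at k 0 `<=` layer_at k i.
Proof.
move=> x H l; have := H l; rewrite !mxE => /andP[H1 H2].
have ri : 0 < rho^-1 by rewrite invr_gt0.
have i0 : 0 <= i%:R :> R by [].
move: H1 H2 ri; rewrite muln0 add0n natrD natrM; set q := rho^-1; set a := _%:~R => H1 H2 ri.
by apply/andP; split; nra.
Qed.

End layers.
Section frame_bounds.
Context {R : realType} {n : nat}.
Local Notation V := 'rV[R]_n.
Local Notation mu := (@lebesgue_rV R n).
Local Notation C := R[i].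
Variables (p : R) (w : V -> R) (A : R).
Hypotheses (p1 : 1 < p) (mw : measurable_fun setT w) (w0 : forall x, 0 < w x).
Hypothesis hA : forall (c : V) (d : R), 0 < d ->
  (average w (cube c d) * average (fun y => w y `^ (- (p - 1)^-1))%R (cube c d) `^ (p - 1) <= A%:E)%E.
Variables (rho : R) (rho0 : 0 < rho).
Variables (h : V -> C) (dl : nat -> R) (g K : R).
Hypotheses (mh : cmeasurable h) (dl0 : forall i, 0 <= dl i)
  (hdl : forall z, ((cabs (h z))%:E <= \sum_(0 <= i <oo) (dl i * \1_(layer i) z)%:E)%E)
  (K0 : 0 <= K)
  (hK : (\sum_(0 <= i <oo) (dl i * (2 * i + 1)%:R `^ g)%:E <= K%:E)%E).

Local Notation Q := (layer_at rho).
Local Notation hk k x := (cabs (h (rho *: (x : V) - map_mx intr (k : 'rV[int]_n)))).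
Local Notation N i := ((2 * i + 1)%:R : R).

Let p0 : 0 < p. Proof. by rewrite (lt_trans _ p1). Qed.
Let N0 i : 0 < N i. Proof. by rewrite ltr0n addn1. Qed.
Let A0 : 0 <= A. Proof. by rewrite (le_trans ler01)// (Ap_const_ge1 p1 mw w0 hA). Qed.

Let N1 i : 1 <= N i. Proof. by rewrite ler1n addn1. Qed.

Lemma wmass_layer k i : wmass w (Q k i) <= A * N i `^ (n%:R * p) * wmass w (Q k 0).
Proof.
have r0 : 0 < (rho^-1 ^+ n) `^ p by rewrite powR_gt0// exprn_gt0// invr_gt0.
rewrite -(ler_pM2r r0).
have := wmass_doubling p1 mw w0 hA (layer_side_gt0 rho0 0) (layer_side_gt0 rho0 i) (@layer_at_sub _ _ _ rho0 k i).
rewrite -/(layer_at rho k i) -/(layer_at rho k 0) muln0 add0n mul1r => /le_trans; apply.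
rewrite exprMn powRM ?exprn_ge0 ?invr_ge0 ?(ltW rho0) ?(ltW (N0 i))//.
rewrite -(powR_mulrn _ (ltW (N0 i))) -powRrM; apply: le_of_eq.
by rewrite mulrA mulrAC.
Qed.

Lemma measurable_hk k : measurable_fun setT (fun x : V => hk k x).
Proof.
apply: measurable_cabs.
exact: (cmfun_comp mh (measurable_rV_affine rho (- map_mx intr k))).
Qed.

Let mQi k i : measurable_fun setT (fun x : V => \1_(Q k i) x : R).
Proof. by apply: measurable_indic; exact: measurable_layer_at. Qed.

Lemma hk_layers k x : ((hk k x)%:E <= \sum_(0 <= i <oo) (dl i * \1_(Q k i) x)%:E)%E.
Proof.
apply: (le_trans (hdl _)); apply: le_of_eq.
by apply: eq_eseriesr => i _; rewrite layer_atE.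
Qed.

Lemma sum_layer_at (i : nat) (x : V) (s : seq 'rV[int]_n) : uniq s ->
  \sum_(k <- s) \1_(Q k i) x <= N i ^+ n.
Proof.
move=> us; under eq_bigr do rewrite layer_atE//.
exact: layer_overlap.
Qed.

(** The balancing weights of Jensen's inequality over the layers; either choice of [g] below makes
    the accumulated powers of 2i+1 collapse to [v i]. *)
Let v i := N i `^ g.
Let v0 i : 0 < v i. Proof. by rewrite powR_gt0. Qed.

Section synthesis.
(* The doubling of w costs (2i+1)^(np), the overlap of the layers (2i+1)^(n(p-1)). *)
Hypothesis gE : g * p = n%:R * p + n%:R * (p - 1).
Variables (s : seq 'rV[int]_n) (c : 'rV[int]_n -> R).
Hypotheses (us : uniq s) (c0 : forall k, 0 <= c k).

Let a i := K `^ (p - 1) * (dl i * v i `^ (1 - p)) * N i `^ (n%:R * (p - 1)).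
Let a0 i : 0 <= a i. Proof. by rewrite !mulr_ge0 ?powR_ge0. Qed.

Let pointwise x : (((\sum_(k <- s) c k * hk k x) `^ p * w x)%:E <=
  \sum_(0 <= i <oo) (a i * \sum_(k <- s) c k `^ p * (w x * \1_(Q k i) x))%:E)%E.
Proof.
pose t i := \sum_(k <- s) c k * \1_(Q k i) x.
have t0 i : 0 <= t i by apply: sumr_ge0 => k _; rewrite mulr_ge0.
have F0 : (0 <= (\sum_(k <- s) c k * hk k x)%:E)%E.
  by rewrite lee_fin; apply: sumr_ge0 => k _; rewrite mulr_ge0 ?cabs_ge0.
have Fle : ((\sum_(k <- s) c k * hk k x)%:E <= \sum_(0 <= i <oo) (dl i * t i)%:E)%E.
  rewrite -sumEFin; apply: (@le_trans _ _ (\sum_(k <- s) \sum_(0 <= i <oo) (c k * (dl i * \1_(Q k i) x))%:E)%E).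
    apply: lee_sum => k _; rewrite EFinM.
    under eq_eseriesr do rewrite EFinM.
    rewrite nneseriesZl; last by move=> i _; rewrite lee_fin mulr_ge0.
    by apply: lee_wpmul2l; [rewrite lee_fin|exact: hk_layers].
  rewrite -nneseries_sum; last by move=> k i _; rewrite lee_fin !mulr_ge0.
  apply: lee_nneseries => [i _ _|i _]; first by rewrite sume_ge0// => k _; rewrite lee_fin !mulr_ge0.
  rewrite sumEFin lee_fin /t mulr_sumr; apply: ler_sum => k _.
  by rewrite mulrCA.
have := jensen_series p1 dl0 t0 v0 F0 Fle hK.
rewrite poweR_EFin => /(lee_wpmul2l (x := (w x)%:E)).
rewrite lee_fin => /(_ (ltW (w0 x))); rewrite -EFinM mulrC => /le_trans; apply.
rewrite -nneseriesZl; last by move=> i _; rewrite lee_fin !mulr_ge0 ?powR_ge0.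
apply: lee_nneseries => [i _ _|i _]; first by rewrite mule_ge0 ?lee_fin ?(ltW (w0 x))// !mulr_ge0 ?powR_ge0.
rewrite -EFinM lee_fin.
(* Jensen over [k] with the indicators as weights; their total is the overlap. *)
have J : t i `^ p <= N i `^ (n%:R * (p - 1)) * \sum_(k <- s) c k `^ p * \1_(Q k i) x.
  rewrite /t; under eq_bigr do rewrite mulrC.
  have I0 (k : 'rV[int]_n) : (0 : R) <= \1_(Q k i) x by [].
  apply: (le_trans (jensen_sum s p1 I0 c0)); under [in X in _ * X <= _]eq_bigr do rewrite mulrC.
  apply: ler_wpM2r.
    by apply: sumr_ge0 => k _; rewrite mulr_ge0 ?powR_ge0.
  rewrite powRrM powR_mulrn ?(ltW (N0 i))//.
  apply: ge0_ler_powR; rewrite ?nnegrE ?subr_ge0 ?(ltW p1) ?sumr_ge0 ?exprn_ge0 ?(ltW (N0 i))//.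
  exact: sum_layer_at.
apply: (@le_trans _ _ (w x * (K `^ (p - 1) * (dl i * v i `^ (1 - p) * (N i `^ (n%:R * (p - 1)) * \sum_(k <- s) c k `^ p * \1_(Q k i) x))))).
  by rewrite !ler_wpM2l ?mulr_ge0 ?powR_ge0 ?(ltW (w0 x)).
apply: le_of_eq.
rewrite /a; under [in RHS]eq_bigr do rewrite mulrCA.
by rewrite -mulr_sumr; ring.
Qed.

(** Doubling replaces the mass of every layer by that of the innermost cube. The remaining series is
    the one bounded by [K], which completes K^(p-1) to K^p. *)
Lemma synthesis_bound :
  (\int[mu]_x ((\sum_(k <- s) c k * hk k x) `^ p * w x)%:E <=
   (K `^ p * A * \sum_(k <- s) c k `^ p * wmass w (Q k 0))%:E)%E.
Proof.
have mQw k i : measurable_fun setT (fun x : V => (w x * \1_(Q k i) x)%:E).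
  by apply/measurable_EFinP; exact: measurable_funM.
have msum i : measurable_fun setT (fun x : V => \sum_(k <- s) c k `^ p * (w x * \1_(Q k i) x)).
  by apply: measurable_sum => k; apply: measurable_funM => //; exact: measurable_funM.
have sum0 i x : 0 <= \sum_(k <- s) c k `^ p * (w x * \1_(Q k i) x).
  by apply: sumr_ge0 => k _; rewrite !mulr_ge0 ?powR_ge0 ?(ltW (w0 x)).
have mterm i : measurable_fun setT (fun x : V => (a i * \sum_(k <- s) c k `^ p * (w x * \1_(Q k i) x))%:E).
  by apply/measurable_EFinP/measurable_funM.
have mF : measurable_fun setT (fun x : V => ((\sum_(k <- s) c k * hk k x) `^ p * w x)%:E).
  apply/measurable_EFinP/measurable_funM => //.
  apply: (measurableT_comp (measurable_powR p)); apply: measurable_sum => k.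
  by apply: measurable_funM => //; exact: measurable_hk.
apply: (@le_trans _ _ (\int[mu]_x \sum_(0 <= i <oo) (a i * \sum_(k <- s) c k `^ p * (w x * \1_(Q k i) x))%:E)%E).
  apply: ge0_le_integral; first exact: measurableT.
  - by move=> x _; rewrite lee_fin mulr_ge0 ?powR_ge0 ?(ltW (w0 x)).
  - exact: mF.
  - by apply: ge0_emeasurable_sum => // i x _ _; rewrite lee_fin mulr_ge0.
  - by move=> x _; exact: pointwise.
rewrite integral_nneseries//; last by move=> i x _; rewrite lee_fin mulr_ge0.
set Y := \sum_(k <- s) c k `^ p * wmass w (Q k 0).
have Y0 : 0 <= Y.
  apply: sumr_ge0 => k _; rewrite mulr_ge0 ?powR_ge0// ltW//.
  exact: (wmass_gt0 p1 mw w0 hA _ (layer_side_gt0 rho0 0)).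
apply: (@le_trans _ _ (\sum_(0 <= i <oo) ((K `^ (p - 1) * A * Y)%:E * (dl i * v i)%:E))%E).
  apply: lee_nneseries => [i _ _|i _].
    by apply: integral_ge0 => x _; rewrite lee_fin mulr_ge0.
  under eq_integral do rewrite EFinM.
  rewrite ge0_integralZl_EFin//; last 2 first.
  - by move=> x _; rewrite lee_fin.
  - exact/measurable_EFinP.
  under eq_integral do rewrite -sumEFin.
  rewrite ge0_integral_sum//; last 2 first.
  - by move=> k; apply/measurable_EFinP/measurable_funM => //; exact: measurable_funM.
  - by move=> k x _; rewrite lee_fin !mulr_ge0 ?powR_ge0 ?(ltW (w0 x)).
  have -> : (\sum_(k <- s) \int[mu]_x (c k `^ p * (w x * \1_(Q k i) x))%:E =
      (\sum_(k <- s) c k `^ p * wmass w (Q k i))%:E)%E.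
    rewrite -sumEFin; apply: eq_bigr => k _; under eq_integral do rewrite EFinM.
    rewrite ge0_integralZl_EFin ?powR_ge0//; last by move=> x _; rewrite lee_fin mulr_ge0 ?(ltW (w0 x)).
    have [-> _ _ _ _] := cube_masses p1 mw w0 hA (rho^-1 *: (map_mx intr k - const_mx i%:R)) (layer_side_gt0 rho0 i).
    by rewrite EFinM.
  rewrite -!EFinM lee_fin.
  apply: (@le_trans _ _ (a i * \sum_(k <- s) c k `^ p * (A * N i `^ (n%:R * p) * wmass w (Q k 0)))).
    by apply: ler_wpM2l => //; apply: ler_sum => k _; rewrite ler_wpM2l ?powR_ge0// wmass_layer.
  apply: le_of_eq.
  under eq_bigr do rewrite mulrCA; rewrite -mulr_sumr -/Y.
  (* The exponents g(1-p), n(p-1) and np add up to g by [gE]. *)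
  have E : v i `^ (1 - p) * N i `^ (n%:R * (p - 1)) * N i `^ (n%:R * p) = v i.
    rewrite /v -powRrM -!powRD ?(gt_eqF (N0 i)) ?implybT//; congr (_ `^ _).
    by rewrite mulrBr mulr1 gE; ring.
  by rewrite -[in RHS]E /a; ring.
rewrite nneseriesZl; last by move=> i _; rewrite lee_fin mulr_ge0 ?(ltW (v0 i)).
apply: (le_trans (lee_wpmul2l _ hK)); first by rewrite lee_fin !mulr_ge0 ?powR_ge0.
by rewrite -EFinM lee_fin (powR_pred p0 K0); apply: le_of_eq; ring.
Qed.

End synthesis.

Section analysis.
(* The averages over the layers cost (2i+1)^(np), their overlap (2i+1)^n. *)
Hypothesis gE : g * p = n%:R * p + n%:R.
Variables (s : seq 'rV[int]_n) (G : V -> R).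
Hypotheses (us : uniq s) (mG : measurable_fun setT G) (G0 : forall x, 0 <= G x)
  (Goo : (\int[mu]_x (G x `^ p * w x)%:E < +oo)%E).

Let X := (\int[mu]_x (G x `^ p * w x)%:E)%E.
Let I k i := (\int[mu]_x (G x * \1_(Q k i) x)%:E)%E.
Let P k i := (\int[mu]_x (G x `^ p * w x * \1_(Q k i) x)%:E)%E.

Let mGp : measurable_fun setT (fun x : V => G x `^ p).
Proof. exact: (measurableT_comp (measurable_powR p)). Qed.

Let mGI k i : measurable_fun setT (fun x : V => (G x * \1_(Q k i) x)%:E).
Proof. by apply/measurable_EFinP; exact: measurable_funM. Qed.

Let mdG k i : measurable_fun setT (fun x : V => (dl i * (G x * \1_(Q k i) x))%:E).
Proof. by apply/measurable_EFinP; apply: measurable_funM => //; exact: measurable_funM. Qed.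

Let mGP k i : measurable_fun setT (fun x : V => (G x `^ p * w x * \1_(Q k i) x)%:E).
Proof. by apply/measurable_EFinP; apply: measurable_funM => //; exact: measurable_funM. Qed.

Let Gw0 x : 0 <= G x `^ p * w x.
Proof. by rewrite mulr_ge0 ?powR_ge0 ?(ltW (w0 x)). Qed.

Let mX : measurable_fun setT (fun x : V => (G x `^ p * w x)%:E).
Proof. by apply/measurable_EFinP; exact: measurable_funM. Qed.

Let X0 : (0 <= X)%E. Proof. by apply: integral_ge0 => x _; rewrite lee_fin. Qed.

Let P0 k i : (0 <= P k i)%E.
Proof. by apply: integral_ge0 => x _; rewrite lee_fin mulr_ge0. Qed.

Let I0 k i : (0 <= I k i)%E.
Proof. by apply: integral_ge0 => x _; rewrite lee_fin mulr_ge0. Qed.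

Let PX k i : (P k i <= X)%E.
Proof.
apply: ge0_le_integral; first exact: measurableT.
- by move=> x _; rewrite lee_fin mulr_ge0.
- exact: mGP.
- exact: mX.
- move=> x _; rewrite lee_fin indicE; case: (x \in _); rewrite ?mulr1 ?mulr0//.
Qed.

Let wI k i : ((wmass w (Q k i))%:E * I k i `^ p <= (A * (((2 * i + 1)%:R * rho^-1) ^+ n) `^ p)%:E * P k i)%E.
Proof. exact: (weighted_average p1 mw w0 hA _ (layer_side_gt0 rho0 i) mG G0). Qed.

Let wQ0 k i : 0 < wmass w (Q k i).
Proof. exact: (wmass_gt0 p1 mw w0 hA _ (layer_side_gt0 rho0 i)). Qed.

(** An infinite average would contradict [wI], since the mass of the cube is positive and [P k i] is
    at most the finite [X]. *)
Let Ifin k i : I k i \is a fin_num.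
Proof.
rewrite ge0_fin_numE// ltNge leye_eq; apply/eqP => Iy.
have := wI k i; rewrite Iy poweRyr ?gt_eqF// gt0_muley ?lte_fin// leye_eq => /eqP H.
have : ((A * (((2 * i + 1)%:R * rho^-1) ^+ n) `^ p)%:E * P k i < +oo)%E.
  by rewrite lte_mul_pinfty ?lee_fin ?mulr_ge0 ?powR_ge0// (le_lt_trans (PX k i)).
by rewrite H ltxx.
Qed.

Let Ir k i : R := fine (I k i).
Let IE k i : I k i = (Ir k i)%:E. Proof. by rewrite fineK. Qed.
Let Ir0 k i : 0 <= Ir k i. Proof. exact: fine_ge0. Qed.

Let a i := K `^ (p - 1) * (dl i * v i `^ (1 - p)).
Let a0 i : 0 <= a i. Proof. by rewrite !mulr_ge0 ?powR_ge0. Qed.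

Let b k := (\int[mu]_x (G x * hk k x)%:E)%E.

Let b_le k : (b k <= \sum_(0 <= i <oo) (dl i * Ir k i)%:E)%E.
Proof.
have -> : (\sum_(0 <= i <oo) (dl i * Ir k i)%:E =
    \sum_(0 <= i <oo) \int[mu]_x (dl i * (G x * \1_(Q k i) x))%:E)%E.
  apply: eq_eseriesr => i _; rewrite EFinM -IE; under eq_integral do rewrite EFinM.
  by rewrite ge0_integralZl_EFin// => x _; rewrite lee_fin mulr_ge0.
have dG0 i x : (0 <= (dl i * (G x * \1_(Q k i) x))%:E)%E by rewrite lee_fin !mulr_ge0.
rewrite -(integral_nneseries _ _ (mdG k) (fun i x _ => dG0 i x))//.
apply: ge0_le_integral; first exact: measurableT.
- by move=> x _; rewrite lee_fin mulr_ge0 ?cabs_ge0.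
- by apply/measurable_EFinP; apply: measurable_funM => //; exact: measurable_hk.
- apply: ge0_emeasurable_sum => [i x _ _|i _]; first by rewrite lee_fin !mulr_ge0.
  exact: mdG.
- move=> x _; rewrite EFinM.
  apply: (le_trans (lee_wpmul2l _ (hk_layers k x))); first by rewrite lee_fin.
  rewrite -nneseriesZl; last by move=> i _; rewrite lee_fin mulr_ge0.
  by apply: lee_nneseries => [i _ _|i _]; rewrite -EFinM lee_fin ?mulr_ge0// mulrCA.
Qed.

(** Jensen over the layers, then the weighted average inequality on each enlarged cube; the sum over
    [k] of the local integrals costs only the overlap. *)
Lemma analysis_bound :
  (\sum_(k <- s) (wmass w (Q k 0))%:E * (\int[mu]_x (G x * hk k x)%:E) `^ p <=
   (K `^ p * A * (rho^-1 ^+ n) `^ p)%:E * \int[mu]_x (G x `^ p * w x)%:E)%E.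
Proof.
rewrite -/X; set D := (rho^-1 ^+ n) `^ p.
have D0 : 0 <= D by exact: powR_ge0.
have b0 k : (0 <= b k)%E by apply: integral_ge0 => x _; rewrite lee_fin mulr_ge0 ?cabs_ge0.
have step1 k : ((wmass w (Q k 0))%:E * b k `^ p <=
    \sum_(0 <= i <oo) (a i * (A * N i `^ (n%:R * p) * D))%:E * P k i)%E.
  have := jensen_series p1 dl0 (Ir0 k) v0 (b0 k) (b_le k) hK.
  move=> /(lee_wpmul2l (x := (wmass w (Q k 0))%:E)); rewrite lee_fin => /(_ (ltW (wQ0 k 0))).
  move=> /le_trans; apply; rewrite -nneseriesZl; last by move=> i _; rewrite lee_fin !mulr_ge0 ?powR_ge0.
  apply: lee_nneseries => [i _ _|i _].
    by rewrite mule_ge0 ?lee_fin ?(ltW (wQ0 k 0))// !mulr_ge0 ?powR_ge0.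
  have := wI k i; rewrite IE poweR_EFin -EFinM => H.
  have -> : (((wmass w (Q k 0))%:E * (K `^ (p - 1) * (dl i * v i `^ (1 - p) * Ir k i `^ p))%:E) =
     (a i)%:E * (wmass w (Q k 0) * Ir k i `^ p)%:E)%E.
    by rewrite -!EFinM; congr EFin; rewrite /a; ring.
  rewrite [(a i * (A * _ * D))%:E]EFinM -muleA; apply: lee_wpmul2l; first by rewrite lee_fin.
  (* The mass of the innermost cube is enlarged by inclusion, without doubling; the cost (2i+1)^(np)
     arises from the volume of the layer in [wI]. *)
  apply: (@le_trans _ _ (wmass w (Q k i) * Ir k i `^ p)%:E).
    rewrite lee_fin ler_wpM2r ?powR_ge0//.
    have [WE _ _ _ _] := cube_masses p1 mw w0 hA (rho^-1 *: (map_mx intr k - const_mx 0%:R)) (layer_side_gt0 rho0 0).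
    have [WE' _ _ _ _] := cube_masses p1 mw w0 hA (rho^-1 *: (map_mx intr k - const_mx i%:R)) (layer_side_gt0 rho0 i).
    rewrite -lee_fin -WE -WE'; apply: ge0_le_integral; first exact: measurableT.
    - by move=> x _; rewrite lee_fin mulr_ge0// ltW.
    - by apply/measurable_EFinP; apply: measurable_funM => //; exact: (mQi k 0).
    - by apply/measurable_EFinP; apply: measurable_funM => //; exact: (mQi k i).
    - move=> x _; rewrite lee_fin ler_wpM2l ?(ltW (w0 x))// !indicE.
      case: (boolP (x \in cube _ ((2 * 0 + 1)%:R * rho^-1))) => // /set_mem xQ.
      by rewrite (mem_set (@layer_at_sub _ _ _ rho0 k i x xQ)).
  apply: (le_trans H); apply: lee_wpmul2r; first exact: P0.
  rewrite lee_fin; apply: le_of_eq.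
  rewrite exprMn powRM ?exprn_ge0 ?invr_ge0 ?(ltW rho0) ?(ltW (N0 i))//.
  by rewrite -(powR_mulrn _ (ltW (N0 i))) -powRrM mulrA.
apply: (@le_trans _ _ (\sum_(k <- s) \sum_(0 <= i <oo) (a i * (A * N i `^ (n%:R * p) * D))%:E * P k i)%E).
  by apply: lee_sum => k _; exact: step1.
have c0 i : 0 <= a i * (A * N i `^ (n%:R * p) * D) by rewrite !mulr_ge0 ?powR_ge0.
rewrite -nneseries_sum; last by move=> k i _; rewrite mule_ge0 ?lee_fin.
apply: (@le_trans _ _ (\sum_(0 <= i <oo) ((K `^ (p - 1) * A * D)%:E * (dl i * v i)%:E) * X)%E).
  apply: lee_nneseries => [i _ _|i _]; first by rewrite sume_ge0// => k _; rewrite mule_ge0 ?lee_fin.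
  rewrite -ge0_sume_distrr; last by move=> k _; exact: P0.
  have SP : (\sum_(k <- s) P k i <= (N i ^+ n)%:E * X)%E.
    rewrite /P -ge0_integral_sum//; last by move=> k x _; rewrite lee_fin mulr_ge0.
    rewrite -ge0_integralZl_EFin ?exprn_ge0 ?(ltW (N0 i))//; last by move=> x _; rewrite lee_fin.
    apply: ge0_le_integral; first exact: measurableT.
    - by move=> x _; rewrite sume_ge0// => k _; rewrite lee_fin mulr_ge0.
    - by apply: emeasurable_sum => k; exact: mGP.
    - exact: measurable_funeM.
    - move=> x _; rewrite sumEFin -EFinM lee_fin -mulr_sumr mulrC ler_wpM2r//.
      exact: sum_layer_at.
  apply: (le_trans (lee_wpmul2l _ SP)); first by rewrite lee_fin.
  rewrite muleA -!EFinM; apply: lee_wpmul2r => //.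
  rewrite lee_fin; apply: le_of_eq.
  (* Here the exponents g(1-p), np and n add up to g. *)
  have E : v i `^ (1 - p) * N i `^ (n%:R * p) * N i ^+ n = v i.
    rewrite -powR_mulrn ?(ltW (N0 i))// /v -powRrM -!powRD ?(gt_eqF (N0 i)) ?implybT//; congr (_ `^ _).
    by rewrite mulrBr mulr1 gE; ring.
  by rewrite -[in RHS]E /a; ring.
have XE : X = (fine X)%:E by rewrite fineK// ge0_fin_numE.
under eq_eseriesr do rewrite XE muleC.
rewrite nneseriesZl; last by move=> i _; rewrite -EFinM lee_fin !mulr_ge0 ?powR_ge0 ?(ltW (v0 i)).
rewrite -XE muleC; apply: lee_wpmul2r => //.
rewrite nneseriesZl; last by move=> i _; rewrite lee_fin mulr_ge0 ?(ltW (v0 i)).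
apply: (le_trans (lee_wpmul2l _ hK)); first by rewrite lee_fin !mulr_ge0 ?powR_ge0.
by rewrite -EFinM lee_fin (powR_pred p0 K0); apply: le_of_eq; ring.
Qed.

End analysis.

End frame_bounds.

Section decay_layers.
Context {R : realType} {n : nat}.
Local Notation V := 'rV[R]_n.
Hypothesis n_gt0 : (1 <= n)%N.

Definition layer_weight (h : V -> R[i]) (i : nat) : R := envr h i - envr h i.+1.

Definition layer_const (g : R) (h : V -> R[i]) : R := fine (envelope_series g (envelope h)).

Lemma decay_layers (h : V -> R[i]) (D si g : R) : 0 <= D -> 1 <= g -> g < si ->
  (forall z, cabs (h z) <= D * (1 + `|z|) `^ (- si)) ->
  [/\ forall i, 0 <= layer_weight h i,
      forall z, ((cabs (h z))%:E <= \sum_(0 <= i <oo) (layer_weight h i * \1_(layer i) z)%:E)%E,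
      0 <= layer_const g h,
      envelope_series g (envelope h) = (layer_const g h)%:E &
      (\sum_(0 <= i <oo) (layer_weight h i * (2 * i + 1)%:R `^ g)%:E <= (layer_const g h)%:E)%E].
Proof.
move=> D0 g1 gsi hD; have si0 : 0 < si by rewrite (lt_trans _ gsi)// (lt_le_trans ltr01).
have lw0 i : 0 <= layer_weight h i by rewrite subr_ge0; exact: (envr_anti n_gt0 D0 si0 hD).
have lt := envelope_series_lty g1 gsi D0 (envr_ge0 n_gt0 D0 si0 hD)
  (envr_anti n_gt0 D0 si0 hD) (envr0 n_gt0 D0 si0 hD) (envrS n_gt0 D0 si0 hD).
have E : (envelope_series g (envelope h) =
    \sum_(0 <= i <oo) (layer_weight h i * (2 * i + 1)%:R `^ g)%:E)%E.
  by rewrite (envelopeE n_gt0 D0 si0 hD).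
have ge0 : (0 <= envelope_series g (envelope h))%E.
  by rewrite E; apply: nneseries_ge0 => i _ _; rewrite lee_fin mulr_ge0 ?powR_ge0.
have fE : envelope_series g (envelope h) = (layer_const g h)%:E.
  by rewrite /layer_const fineK// ge0_fin_numE// (envelopeE n_gt0 D0 si0 hD).
split => //; [exact: (envelope_pointwise n_gt0 D0 si0 hD)|exact: fine_ge0|].
by rewrite -fE E.
Qed.

End decay_layers.

(** * The weighted norm and the estimate of one level *)

Section weighted_norm.
Context {R : realType} {n : nat}.
Local Notation V := 'rV[R]_n.
Local Notation mu := (@lebesgue_rV R n).
Local Notation C := R[i].
Variables (p : R) (w : V -> R).
Hypotheses (p1 : 1 < p) (mw : measurable_fun setT w) (w0 : forall x, 0 < w x).
Implicit Types f g : V -> C.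

Let p0 : 0 < p. Proof. by rewrite (lt_trans _ p1). Qed.

Lemma wLp_norm_ge0 f : (0 <= wLp_norm p w f)%E. Proof. exact: poweR_ge0. Qed.

Lemma wLp_integral_ge0 f : (0 <= \int[mu]_x (cabs (f x) `^ p * w x)%:E)%E.
Proof. by apply: integral_ge0 => x _; rewrite lee_fin mulr_ge0 ?powR_ge0 ?(ltW (w0 x)). Qed.

Lemma measurable_wLp (u : V -> R) : measurable_fun setT u ->
  measurable_fun setT (fun x : V => (u x `^ p * w x)%:E).
Proof.
move=> mu'; apply/measurable_EFinP; apply: measurable_funM => //.
exact: (measurableT_comp (measurable_powR p)).
Qed.

Lemma wLp_norm_poweR f : (wLp_norm p w f `^ p = \int[mu]_x (cabs (f x) `^ p * w x)%:E)%E.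
Proof. exact: (poweRK p0 (wLp_integral_ge0 f)). Qed.

(** The weight is absorbed into the function as w^(1/p), so that Minkowski's inequality for Lebesgue
    measure applies. *)
Lemma wLp_normE f :
  wLp_norm p w f = ('N[mu]_p%:E[EFin \o (fun x => cabs (f x) * w x `^ p^-1)%R])%E.
Proof.
have N0 := Lnorm_ge0 mu p%:E (EFin \o (fun x => cabs (f x) * w x `^ p^-1)).
rewrite -[RHS](poweRVK p0 N0) poweR_Lnorm ?gt_eqF//; congr (_ `^ _)%E.
apply: eq_integral => x _ /=; rewrite ger0_norm ?mulr_ge0 ?cabs_ge0 ?powR_ge0//.
by rewrite powRM ?cabs_ge0 ?powR_ge0// -powRrM mulVf ?gt_eqF// powRr1// ltW.
Qed.

Lemma wLp_norm_le f (u : V -> R) : cmeasurable f -> measurable_fun setT u ->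
  (forall x, cabs (f x) <= u x) ->
  (wLp_norm p w f <= (\int[mu]_x (u x `^ p * w x)%:E) `^ p^-1)%E.
Proof.
move=> mf mu' fu; apply: poweR_le; [by rewrite invr_ge0 ltW|exact: wLp_integral_ge0|].
apply: le_integral_EFin.
- by apply/measurable_EFinP; apply: measurable_wLp; exact: measurable_cabs.
- by apply/measurable_EFinP; exact: measurable_wLp.
- by move=> x; rewrite mulr_ge0 ?powR_ge0 ?(ltW (w0 x)).
- move=> x; rewrite ler_wpM2r ?(ltW (w0 x))//.
  by apply: ge0_ler_powR; rewrite ?nnegrE ?cabs_ge0 ?(ltW p0)// (le_trans (cabs_ge0 _) (fu x)).
Qed.

Lemma wLp_normD f g : cmeasurable f -> cmeasurable g ->
  (wLp_norm p w (fun x => f x + g x)%R <= wLp_norm p w f + wLp_norm p w g)%E.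
Proof.
move=> mf mg; have mcf := measurable_cabs mf; have mcg := measurable_cabs mg.
have mwp : measurable_fun setT (fun x => w x `^ p^-1) by exact: (measurableT_comp (measurable_powR _)).
have m1 : measurable_fun setT (fun x => cabs (f x) * w x `^ p^-1) by exact: measurable_funM.
have m2 : measurable_fun setT (fun x => cabs (g x) * w x `^ p^-1) by exact: measurable_funM.
rewrite [in leRHS]wLp_normE [X in (_ + X)%E]wLp_normE.
apply: le_trans (minkowski_EFin mu m1 m2 (ltW p1)).
set N := ('N[mu]_p%:E[_])%E.
have N0 : (0 <= N)%E by exact: Lnorm_ge0.
rewrite -(poweRVK p0 N0) /N poweR_Lnorm ?gt_eqF//.
apply: (le_trans (wLp_norm_le (u := fun x => cabs (f x) + cabs (g x)) _ _ _)).
- exact: cmfunD.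
- exact: measurable_funD.
- by move=> x; exact: cabsD.
apply: le_of_eq; congr (_ `^ _)%E; apply: eq_integral => x _ /=.
rewrite -mulrDl ger0_norm ?mulr_ge0 ?addr_ge0 ?cabs_ge0 ?powR_ge0//.
by rewrite powRM ?addr_ge0 ?cabs_ge0 ?powR_ge0// -powRrM mulVf ?gt_eqF// powRr1// ltW.
Qed.

Lemma wLp_norm0 : (wLp_norm p w (fun=> 0%R) = 0)%E.
Proof.
rewrite /wLp_norm; under eq_integral do rewrite cabs0 powR0 ?gt_eqF// mul0r.
by rewrite integral0 poweR0r// invr_neq0// gt_eqF.
Qed.

Lemma wLp_norm_sum I (r : seq I) (F : I -> V -> C) : (forall i, cmeasurable (F i)) ->
  (wLp_norm p w (fun x => \sum_(i <- r) F i x)%R <= \sum_(i <- r) wLp_norm p w (F i))%E.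
Proof.
move=> mF; elim: r => [|i r IH].
  by rewrite big_nil; under eq_fun do rewrite big_nil; rewrite wLp_norm0.
rewrite big_cons; under eq_fun do rewrite big_cons.
apply: (le_trans (wLp_normD (mF i) _)); first exact: cmfun_sum.
exact: leeD2l.
Qed.

End weighted_norm.

Section level.
Context {R : realType} {n : nat}.
Local Notation V := 'rV[R]_n.
Local Notation mu := (@lebesgue_rV R n).
Local Notation C := R[i].
Local Open Scope complex_scope.
Hypothesis n_gt0 : (1 <= n)%N.
Variables (p : R) (w : V -> R) (A : R).
Hypotheses (p1 : 1 < p) (mw : measurable_fun setT w) (w0 : forall x, 0 < w x).
Hypothesis hA : forall (c : V) (d : R), 0 < d ->
  (average w (cube c d) * average (fun y => w y `^ (- (p - 1)^-1))%R (cube c d) `^ (p - 1) <= A%:E)%E.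

Let p0 : 0 < p. Proof. by rewrite (lt_trans _ p1). Qed.
Let A1 : 1 <= A. Proof. exact: (Ap_const_ge1 p1 mw w0 hA). Qed.
Let A0 : 0 <= A. Proof. by rewrite (le_trans ler01). Qed.

Lemma gammaU_ge1 : 1 <= gammaU n p.
Proof.
have n1 : 1 <= n%:R :> R by rewrite ler1n.
rewrite /gammaU /conjugate_exponent (le_trans n1)// lerDl divr_ge0// divr_ge0 ?subr_ge0 ?ltW//.
Qed.

Lemma gammaL_ge1 : 1 <= gammaL n p.
Proof.
have n1 : 1 <= n%:R :> R by rewrite ler1n.
by rewrite /gammaL (le_trans n1)// lerDl divr_ge0// ltW.
Qed.

Lemma gammaU_p : gammaU n p * p = n%:R * p + n%:R * (p - 1).
Proof.
rewrite /gammaU /conjugate_exponent; field.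
by rewrite (gt_eqF p0) subr_eq0 (gt_eqF p1).
Qed.

Lemma gammaL_p : gammaL n p * p = n%:R * p + n%:R.
Proof. by rewrite /gammaL; field; rewrite (gt_eqF p0). Qed.

(** Since n/p' <= n, decay of order 2n + tau makes the series K_U converge. *)
Lemma gammaU_lt (tau : R) : 0 < tau -> gammaU n p < 2 * n%:R + tau.
Proof.
move=> t0; rewrite /gammaU /conjugate_exponent.
have : n%:R / (p / (p - 1)) <= n%:R :> R.
  rewrite invf_div -[leRHS]mulr1 ler_wpM2l// ler_pdivrMr// mul1r; lra.
lra.
Qed.

Lemma gammaL_lt (sigma : R) : 2 * n%:R < sigma -> gammaL n p < sigma.
Proof.
rewrite /gammaL; have : n%:R / p <= n%:R :> R by rewrite -[leRHS]mulr1 ler_wpM2l// invf_le1// ltW.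
lra.
Qed.

(* The analysis bound at the single index k = 0, applied to the profile (1 + |x|)^(-sigma). *)
Lemma wLp_weighted_lty (f : V -> C) (si : R) : wLp p w f -> 2 * n%:R < si ->
  (\int[mu]_y (cabs (f y) * (1 + enorm y) `^ (- si))%:E < +oo)%E.
Proof.
move=> [mf foo] nsi.
have Xoo : (\int[mu]_x (cabs (f x) `^ p * w x)%:E < +oo)%E.
  by rewrite -(wLp_norm_poweR p1 w0); exact: poweR_lty.
pose h (x : V) : C := ((1 + enorm x) `^ (- si))%:C.
have mh : cmeasurable h by split => //; exact: measurable_weight.
have si0 : 0 <= si by rewrite ltW// (le_lt_trans _ nsi)// mulr_ge0.
have ch x : cabs (h x) = (1 + enorm x) `^ (- si) by rewrite cabs_real ger0_norm ?powR_ge0.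
have hD z : cabs (h z) <= 1 * (1 + `|z|) `^ (- si) by rewrite ch mul1r le_enorm_norm.
have [d0 hd K0 _ hK] := decay_layers n_gt0 ler01 gammaL_ge1 (gammaL_lt nsi) hD.
have G0 x : 0 <= cabs (f x) by exact: cabs_ge0.
have := analysis_bound p1 mw w0 hA ltr01 mh d0 hd K0 hK gammaL_p (s := [:: 0]) isT
  (measurable_cabs mf) G0 Xoo.
rewrite big_seq1; set I := (\int[mu]_x (cabs (f x) * cabs _)%:E)%E => H.
have IE : I = (\int[mu]_y (cabs (f y) * (1 + enorm y) `^ (- si))%:E)%E.
  apply: eq_integral => x _; rewrite ch; congr (_ * (1 + enorm _) `^ _)%:E.
  by rewrite scale1r; apply/rowP => l; rewrite !mxE subr0.
rewrite -IE ltNge leye_eq; apply/eqP => Iy.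
have W0 := wmass_gt0 p1 mw w0 hA (1^-1 *: (map_mx intr (0 : 'rV[int]_n) - const_mx 0%:R)) (layer_side_gt0 (ltr01 : 0 < (1 : R)) 0).
move: H; rewrite Iy poweRyr ?gt_eqF// gt0_muley ?lte_fin// leye_eq => /eqP H.
have : ((layer_const (gammaL n p) h `^ p * A * (1^-1 ^+ n) `^ p)%:E * \int[mu]_x (cabs (f x) `^ p * w x)%:E < +oo)%E.
  by rewrite lte_mul_pinfty ?lee_fin ?mulr_ge0 ?powR_ge0.
by rewrite H ltxx.
Qed.

Variables (a b c1 c2 : R) (phi : V -> C).
Hypotheses (a0 : 0 < a) (ab : a < b) (c10 : 0 < c1) (c12 : c1 < c2)
  (gphi : lp_generator c1 c2 phi).
Local Notation M := (band_depth a b c1 c2).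

Variables (hu ht : V -> C) (Du Dt tau sigma : R).
Hypotheses (tau0 : 0 < tau) (nsi : 2 * n%:R < sigma) (Du0 : 0 <= Du) (Dt0 : 0 <= Dt)
  (bu : band_limited a b hu) (bt : band_limited a b ht)
  (hDu : forall z, cabs (hu z) <= Du * (1 + `|z|) `^ (- (2 * n%:R + tau)))
  (hDt : forall z, cabs (ht z) <= Dt * (1 + `|z|) `^ (- sigma))
  (tw : (\int[mu]_y (cabs (ht y) * (1 + enorm y) `^ sigma)%:E < +oo)%E).

Local Notation KU := (layer_const (gammaU n p) hu).
Local Notation KL := (layer_const (gammaL n p) ht).

Definition band_part (f : V -> C) (j : int) (x : V) : C :=
  \sum_(0 <= i < (2 * M).+1) lp_block phi (j + (i%:Z - M%:Z)) (dist_of f) x.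

Definition level_part (f : V -> C) (j : int) (s : seq 'rV[int]_n) (x : V) : C :=
  \sum_(k <- s) pairing f (dilate j k ht) * dilate j k hu x.

Variable f : V -> C.
Hypotheses (mf : cmeasurable f)
  (fw : (\int[mu]_y (cabs (f y) * (1 + enorm y) `^ (- sigma))%:E < +oo)%E).

Let si0 : 0 <= sigma. Proof. by rewrite ltW// (le_lt_trans _ nsi)// mulr_ge0. Qed.

Lemma cmeasurable_lp_block (j : int) : cmeasurable (lp_block phi j (dist_of f)).
Proof.
have rphi : rapid phi by case: gphi => /schwartz_rapid.
exact: (cmeasurable_convf mf (rapid_lp_dilate j rphi)).
Qed.

Lemma cmeasurable_band_part j : cmeasurable (band_part f j).
Proof. by apply: cmfun_sum => i; exact: cmeasurable_lp_block. Qed.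

Lemma cmeasurable_level_part j s : cmeasurable (level_part f j s).
Proof.
apply: cmfun_sum => k; apply: cmfunM; first exact: cmfun_cst.
by apply: cmeasurable_dilate; apply: cmeasurable_continuous; case: bu.
Qed.

(** One factor [A] comes from the synthesis and one from the analysis; under the p-th root they
    become [A ^ (2 / p)]. *)
Let const_power (k l x : R) : 0 <= k -> 0 <= l ->
  k `^ p * A * (l `^ p * A * x) = (k * l * A `^ (2 / p)) `^ p * x.
Proof.
move=> k0 l0; rewrite !powRM ?mulr_ge0 ?powR_ge0// -powRrM divfK ?gt_eqF//.
have -> : A `^ 2 = A * A by rewrite -[2]/(2%:R) powR_mulrn// expr2.
by ring.
Qed.

(** The analysis bound for [ht] controls the coefficients of the band part and the synthesis bound
    for [hu] resums them; the powers of [rho] from normalisation and from cube volumes cancel. *)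
Lemma level_bound (j : int) (s : seq 'rV[int]_n) : uniq s ->
  (wLp_norm p w (band_part f j) < +oo)%E ->
  (wLp_norm p w (level_part f j s) <=
    (KU * KL * A `^ (2 / p))%:E * wLp_norm p w (band_part f j))%E.
Proof.
move=> us Goo; set rho : R := 2 ^ j; have rho0 : 0 < rho by rewrite exprz_gt0.
have [du0 hdu KU0 _ hKU] := decay_layers n_gt0 Du0 gammaU_ge1 (gammaU_lt tau0) hDu.
have [dt0 hdt KL0 _ hKL] := decay_layers n_gt0 Dt0 gammaL_ge1 (gammaL_lt nsi) hDt.
have mhu : cmeasurable hu by apply: cmeasurable_continuous; case: bu.
have mht : cmeasurable ht by apply: cmeasurable_continuous; case: bt.
have mg := cmeasurable_band_part j; have mcg := measurable_cabs mg.
set X := (\int[mu]_x (cabs (band_part f j x) `^ p * w x)%:E)%E.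
have X0 : (0 <= X)%E by exact: wLp_integral_ge0.
have Xoo : (X < +oo)%E by rewrite /X -(wLp_norm_poweR p1 w0); exact: poweR_lty.
have Xf : X \is a fin_num by rewrite ge0_fin_numE.
have G0 x : 0 <= cabs (band_part f j x) by exact: cabs_ge0.
pose bk (k : 'rV[int]_n) := (\int[mu]_x (cabs (band_part f j x) * cabs (ht (rho *: x - map_mx intr k)))%:E)%E.
have bk0 k : (0 <= bk k)%E by apply: integral_ge0 => x _; rewrite lee_fin mulr_ge0 ?cabs_ge0.
have ana s' : uniq s' -> (\sum_(k <- s') (wmass w (layer_at rho k 0))%:E * bk k `^ p <=
    (KL `^ p * A * (rho^-1 ^+ n) `^ p)%:E * X)%E.
  by move=> us'; exact: (analysis_bound p1 mw w0 hA rho0 mht dt0 hdt KL0 hKL gammaL_p us' mcg G0 Xoo).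
have bkf k : bk k \is a fin_num.
  rewrite ge0_fin_numE// ltNge leye_eq; apply/eqP => Iy.
  (* The analysis bound on a one-element list shows that a single integral is finite. *)
  have := ana [:: k] isT; rewrite big_seq1 Iy poweRyr ?gt_eqF// gt0_muley; last first.
    rewrite lte_fin; exact: (wmass_gt0 p1 mw w0 hA _ (layer_side_gt0 rho0 0)).
  rewrite leye_eq -(fineK Xf) -EFinM.
  by move=> /eqP.
(* The L^2 normalisation of one wavelet; the coefficient and the synthesised wavelet contribute it
   once each, and u u = rho^n. *)
pose u := 2 `^ (j%:~R * n%:R / 2) : R.
have u0 : 0 <= u by exact: powR_ge0.
have uu : u * u = rho ^+ n.
  have rE : rho ^+ n = `|rho| ^+ n by rewrite ger0_norm// ltW.
  rewrite rE -lp_dilate_scale /u -powRD; last by rewrite pnatr_eq0 implybT.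
  by congr (_ `^ _); field.
pose c k := rho ^+ n * fine (bk k).
have c0 k : 0 <= c k by rewrite mulr_ge0 ?fine_ge0// exprn_ge0// ltW.
(* The coefficient depends on [f] only through its band part, which is where band-limitation
   enters. *)
have pair_le k : cabs (pairing f (dilate j k ht)) <= u * fine (bk k).
  rewrite (pairing_blocks n_gt0 a0 ab c10 c12 gphi _ _ si0 mf fw bt tw).
  rewrite -lee_fin EFinM fineK//.
  have mB : cmeasurable (fun x => band_part f j x * conjc (dilate j k ht x)).
    by apply: cmfunM => //; apply: cmfunJ; exact: cmeasurable_dilate.
  apply: (le_trans (le_cabs_cint mB)).
  apply: le_integral_scale => //.
  - exact: measurable_cabs.
  - by apply: measurable_funM => //; exact: (measurable_hk rho mht).
  - by move=> x; exact: cabs_ge0.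
  - by move=> x; rewrite mulr_ge0 ?cabs_ge0.
  - move=> x; rewrite cabsM cabsJ /dilate cabsM cabs_real ger0_norm//.
    by rewrite -/u -/rho mulrCA.
have lev_le x : cabs (level_part f j s x) <= \sum_(k <- s) c k * cabs (hu (rho *: x - map_mx intr k)).
  rewrite (le_trans (cabs_sum _ _))//; apply: ler_sum => k _.
  rewrite cabsM /dilate cabsM cabs_real ger0_norm// -/u -/rho mulrA ler_wpM2r ?cabs_ge0//.
  by rewrite (le_trans (ler_wpM2r u0 (pair_le k)))// /c -uu mulrAC.
have msum : measurable_fun setT (fun x : V => \sum_(k <- s) c k * cabs (hu (rho *: x - map_mx intr k))).
  by apply: measurable_sum => k; apply: measurable_funM => //; exact: (measurable_hk rho mhu).
apply: (le_trans (wLp_norm_le p1 mw w0 (cmeasurable_level_part j s) msum lev_le)).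
have syn := synthesis_bound p1 mw w0 hA rho0 mhu du0 hdu KU0 hKU gammaU_p us c0.
have D0 : 0 < (rho ^+ n) `^ p by rewrite powR_gt0// exprn_gt0.
have Sc : \sum_(k <- s) c k `^ p * wmass w (layer_at rho k 0) <= KL `^ p * A * fine X.
  have := ana s us; rewrite -(fineK Xf) -EFinM.
  have -> : (\sum_(k <- s) (wmass w (layer_at rho k 0))%:E * bk k `^ p =
     (\sum_(k <- s) wmass w (layer_at rho k 0) * fine (bk k) `^ p)%:E)%E.
    by rewrite -sumEFin; apply: eq_bigr => k _; rewrite -{1}(fineK (bkf k)) poweR_EFin EFinM.
  rewrite lee_fin /= => /(ler_wpM2l (ltW D0)).
  rewrite exprVn -powR_inv1 ?exprn_ge0 ?(ltW rho0)// -powRrM mulN1r powRN mulr_sumr => H.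
  rewrite (le_trans _ (le_trans H _))//.
    apply: ler_sum => k _; rewrite /c powRM ?fine_ge0 ?exprn_ge0 ?(ltW rho0)//.
    by apply: le_of_eq; ring.
  apply: le_of_eq; field.
  by rewrite gt_eqF.
have {}syn : (\int[mu]_x ((\sum_(k <- s) c k * cabs (hu (rho *: x - map_mx intr k))) `^ p * w x)%:E <=
    ((KU * KL * A `^ (2 / p)) `^ p)%:E * X)%E.
  apply: (le_trans syn); rewrite -[in leRHS](fineK Xf) -EFinM lee_fin.
  apply: (@le_trans _ _ (KU `^ p * A * (KL `^ p * A * fine X))).
    by rewrite ler_wpM2l// mulr_ge0 ?powR_ge0.
  apply: le_of_eq.
  exact: const_power.
have I0 : (0 <= \int[mu]_x ((\sum_(k <- s) c k * cabs (hu (rho *: x - map_mx intr k))) `^ p * w x)%:E)%E.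
  by apply: integral_ge0 => x _; rewrite lee_fin mulr_ge0 ?powR_ge0 ?(ltW (w0 x)).
have pi0 : 0 <= p^-1 by rewrite invr_ge0 ltW.
apply: (le_trans (poweR_le pi0 I0 syn)).
have k0 := mulr_ge0 (mulr_ge0 KU0 KL0) (powR_ge0 A (2 / p)).
have k1 : (0 <= ((KU * KL * A `^ (2 / p)) `^ p)%:E)%E by rewrite lee_fin; exact: powR_ge0.
rewrite (poweRM _ k1 X0).
by rewrite poweR_EFin -powRrM mulfV ?gt_eqF// powRr1.
Qed.

End level.

(** * Approximation by the wavelets of the unit cube *)

Section besov_terms.
Context {R : realType} {n : nat}.
Local Notation V := 'rV[R]_n.
Local Notation C := R[i].

Lemma besov_norm_ge0 (phi : V -> C) (s p q : R) (w : V -> R) u :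
  (0 <= besov_norm phi s p q w u)%E.
Proof. exact: poweR_ge0. Qed.

(** One term of the sum over levels is at most the whole sum. Nothing else of the Besov norm is
    used, so the constants do not depend on [q]. *)
Lemma besov_block_le (phi : V -> C) (s p q : R) (w : V -> R) u (j : int) : 0 < q ->
  (wLp_norm p w (lp_block phi j u) <=
    (2 `^ (- (j%:~R * s)))%:E * besov_norm phi s p q w u)%E.
Proof.
move=> q0; set N := wLp_norm _ _ _; have N0 : (0 <= N)%E by exact: poweR_ge0.
set u2 : R := 2 `^ (j%:~R * s); have u20 : 0 < u2 by rewrite powR_gt0.
have H : ((u2%:E * N) `^ q <= \esum_(i in [set: int])
      ((2 `^ (i%:~R * s * q))%:E * wLp_norm p w (lp_block phi i u) `^ q))%E.
  apply: esum_ge; exists [set j] => //; rewrite fsbig_set1.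
  by rewrite poweRM ?lee_fin ?powR_ge0// poweR_EFin -powRrM.
have qi0 : 0 <= q^-1 by rewrite invr_ge0 ltW.
have {H} := poweR_le qi0 (poweR_ge0 _ _) H.
rewrite (poweRVK q0); last by rewrite mule_ge0// lee_fin powR_ge0.
rewrite -/(besov_norm phi s p q w u) => H.
have E : N = ((u2^-1)%:E * (u2%:E * N))%E by rewrite muleA -EFinM mulVf ?gt_eqF// mul1e.
rewrite {1}E powRN; apply: lee_wpmul2l => //.
by rewrite lee_fin invr_ge0 powR_ge0.
Qed.

(** A block [i] levels below costs 2^(is); reversing the symmetric window turns the sum into
    [C_band]. *)
Lemma band_shift_sum (s t : R) (M : nat) :
  \sum_(0 <= i < (2 * M).+1) 2 `^ (- ((t + (i%:R - M%:R)) * s)) = 2 `^ (- (t * s)) * C_band s M.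
Proof.
rewrite big_nat_rev /C_band mulr_sumr; apply: eq_big_nat => i /andP[_ iM] /=.
rewrite -powRD ?pnatr_eq0 ?implybT//; congr (_ `^ _).
rewrite add0n subSS natrB// natrM; ring.
Qed.

Lemma geometric_tail (x : R) (m l : nat) : 0 <= x -> x < 1 ->
  \sum_(m <= j < l) x ^+ j <= x ^+ m / (1 - x).
Proof.
move=> x0 x1; have d0 : 0 < 1 - x by rewrite subr_gt0.
case: (leqP l m) => [lm|ml]; first by rewrite big_geq// divr_ge0 ?exprn_ge0// ltW.
rewrite ler_pdivlMr//; suff -> : (\sum_(m <= j < l) x ^+ j) * (1 - x) = x ^+ m - x ^+ l.
  by rewrite gerBl exprn_ge0.
elim: l ml => // l IH; rewrite ltnS leq_eqVlt => /orP[/eqP <-|ml].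
  by rewrite big_nat1 exprS; ring.
by rewrite big_nat_recr ?(ltnW ml)//= mulrDl IH// exprS; ring.
Qed.

End besov_terms.

Section index_sets.
Context {R : realType} {n : nat}.
Local Notation V := 'rV[R]_n.

Definition inner_cubes (j : nat) : set 'rV[int]_n :=
  [set k | @dyadic R n j%:Z k `<=` unit_cube].

Lemma inner_cubes_coord j k : inner_cubes j k ->
  forall l, (0 <= k ord0 l) && (k ord0 l < (2 ^ j)%:Z).
Proof.
move=> kj l; have dk : @dyadic R n j%:Z k ((2 ^ (- j%:Z)) *: (map_mx intr k + 0)).
  by exists 0 => //= i; rewrite mxE lexx ltr01.
have := kj _ dk l; rewrite !mxE addr0 => /andP[k0 k1].
have e0 : 0 < (2 : R) ^ (- j%:Z) by rewrite exprz_gt0.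
move: k0; rewrite pmulr_rge0// ler0z => ->/=.
move: k1; rewrite -invr_expz mulrC ltr_pdivrMr ?exprz_gt0// mul1r.
by rewrite -exprnP -natrX -(ltr_int R) pmulrn.
Qed.

(** The bound is spelled as a successor because [inord] takes values in such a type. *)
Let cube_code (j : nat) (k : 'rV[int]_n) : {ffun 'I_n -> 'I_(2 ^ j).-1.+1} :=
  [ffun l => inord (absz (k ord0 l))].

Let cube_code_inj j k k' : inner_cubes j k -> inner_cubes j k' ->
  cube_code j k = cube_code j k' -> k = k'.
Proof.
move=> /inner_cubes_coord kP /inner_cubes_coord kP' /ffunP E; apply/rowP => l.
have := congr1 val (E l); rewrite !ffunE.
move: (kP l) (kP' l); set a := k ord0 l; set b := k' ord0 l => ka kb.
have e0 : (0 < 2 ^ j)%N by rewrite expn_gt0.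
rewrite /= !inordK ?prednK//; lia.
Qed.

Lemma finite_inner_cubes j : finite_set (inner_cubes j).
Proof.
pose g (c : {ffun 'I_n -> 'I_(2 ^ j).-1.+1}) : 'rV[int]_n := \row_l (c l : nat)%:Z.
apply: (@sub_finite_set _ _ (g @` setT)); last exact/finite_image/finite_finset.
move=> k kP; exists (cube_code j k) => //; apply/rowP => l; rewrite mxE ffunE.
have := inner_cubes_coord kP l; set a := k ord0 l => ka.
have e0 : (0 < 2 ^ j)%N by rewrite expn_gt0.
rewrite inordK ?prednK//; lia.
Qed.

Definition inner_seq j : seq 'rV[int]_n := fset_set (inner_cubes j).

Lemma inner_seqP j k : (k \in inner_seq j) -> inner_cubes j k.
Proof. by rewrite in_fset_set ?inE//; exact: finite_inner_cubes. Qed.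

Lemma uniq_inner_seq j : uniq (inner_seq j).
Proof. exact: fset_uniq. Qed.

Lemma size_inner_seq j : (size (inner_seq j) <= (2 ^ j) ^ n)%N.
Proof.
rewrite -(size_map (cube_code j)) -(card_uniqP _).
  by rewrite (leq_trans (max_card _))// card_ffun !card_ord prednK// expn_gt0.
rewrite map_inj_in_uniq ?uniq_inner_seq// => k k' /inner_seqP kP /inner_seqP kP'.
exact: cube_code_inj.
Qed.

End index_sets.

Section partial_sums.
Context {R : realType} {n L : nat}.
Local Notation V := 'rV[R]_n.
Local Notation C := R[i].
Variables (psi tpsi : 'I_L -> V -> C) (f : V -> C).

Definition partial_sum (m1 m2 : nat) (x : V) : C :=
  \sum_(e < L) \sum_(m1 <= j < m2) level_part (psi e) (tpsi e) f j%:Z (@inner_seq R n j) x.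

Lemma truncationE J x : truncation psi tpsi f J x = partial_sum 0 J.+1 x.
Proof.
apply: eq_bigr => e _; apply: eq_bigr => j _.
by rewrite fsbig_finite//; exact: (@finite_inner_cubes R n j).
Qed.

Lemma partial_sum_cat m1 m2 x : (m1 <= m2)%N ->
  partial_sum 0 m2 x = partial_sum 0 m1 x + partial_sum m1 m2 x.
Proof.
by move=> m12; rewrite /partial_sum -big_split; apply: eq_bigr => e _; rewrite -big_cat_nat.
Qed.

Let jks (m : nat) : seq (int * 'rV[int]_n) :=
  [seq (j%:Z, k) | j <- iota 0 m, k <- @inner_seq R n j].

Let index_seq m : seq (@windex n L) := [seq (e, jk) | e <- enum 'I_L, jk <- jks m].

Let uniq_index_seq m : uniq (index_seq m).
Proof.
apply: allpairs_uniq; first exact: enum_uniq.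
  apply: allpairs_uniq_dep => [|j _|]; first exact: iota_uniq.
    exact: uniq_inner_seq.
  by move=> [j k] [j' k'] _ _ /= [] -> ->.
by move=> [e jk] [e' jk'] _ _ /= [] -> ->.
Qed.

Let size_index_seq m : (size (index_seq m) <= L * \sum_(0 <= j < m) (2 ^ j) ^ n)%N.
Proof.
rewrite size_allpairs -cardE card_ord leq_mul2l; apply/orP; right.
rewrite size_allpairs_dep sumnE big_map /index_iota subn0.
by apply: leq_sum => j _; exact: size_inner_seq.
Qed.

(** The triple sum is re-indexed by a duplicate-free list, whose length is the number of terms
    charged to the approximation. *)
Lemma partial_sum_wcomb m : exists (La : {fset @windex n L}) (c : @windex n L -> C),
  (#|` La| <= L * \sum_(0 <= j < m) (2 ^ j) ^ n)%N /\
  forall x, wcomb psi La c x = partial_sum 0 m x.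
Proof.
exists (seq_fset tt (index_seq m)), (fun i => pairing f (wavelet tpsi i)); split.
  by rewrite (perm_size (seq_fset_perm _ _)) undup_id// size_index_seq.
move=> x; rewrite /wcomb (perm_big _ (seq_fset_perm _ _))/= undup_id//.
rewrite big_allpairs big_enum /=; apply: eq_bigr => e _.
by rewrite big_allpairs_dep /index_iota subn0.
Qed.

End partial_sums.

Section level_choice.

(** The ratio 2^n is at least 2, so the geometric sum is at most twice its last term: the source of
    the 2 in (2L)^(s/n). *)
Lemma dyadic_count (n m : nat) : (1 <= n)%N ->
  (\sum_(0 <= j < m.+1) (2 ^ j) ^ n <= 2 * (2 ^ m) ^ n)%N.
Proof.
move=> n0; elim: m => [|m IH]; first by rewrite big_nat1 expn0 exp1n.
rewrite big_nat_recr//= mul2n -addnn leq_add2r (leq_trans IH)//.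
have n2 : (2 ^ 1 <= 2 ^ n)%N by rewrite leq_exp2l.
by rewrite expnS expnMn leq_mul2r -[X in (X <= _)%N]/(2 ^ 1)%N n2 orbT.
Qed.

(** For the least [m] satisfying the first bound: were the count above N, then by [dyadic_count] the
    level [m - 1] would satisfy it already. For [m = 0] nothing is counted. *)
Lemma level_threshold (n L N : nat) : (1 <= n)%N -> (1 <= L)%N -> exists m : nat,
  (N < 2 * L * (2 ^ m) ^ n)%N /\
  (L * \sum_(0 <= j < m) (2 ^ j) ^ n <= N)%N.
Proof.
move=> n0 L0; have ex : exists m, (N < 2 * L * (2 ^ m) ^ n)%N.
  exists N; rewrite (leq_trans (ltn_expl N (isT : (1 < 2)%N)))//.
  rewrite (@leq_trans ((2 ^ N) ^ n))//; first by rewrite -{1}(expn1 (2 ^ N)) leq_pexp2l// expn_gt0.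
  by rewrite leq_pmull// muln_gt0.
exists (ex_minn ex); case: ex_minnP => m mP mmin; split => //.
case: m mP mmin => [|m] mP mmin; first by rewrite big_geq// muln0.
rewrite leqNgt; apply/negP => H; have := mmin m.
suff K : (N < 2 * L * (2 ^ m) ^ n)%N by move/(_ K); rewrite ltnn.
rewrite (leq_trans H)// mulnC -mulnA [(L * _)%N]mulnC mulnA leq_mul2r.
by rewrite dyadic_count// orbT.
Qed.

End level_choice.

(** * The error estimate for a weight that is positive everywhere *)

Section positive_weight_bound.
Context {R : realType} {n L : nat}.
Local Notation V := 'rV[R]_n.
Local Notation mu := (@lebesgue_rV R n).
Local Notation C := R[i].
Hypotheses (n_gt0 : (1 <= n)%N) (L_gt0 : (1 <= L)%N).
Variables (p : R) (w : V -> R) (A : R).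
Hypotheses (p1 : 1 < p) (mw : measurable_fun setT w) (w0 : forall x, 0 < w x).
Hypothesis hA : forall (c : V) (d : R), 0 < d ->
  (average w (cube c d) * average (fun y => w y `^ (- (p - 1)^-1))%R (cube c d) `^ (p - 1) <= A%:E)%E.
Variables (a b c1 c2 : R) (phi : V -> C).
Hypotheses (a0 : 0 < a) (ab : a < b) (c10 : 0 < c1) (c12 : c1 < c2)
  (gphi : lp_generator c1 c2 phi).
Local Notation M := (band_depth a b c1 c2).
Variables (psi tpsi : 'I_L -> V -> C) (Du Dt : 'I_L -> R) (tau sigma s q : R).
Hypotheses (tau0 : 0 < tau) (nsi : 2 * n%:R < sigma) (s0 : 0 < s) (q0 : 0 < q)
  (Du0 : forall e, 0 <= Du e) (Dt0 : forall e, 0 <= Dt e)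
  (bu : forall e, band_limited a b (psi e)) (bt : forall e, band_limited a b (tpsi e))
  (hDu : forall e z, cabs (psi e z) <= Du e * (1 + `|z|) `^ (- (2 * n%:R + tau)))
  (hDt : forall e z, cabs (tpsi e z) <= Dt e * (1 + `|z|) `^ (- sigma))
  (tw : forall e, (\int[mu]_y (cabs (tpsi e y) * (1 + enorm y) `^ sigma)%:E < +oo)%E).
Variables (KU KL : R).
Hypotheses (KUE : forall e, layer_const (gammaU n p) (psi e) <= KU)
  (KLE : forall e, layer_const (gammaL n p) (tpsi e) <= KL).
Variable f : V -> C.
Hypothesis fB : besov_localized psi tpsi phi s p q w f.

Let B := besov_norm phi s p q w (dist_of f).
Let B0 : (0 <= B)%E. Proof. exact: besov_norm_ge0. Qed.
Let Boo : (B < +oo)%E. Proof. by case: fB => _ []. Qed.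
Let mf : cmeasurable f. Proof. by case: fB => -[]. Qed.
Let fw : (\int[mu]_y (cabs (f y) * (1 + enorm y) `^ (- sigma))%:E < +oo)%E.
Proof. by case: fB => fL _ _; exact: (wLp_weighted_lty n_gt0 p1 mw w0 hA fL nsi). Qed.

Let x2 : R := 2 `^ (- s).
Let x20 : 0 < x2. Proof. by rewrite powR_gt0. Qed.
Let x21 : x2 < 1.
Proof.
rewrite /x2 powRN invf_lt1 ?powR_gt0//.
have := gt0_ltr_powR s0; move=> /(_ 1 2); rewrite !nnegrE powR1; apply => //.
by rewrite ltr1n.
Qed.

Let CB0 : 0 <= C_band s M.
Proof. by apply: sumr_ge0 => i _; exact: powR_ge0. Qed.

Let band_norm (j : nat) :
  (wLp_norm p w (band_part a b c1 c2 phi f j%:Z) <= (x2 ^+ j * C_band s M)%:E * B)%E.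
Proof.
have mb i : cmeasurable (lp_block phi (j%:Z + (i%:Z - M%:Z)) (dist_of f)).
  exact: (cmeasurable_lp_block gphi mf).
apply: (le_trans (wLp_norm_sum p1 mw w0 _ mb)).
apply: (@le_trans _ _ (\sum_(0 <= i < (2 * M).+1) (2 `^ (- ((j%:R + (i%:R - M%:R)) * s)))%:E * B)%E).
  apply: lee_sum => i _; have := besov_block_le phi s p w (dist_of f) (j%:Z + (i%:Z - M%:Z)) q0.
  by rewrite !(rmorphD, rmorphN)/= -!pmulrn.
rewrite -ge0_sume_distrl; last by move=> i _; rewrite lee_fin powR_ge0.
rewrite sumEFin band_shift_sum lee_wpmul2r// lee_fin.
by rewrite /x2 -powR_mulrn ?powR_ge0// -powRrM mulNr [s * _]mulrC.
Qed.

Let K0 (e : 'I_L) : 0 <= layer_const (gammaU n p) (psi e) /\ 0 <= layer_const (gammaL n p) (tpsi e).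
Proof.
have [_ _ ? _ _] := decay_layers n_gt0 (Du0 e) (gammaU_ge1 n_gt0 p1) (gammaU_lt p1 tau0) (hDu e).
by have [_ _ ? _ _] := decay_layers n_gt0 (Dt0 e) (gammaL_ge1 n_gt0 p1) (gammaL_lt p1 nsi) (hDt e).
Qed.

Let KA := KU * KL * A `^ (2 / p).

Let KA0 : 0 <= KA.
Proof.
have [u0 l0] := K0 (Ordinal L_gt0).
by rewrite /KA !mulr_ge0 ?powR_ge0 ?(le_trans u0 (KUE _)) ?(le_trans l0 (KLE _)).
Qed.

Let level_norm (e : 'I_L) (j : nat) :
  (wLp_norm p w (level_part (psi e) (tpsi e) f j%:Z (@inner_seq R n j)) <=
    (KA * (x2 ^+ j * C_band s M))%:E * B)%E.
Proof.
have Goo : (wLp_norm p w (band_part a b c1 c2 phi f j%:Z) < +oo)%E.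
  apply: (le_lt_trans (band_norm j)); rewrite lte_mul_pinfty ?lee_fin ?mulr_ge0 ?exprn_ge0//.
  exact: ltW.
have := level_bound n_gt0 p1 mw w0 hA a0 ab c10 c12 gphi tau0 nsi (Du0 e) (Dt0 e) (bu e) (bt e)
  (hDu e) (hDt e) (tw e) mf fw (@uniq_inner_seq R n j) Goo.
move=> /le_trans; apply; have [u0 l0] := K0 e.
apply: (@le_trans _ _ (KA%:E * wLp_norm p w (band_part a b c1 c2 phi f j%:Z))%E).
  apply: lee_wpmul2r; first exact: wLp_norm_ge0.
  by rewrite lee_fin; apply: ler_wpM2r; [exact: powR_ge0|exact: ler_pM u0 l0 (KUE e) (KLE e)].
by rewrite [(KA * _)%:E]EFinM -muleA; apply: lee_wpmul2l; [rewrite lee_fin|exact: band_norm].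
Qed.

Let cmeasurable_level (e : 'I_L) (j : nat) :
  cmeasurable (level_part (psi e) (tpsi e) f j%:Z (@inner_seq R n j)).
Proof. exact: (cmeasurable_level_part _ (bu e)). Qed.

Let cmeasurable_partial m1 m2 : cmeasurable (partial_sum psi tpsi f m1 m2).
Proof. by apply: cmfun_sum => e; apply: cmfun_sum => j; exact: cmeasurable_level. Qed.

Let tail_norm m1 m2 : (wLp_norm p w (partial_sum psi tpsi f m1 m2) <=
  (L%:R * (KA * (x2 ^+ m1 / (1 - x2) * C_band s M)))%:E * B)%E.
Proof.
have ml e : cmeasurable (fun x => \sum_(m1 <= j < m2)
    level_part (psi e) (tpsi e) f j%:Z (@inner_seq R n j) x).
  by apply: cmfun_sum => j; exact: cmeasurable_level.
apply: (le_trans (wLp_norm_sum p1 mw w0 _ ml)).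
apply: (@le_trans _ _ (\sum_(e < L) (KA * (x2 ^+ m1 / (1 - x2) * C_band s M))%:E * B)%E).
  apply: lee_sum => e _; apply: (le_trans (wLp_norm_sum p1 mw w0 _ (cmeasurable_level e))).
  apply: (@le_trans _ _ (\sum_(m1 <= j < m2) (KA * (x2 ^+ j * C_band s M))%:E * B)%E).
    by apply: lee_sum => j _; exact: level_norm.
  rewrite -ge0_sume_distrl; last first.
    by move=> j _; rewrite lee_fin; exact: mulr_ge0 KA0 (mulr_ge0 (exprn_ge0 j (ltW x20)) CB0).
  rewrite sumEFin lee_wpmul2r// lee_fin -mulr_sumr ler_wpM2l// -mulr_suml ler_wpM2r//.
  exact: geometric_tail (ltW x20) x21.
rewrite -ge0_sume_distrl; last first.
  move=> e _; rewrite lee_fin; apply: mulr_ge0 KA0 (mulr_ge0 _ CB0).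
  by rewrite divr_ge0 ?subr_ge0 ?(ltW x21)//; exact: exprn_ge0 (ltW x20).
rewrite sumEFin lee_wpmul2r// lee_fin sumr_const card_ord -[leLHS]mulr_natl.
by rewrite lexx.
Qed.

(** The inequality N <= 2L 2^(mn) raised to the power s/n. *)
Let threshold (N m : nat) : (1 <= N)%N -> (N < 2 * L * (2 ^ m) ^ n)%N ->
  x2 ^+ m <= (2 * L%:R) `^ (s / n%:R) * N%:R `^ (- (s / n%:R)).
Proof.
move=> N1 Nm; have n0 : 0 < n%:R :> R by rewrite ltr0n.
have sn0 : 0 <= s / n%:R by rewrite divr_ge0 ?ltW.
have N0 : 0 < N%:R :> R by rewrite ltr0n.
rewrite powRN ler_pdivlMr ?powR_gt0// /x2 powRN exprVn mulrC ler_pdivrMr ?exprn_gt0 ?powR_gt0//.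
have : N%:R <= 2 * L%:R * (2 ^+ m) ^+ n :> R by rewrite -!natrX -!natrM ler_nat ltnW.
move=> /(ge0_ler_powR sn0); rewrite !nnegrE => /(_ (ltW N0)).
rewrite !mulr_ge0 ?exprn_ge0// => /(_ isT) /le_trans; apply.
have L2 : 0 <= 2 * L%:R :> R by rewrite mulr_ge0.
have m2 : 0 <= (2 : R) ^+ m by exact: exprn_ge0.
rewrite (powRM _ L2 (exprn_ge0 n m2)) -exprM -(powR_mulrn _ (ler0n R 2)).
rewrite -(powR_mulrn _ (powR_ge0 _ _)) -!powRrM.
apply: le_of_eq; congr (_ * _ `^ _).
by rewrite natrM; field; rewrite gt_eqF.
Qed.

(** The approximant keeps all levels below [m]. The remainder is at most the truncation error at
    some large [J] plus the levels from [m] to [J], whose bound does not depend on [J]. *)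
Lemma nterm_bound_pos (N : nat) : (1 <= N)%N ->
  (nterm_error psi p w N f <=
    (prefactor n L s M * KU * KL * A `^ (2 / p) * N%:R `^ (- (s / n%:R)))%:E * B)%E.
Proof.
move=> N1; have [m [Nm mN]] := level_threshold N n_gt0 L_gt0.
have [La [c [LaN wE]]] := partial_sum_wcomb psi tpsi f m.
set bound := (_%:E * B)%E.
apply: (@le_trans _ _ (wLp_norm p w (fun x => f x - partial_sum psi tpsi f 0 m x))).
  apply: ereal_inf_lbound; exists La, c; split; first exact: leq_trans mN.
  by congr wLp_norm; apply/funext => x; rewrite wE.
apply/lee_addgt0Pr => eps eps0.
have [_ _ cv] := fB.
(* [J] is taken at least [m], so that the truncation contains every kept level. *)
have [J mJ eJ] : exists2 J : nat, (m <= J)%N &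
    (wLp_norm p w (fun x => truncation psi tpsi f J x - f x)%R <= eps%:E)%E.
  have [cf /cvgrPdist_lt/(_ _ eps0) ce] := (fine_cvgP _ _).1 cv.
  have [J0 _ HJ] := filterI cf ce.
  exists (maxn m J0); first exact: leq_maxl.
  have [] := HJ (maxn m J0) (leq_maxr _ _) => /= fin.
  rewrite sub0r normrN -{2}(fineK fin) => /ltW le; rewrite lee_fin.
  by rewrite (le_trans (ler_norm _)).
have -> : (fun x => f x - partial_sum psi tpsi f 0 m x) =
    (fun x => (f x - truncation psi tpsi f J x) + partial_sum psi tpsi f m J.+1 x).
  apply/funext => x; rewrite truncationE (partial_sum_cat psi tpsi f x (leqW mJ)).
  by rewrite opprD addrA subrK.
have mT : cmeasurable (fun x => f x - truncation psi tpsi f J x).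
  apply: cmfunB => //; have := cmeasurable_partial 0 J.+1.
  by congr cmfun; apply/funext => x; rewrite truncationE.
apply: (le_trans (wLp_normD p1 mw w0 mT (cmeasurable_partial m J.+1))).
rewrite addeC; apply: leeD; last first.
  suff -> : wLp_norm p w (fun x => f x - truncation psi tpsi f J x) =
      wLp_norm p w (fun x => truncation psi tpsi f J x - f x) by [].
  by rewrite /wLp_norm; under eq_integral do rewrite -cabsN opprB.
apply: (le_trans (tail_norm m J.+1)); apply: lee_wpmul2r => //; rewrite lee_fin.
have d0 : 0 < 1 - x2 by rewrite subr_gt0.
have := threshold N1 Nm; set y := x2 ^+ m; set T := (2 * L%:R) `^ _; set Nn := N%:R `^ _ => yle.
have -> : prefactor n L s M * KU * KL * A `^ (2 / p) * Nn =
    L%:R * (KA * (T * Nn / (1 - x2) * C_band s M)).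
  by rewrite /prefactor /KA -/x2 -/T; ring.
apply: ler_wpM2l => //; apply: ler_wpM2l => //; apply: ler_wpM2r => //.
by apply: ler_wpM2r => //; rewrite invr_ge0 ltW.
Qed.

End positive_weight_bound.

(** * Reduction to a weight that is positive everywhere *)

Section positive_version.
Context {R : realType} {n : nat}.
Local Notation V := 'rV[R]_n.
Local Notation mu := (@lebesgue_rV R n).
Local Notation C := R[i].
Variable w : V -> R.
Hypotheses (mw : measurable_fun setT w) (wp : {ae mu, forall x, 0 < w x}).

(* A weight is only positive almost everywhere; no norm sees the modification. *)
Definition positive_version (x : V) : R := if 0 < w x then w x else 1.
Local Notation w1 := positive_version.

Lemma positive_version_gt0 x : 0 < w1 x.
Proof. by rewrite /positive_version; case: ifP. Qed.

Lemma measurable_positive_version : measurable_fun setT w1.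
Proof. by apply: measurable_fun_ifT => //; exact: measurable_fun_ltr. Qed.

Let integral_positive (D : set V) (F : V -> R -> \bar R) : measurable D ->
  measurable_fun D (fun x => F x (w x)) -> measurable_fun D (fun x => F x (w1 x)) ->
  (\int[mu]_(x in D) F x (w x) = \int[mu]_(x in D) F x (w1 x))%E.
Proof.
move=> mD m1 m2; apply: ae_eq_integral => //.
apply: filterS wp => x wx _; congr (F x _).
by rewrite /positive_version wx.
Qed.

Lemma wLp_norm_positive (p : R) (f : V -> C) : cmeasurable f ->
  wLp_norm p w f = wLp_norm p w1 f.
Proof.
move=> mf; congr (_ `^ _)%E.
apply: (integral_positive (F := fun x t => (cabs (f x) `^ p * t)%:E)) => //.
- exact: measurable_wLp mw _ (measurable_cabs mf).
- exact: measurable_wLp measurable_positive_version _ (measurable_cabs mf).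
Qed.

Lemma average_positive (t : R) (Q : set V) : measurable Q ->
  average (fun x => w x `^ t) Q = average (fun x => w1 x `^ t) Q.
Proof.
move=> mQ; congr (_ * _)%E.
apply: (integral_positive (F := fun x t' => (t' `^ t)%:E)) => //; apply/measurable_EFinP;
  apply: measurable_funTS; apply: (measurableT_comp (measurable_powR t)) => //.
exact: measurable_positive_version.
Qed.

Lemma average_positive1 (Q : set V) : measurable Q -> average w Q = average w1 Q.
Proof.
move=> mQ; congr (_ * _)%E.
apply: (integral_positive (F := fun x t' => t'%:E)) => //; apply/measurable_EFinP;
  apply: measurable_funTS => //; exact: measurable_positive_version.
Qed.

Lemma Ap_const_positive (p : R) : Ap_const p w = Ap_const p w1.
Proof.
have E (x : V) (r : R) :
    (average w (cube x r) * average (fun y => w y `^ (- (p - 1)^-1))%R (cube x r) `^ (p - 1) =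
     average w1 (cube x r) * average (fun y => w1 y `^ (- (p - 1)^-1))%R (cube x r) `^ (p - 1))%E.
  by rewrite (average_positive1 (@measurable_cube R n x r)) (average_positive _ (@measurable_cube R n x r)).
rewrite /Ap_const; apply: (congr1 (@ereal_sup R)); apply/funext => e; apply/propext.
by split=> -[x [r [r0 eE]]]; exists x, r; move: eE; rewrite E.
Qed.

Lemma positive_version_Ap (p : R) : (Ap_const p w < +oo)%E ->
  exists2 A : R, Ap_const p w = A%:E & forall (c : V) (d : R), 0 < d ->
  (average w1 (cube c d) * average (fun y => w1 y `^ (- (p - 1)^-1))%R (cube c d) `^ (p - 1) <= A%:E)%E.
Proof.
move=> Aoo.
have ub (c : V) (d : R) : 0 < d ->
    (average w1 (cube c d) * average (fun y => w1 y `^ (- (p - 1)^-1))%R (cube c d) `^ (p - 1) <= Ap_const p w)%E.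
  by move=> d0; rewrite Ap_const_positive; apply: ereal_sup_ubound; exists c, d.
have A0 : (0 <= Ap_const p w)%E.
  apply: le_trans (ub 0 1 ltr01); rewrite mule_ge0 ?poweR_ge0// mule_ge0//.
    by rewrite lee_fin invr_ge0 fine_ge0.
  by apply: integral_ge0 => x _; rewrite lee_fin ltW// positive_version_gt0.
have AE : Ap_const p w = (fine (Ap_const p w))%:E by rewrite fineK// ge0_fin_numE.
by exists (fine (Ap_const p w)) => // c d d0; rewrite -AE; exact: ub.
Qed.

Section transfer.
Context {L : nat}.
Variables (psi tpsi : 'I_L -> V -> C) (phi : V -> C) (s p q : R) (f : V -> C).
Hypotheses (mpsi : forall e, cmeasurable (psi e)) (rphi : rapid phi) (mf : cmeasurable f).

Lemma besov_norm_positive :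
  besov_norm phi s p q w (dist_of f) = besov_norm phi s p q w1 (dist_of f).
Proof.
congr (_ `^ _)%E; apply: eq_esum => j _; rewrite wLp_norm_positive//.
exact: (cmeasurable_convf mf (rapid_lp_dilate j rphi)).
Qed.

Lemma besov_localized_positive :
  besov_localized psi tpsi phi s p q w f -> besov_localized psi tpsi phi s p q w1 f.
Proof.
move=> [[_ f1] [f2 f3] f4]; split.
- by split => //; rewrite -wLp_norm_positive.
- by split => //; rewrite -besov_norm_positive.
- suff -> : (fun J => wLp_norm p w1 (fun x => truncation psi tpsi f J x - f x)) =
      (fun J => wLp_norm p w (fun x => truncation psi tpsi f J x - f x)) by [].
  apply/funext => J; rewrite wLp_norm_positive//; apply: cmfunB => //.
  rewrite (funext (truncationE psi tpsi f J)).
  apply: cmfun_sum => e; apply: cmfun_sum => j; apply: cmfun_sum => k.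
  by apply: cmfunM; [exact: cmfun_cst|exact: cmeasurable_dilate].
Qed.

Lemma nterm_error_positive (N : nat) :
  nterm_error psi p w N f = nterm_error psi p w1 N f.
Proof.
have E La c : wLp_norm p w (fun x => f x - wcomb psi La c x) =
    wLp_norm p w1 (fun x => f x - wcomb psi La c x).
  apply: wLp_norm_positive; apply: cmfunB => //; apply: cmfun_sum => i.
  apply: cmfunM; first exact: cmfun_cst.
  exact: cmeasurable_dilate.
congr ereal_inf; apply/seteqP; split => e [La [c [LN ->]]]; exists La, c; split => //.
Qed.

End transfer.

End positive_version.

(** * Decay of the generators and assembly of the constants *)

Section generators.
Context {R : realType} {n : nat}.
Local Notation V := 'rV[R]_n.
Local Notation mu := (@lebesgue_rV R n).
Local Notation C := R[i].
Hypothesis n_gt0 : (1 <= n)%N.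
Implicit Types h : V -> C.

(** The decay quantities use the Euclidean norm and the envelopes the smaller maximum norm; a
    negative power makes the passage go the right way. *)
Lemma decay_max_norm h (D si : R) : 0 <= D -> 0 <= si ->
  (forall x, (1 + enorm x) `^ si * cabs (h x) <= D) ->
  forall z, cabs (h z) <= D * (1 + `|z|) `^ (- si).
Proof.
move=> D0 si0 hD z; rewrite (le_trans _ (ler_wpM2l D0 (le_enorm_norm z si0)))//.
by rewrite powRN -ler_pdivrMr ?invr_gt0 ?powR_gt0 ?weight_gt0// invrK mulrC.
Qed.

Lemma sup_weight_ge0 h (t : R) :
  (0 <= ereal_sup (range (fun x => ((1 + enorm x) `^ t * cabs (h x))%:E)))%E.
Proof.
apply: (@le_trans _ _ ((1 + enorm (0 : V)) `^ t * cabs (h 0))%:E).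
  by rewrite lee_fin mulr_ge0 ?powR_ge0 ?cabs_ge0.
by apply: ereal_sup_ubound; exists 0.
Qed.

Lemma sup_weight_le h (t : R) :
  (ereal_sup (range (fun x => ((1 + enorm x) `^ t * cabs (h x))%:E)) < +oo)%E ->
  forall x, (1 + enorm x) `^ t * cabs (h x) <=
    fine (ereal_sup (range (fun x => ((1 + enorm x) `^ t * cabs (h x))%:E))).
Proof.
move=> oo x; rewrite -lee_fin fineK; last by rewrite ge0_fin_numE// sup_weight_ge0.
by apply: ereal_sup_ubound; exists x.
Qed.

Lemma Mnorm_ge0 (tau : R) h : (0 <= Mnorm tau h)%E. Proof. exact: sup_weight_ge0. Qed.

Lemma Kkernel_ge0 (sigma : R) h : (0 <= Kkernel sigma h)%E. Proof. exact: sup_weight_ge0. Qed.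

Lemma Kkernel_lty (sigma : R) h : rapid h -> (Kkernel sigma h < +oo)%E.
Proof.
move=> rh; have [K hK] := rapid_powR sigma rh.
apply: (@le_lt_trans _ _ K%:E); last exact: ltry.
by apply: ge_ereal_sup => _ [x _ <-]; rewrite lee_fin.
Qed.

Lemma Dnorm_ge0 (sigma : R) h : (0 <= Dnorm sigma h)%E.
Proof.
by apply: integral_ge0 => x _; rewrite lee_fin mulr_ge0 ?cabs_ge0 ?addr_ge0 ?powR_ge0.
Qed.

Lemma Mnorm_decay (tau : R) h : 0 < tau -> (Mnorm tau h < +oo)%E ->
  forall z, cabs (h z) <= fine (Mnorm tau h) * (1 + `|z|) `^ (- (2 * n%:R + tau)).
Proof.
move=> t0 oo; have si0 : 0 <= 2 * n%:R + tau by rewrite addr_ge0 ?mulr_ge0// ltW.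
apply: decay_max_norm => //; first exact: fine_ge0 (Mnorm_ge0 _ _).
exact: sup_weight_le oo.
Qed.

Lemma Dnorm_weight_lty (sigma : R) h : 0 <= sigma -> cmeasurable h -> (Dnorm sigma h < +oo)%E ->
  (\int[mu]_y (cabs (h y) * (1 + enorm y) `^ sigma)%:E < +oo)%E.
Proof.
move=> s0 mh oo; have mc := measurable_cabs mh.
apply: (integral_scale_lty (powR_ge0 2 sigma) _ _ _ _ _ oo).
- by apply: measurable_funM => //; exact: measurable_weight.
- by apply: measurable_funM => //; exact: measurable_dnorm_weight.
- by move=> y; rewrite mulr_ge0 ?cabs_ge0 ?powR_ge0.
- by move=> y; rewrite mulr_ge0 ?cabs_ge0 ?addr_ge0 ?powR_ge0.
- by move=> y; rewrite mulrA mulrC ler_wpM2r ?cabs_ge0// weight_powR_le.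
Qed.

Lemma Dnorm_decay (a b sigma : R) h (Phi : V -> C) : 0 <= sigma -> band_limited a b h ->
  rapid Phi -> (forall xi, a <= enorm xi <= b -> fourier Phi xi = 1) ->
  (Dnorm sigma h < +oo)%E ->
  forall z, cabs (h z) <=
    2 `^ sigma * fine (Kkernel sigma Phi) * fine (Dnorm sigma h) * (1 + `|z|) `^ (- sigma).
Proof.
move=> s0 hb rP P1 oo.
have f0 : 0 <= 2 `^ sigma * fine (Kkernel sigma Phi) * fine (Dnorm sigma h).
  by rewrite !mulr_ge0 ?powR_ge0 ?fine_ge0 ?Kkernel_ge0 ?Dnorm_ge0.
apply: decay_max_norm => // x.
have := band_decay n_gt0 hb s0 rP P1 (sup_weight_le (Kkernel_lty sigma rP)) x.
have Df : Dnorm sigma h \is a fin_num by rewrite ge0_fin_numE// Dnorm_ge0.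
by rewrite -/(Kkernel sigma Phi) -{1}(fineK Df) -!EFinM lee_fin.
Qed.

End generators.

Section maxima.
Context {R : realType} {L : nat}.
Implicit Types F : 'I_L -> \bar R.

Lemma emax_ord_ge F e : (F e <= emax_ord F)%E.
Proof. exact: (le_bigmax (-oo)%E F e). Qed.

Lemma emax_ord_le F (x : \bar R) : (forall e, F e <= x)%E -> (emax_ord F <= x)%E.
Proof. by move=> H; apply: bigmax_le => //; exact: leNye. Qed.

Lemma emax_ord_lty F : (forall e, F e < +oo)%E -> (emax_ord F < +oo)%E.
Proof. by move=> H; rewrite /emax_ord; elim/big_ind: _ => // x y; rewrite gt_max => -> ->. Qed.

Lemma emax_ord_ge0 F : (1 <= L)%N -> (forall e, 0 <= F e)%E -> (0 <= emax_ord F)%E.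
Proof. by move=> L1 F0; apply: le_trans (emax_ord_ge F (Ordinal L1)). Qed.

Lemma emax_ord_fin F : (1 <= L)%N -> (forall e, 0 <= F e)%E -> (forall e, F e < +oo)%E ->
  emax_ord F = (fine (emax_ord F))%:E.
Proof. by move=> L1 F0 Foo; rewrite fineK// ge0_fin_numE ?emax_ord_ge0// emax_ord_lty. Qed.

End maxima.

(** 2/p <= 1/(p-1) holds exactly for p <= 2, and 2/p <= 1 for p >= 2. *)
Lemma theta_ge (R : realType) (p : R) : 1 < p -> 2 / p <= 2 * theta p.
Proof.
move=> p1; have p0 : 0 < p by rewrite (lt_trans _ p1).
rewrite /theta mulrA mulfV ?mul1r//.
rewrite le_max; case: (leP p 2) => p2; apply/orP; [right|left].
- by rewrite ler_pdivrMr// mulrC ler_pdivlMr ?subr_gt0//; lra.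
- by rewrite ler_pdivrMr// mul1r ltW.
Qed.

Lemma prefactor_ge0 (R : realType) (n L : nat) (s : R) (M : nat) : 0 < s ->
  0 <= prefactor n L s M.
Proof.
move=> s0; have s1 : 2 `^ (- s) <= 1 :> R.
  by rewrite -[leRHS](powRr0 2) ler_powR ?ler1n// oppr_le0 ltW.
rewrite /prefactor mulr_ge0//; last by apply: sumr_ge0 => i _; exact: powR_ge0.
by rewrite divr_ge0 ?subr_ge0// mulr_ge0 ?powR_ge0.
Qed.

Lemma zeta_factor_lty (R : realType) (g z : R) : 0 <= g -> 1 < z ->
  (0 <= 1 + (2 * g * 3 `^ (g - 1))%:E * zeta z < +oo)%E.
Proof.
move=> g0 z1; have z0 : (0 <= zeta z)%E.
  by apply: nneseries_ge0 => i _ _; rewrite lee_fin powR_ge0.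
have c0 : 0 <= 2 * g * 3 `^ (g - 1) by rewrite !mulr_ge0 ?powR_ge0.
rewrite adde_ge0 ?mule_ge0//= lte_add_pinfty ?ltry// lte_mul_pinfty ?lee_fin//.
exact: le_lt_trans (zeta_le z1) (ltry _).
Qed.

Theorem theorem1 (R : realType) (n L : nat)
    (psi tpsi : 'I_L -> 'rV[R]_n -> R[i]) (phi : 'rV[R]_n -> R[i])
    (a b A B A' B' c1 c2 tau sigma s p : R) :
  (1 <= n)%N -> (1 <= L)%N ->
  0 < a -> a < b ->
  biorthogonal_riesz_pair a b A B A' B' psi tpsi ->
  0 < c1 -> c1 < c2 -> lp_generator c1 c2 phi ->
  0 < tau -> 2 * n%:R < sigma ->
  (forall e, (Mnorm tau (psi e) < +oo)%E) ->
  (forall e, (Dnorm sigma (tpsi e) < +oo)%E) ->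
  0 < s -> 1 < p ->
  let M := band_depth a b c1 c2 in
  let C := C0 n p s M (fun e => envelope (psi e)) (fun e => envelope (tpsi e)) in
  (forall (q : R) (w : 'rV[R]_n -> R) (f : 'rV[R]_n -> R[i]) (N : nat),
    0 < q -> Ap p w -> besov_localized psi tpsi phi s p q w f -> (1 <= N)%N ->
    (nterm_error psi p w N f <=
       C * Ap_const p w `^ (2 / p) * (N%:R `^ (- (s / n%:R)))%:E
         * besov_norm phi s p q w (dist_of f))%E /\
    (C * Ap_const p w `^ (2 / p) * (N%:R `^ (- (s / n%:R)))%:E
         * besov_norm phi s p q w (dist_of f) <=
     C * Ap_const p w `^ (2 * theta p) * (N%:R `^ (- (s / n%:R)))%:E
         * besov_norm phi s p q w (dist_of f))%E) /\
  (forall Phi : 'rV[R]_n -> R[i],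
    schwartz Phi ->
    (forall xi, a <= enorm xi <= b -> fourier Phi xi = 1) ->
    let maj := C0_majorant n L p s M
      tau (emax_ord (fun e => Mnorm tau (psi e)))
      sigma (emax_ord (fun e => Dnorm sigma (tpsi e))) (Kkernel sigma Phi) in
    (C <= maj)%E /\ (maj < +oo)%E).
Proof.
move=> n1 L1 a0 ab [bl _ _ _ _] c10 c12 gphi tau0 nsi Mf Df s0 p1 M C.
have bu e : band_limited a b (psi e) by case: (bl e).
have bt e : band_limited a b (tpsi e) by case: (bl e).
have rphi : rapid phi by case: gphi => /schwartz_rapid.
have p0 : 0 < p by rewrite (lt_trans _ p1).
have si0 : 0 <= sigma by rewrite ltW// (le_lt_trans _ nsi)// mulr_ge0.
have Du0 e : 0 <= fine (Mnorm tau (psi e)) by exact: fine_ge0 (Mnorm_ge0 _ _).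
have hDu e := Mnorm_decay tau0 (Mf e).
have gU1 := gammaU_ge1 n1 p1; have gL1 := gammaL_ge1 n1 p1.
pose Dt (Phi : 'rV[R]_n -> R[i]) e := 2 `^ sigma * fine (Kkernel sigma Phi) * fine (Dnorm sigma (tpsi e)).
have Dt0 Phi e : 0 <= Dt Phi e.
  by rewrite /Dt !mulr_ge0 ?powR_ge0 ?fine_ge0 ?Kkernel_ge0 ?Dnorm_ge0.
(* Any rapidly decreasing kernel with transform 1 on the annulus yields decay of the dual
   generators: the error estimate takes the band kernel, the majorant the given [Phi]. *)
have rb := rapid_band_kernel a b gphi.
have fb := fourier_band_kernel n1 a0 ab c10 c12 gphi.
have hDt Phi (rP : rapid Phi) (P1 : forall xi, a <= enorm xi <= b -> fourier Phi xi = 1) e :=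
  Dnorm_decay n1 si0 (bt e) rP P1 (Df e).
have mpsi e : cmeasurable (psi e) by apply: cmeasurable_continuous; case: (bu e).
have mtpsi e : cmeasurable (tpsi e) by apply: cmeasurable_continuous; case: (bt e).
have layU e := decay_layers n1 (Du0 e) gU1 (gammaU_lt p1 tau0) (hDu e).
have layL e := decay_layers n1 (Dt0 _ e) gL1 (gammaL_lt p1 nsi) (hDt _ rb fb e).
pose FU e := envelope_series (gammaU n p) (envelope (psi e)).
pose FL e := envelope_series (gammaL n p) (envelope (tpsi e)).
have FUE e : FU e = (layer_const (gammaU n p) (psi e))%:E by case: (layU e).
have FLE e : FL e = (layer_const (gammaL n p) (tpsi e))%:E by case: (layL e).
have FU0 e : (0 <= FU e)%E by rewrite FUE lee_fin; case: (layU e).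
have FL0 e : (0 <= FL e)%E by rewrite FLE lee_fin; case: (layL e).
have [KU KUE] : exists K : R, emax_ord FU = K%:E.
  exists (fine (emax_ord FU)); apply: (emax_ord_fin L1 FU0) => e.
  by rewrite FUE; exact: ltry.
have [KL KLE] : exists K : R, emax_ord FL = K%:E.
  exists (fine (emax_ord FL)); apply: (emax_ord_fin L1 FL0) => e.
  by rewrite FLE; exact: ltry.
have pre0 : 0 <= prefactor n L s M := prefactor_ge0 n L M s0.
have KU0 : 0 <= KU by rewrite -lee_fin -KUE; exact: emax_ord_ge0 L1 FU0.
have KL0 : 0 <= KL by rewrite -lee_fin -KLE; exact: emax_ord_ge0 L1 FL0.
have CE' : C = ((prefactor n L s M)%:E * emax_ord FU * emax_ord FL)%E by [].
have CE : C = (prefactor n L s M * KU * KL)%:E by rewrite CE' KUE KLE.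
have C0 : (0 <= C)%E by rewrite CE lee_fin; exact: mulr_ge0 (mulr_ge0 pre0 KU0) KL0.
split.
  move=> q w f N q0 [[mw wp _] Aoo] fB N1.
  have mf : cmeasurable f by case: fB => -[].
  have [W WE hW] := positive_version_Ap mw wp Aoo.
  have w10 := positive_version_gt0 w; have mw1 := measurable_positive_version mw.
  rewrite (nterm_error_positive mw wp p mpsi mf) (besov_norm_positive mw wp s p q rphi mf).
  have fB1 := besov_localized_positive mw wp mpsi rphi mf fB.
  rewrite WE !poweR_EFin; split.
    have := nterm_bound_pos n1 L1 p1 mw1 w10 hW a0 ab c10 c12 gphi tau0 nsi s0 q0 Du0 (Dt0 _) bu bt
      hDu (hDt _ rb fb) (fun e => Dnorm_weight_lty si0 (mtpsi e) (Df e))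
      (KU := KU) (KL := KL) _ _ fB1 N1.
    rewrite CE -!EFinM; apply.
    - by move=> e; rewrite -lee_fin -KUE -FUE emax_ord_ge.
    - by move=> e; rewrite -lee_fin -KLE -FLE emax_ord_ge.
  apply: lee_wpmul2r; first exact: besov_norm_ge0.
  apply: lee_wpmul2r; first by rewrite lee_fin powR_ge0.
  (* The exponent may grow from 2/p to 2 theta(p) because the A_p constant is at least 1. *)
  apply: lee_wpmul2l => //; rewrite lee_fin ler_powR ?theta_ge//.
  exact: Ap_const_ge1 p1 mw1 w10 hW.
move=> Phi sP P1 maj; have rP := schwartz_rapid sP.
have zU : (0 <= 1 + (2 * gammaU n p * 3 `^ (gammaU n p - 1))%:E * zeta (1 + tau + n%:R / p) < +oo)%E.
  apply: zeta_factor_lty; first by rewrite (le_trans ler01).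
  by rewrite -addrA ltrDl ltr_wpDr// divr_ge0// ltW.
have zL : (0 <= 1 + (2 * gammaL n p * 3 `^ (gammaL n p - 1))%:E * zeta (1 + sigma - n%:R - n%:R / p) < +oo)%E.
  apply: zeta_factor_lty; first by rewrite (le_trans ler01).
  by have := gammaL_lt p1 nsi; rewrite /gammaL; lra.
have Kf : Kkernel sigma Phi \is a fin_num by rewrite ge0_fin_numE ?Kkernel_ge0// Kkernel_lty.
have M0 : (0 <= emax_ord (fun e => Mnorm tau (psi e)))%E.
  by apply: emax_ord_ge0 => // e; exact: Mnorm_ge0.
have D0 : (0 <= emax_ord (fun e => Dnorm sigma (tpsi e)))%E.
  by apply: emax_ord_ge0 => // e; exact: Dnorm_ge0.
have K0 : (0 <= (2 `^ sigma)%:E * Kkernel sigma Phi)%E.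
  by rewrite mule_ge0 ?lee_fin ?powR_ge0 ?Kkernel_ge0.
have [zU0 zUoo] := andP zU; have [zL0 zLoo] := andP zL.
have tn0 : 0 < 2 * n%:R + tau by rewrite ltr_wpDl// mulr_ge0.
have sn0 : 0 < sigma by rewrite (le_lt_trans _ nsi)// mulr_ge0.
have Mfin e : Mnorm tau (psi e) = (fine (Mnorm tau (psi e)))%:E.
  by rewrite fineK// ge0_fin_numE// Mnorm_ge0.
have Dfin e : Dnorm sigma (tpsi e) = (fine (Dnorm sigma (tpsi e)))%:E.
  by rewrite fineK// ge0_fin_numE// Dnorm_ge0.
split.
  rewrite CE' /maj /C0_majorant; apply: lee_pmul.
  - by rewrite KUE -EFinM lee_fin; exact: mulr_ge0 pre0 KU0.
  - by rewrite KLE lee_fin.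
  - apply: lee_wpmul2l; rewrite ?lee_fin//; apply: emax_ord_le => e.
    have := envelope_series_le gU1 (Du0 e) (envr_ge0 n1 (Du0 e) tn0 (hDu e))
      (envr_anti n1 (Du0 e) tn0 (hDu e)) (envr0 n1 (Du0 e) tn0 (hDu e)) (envrS n1 (Du0 e) tn0 (hDu e)).
    rewrite -(envelopeE n1 (Du0 e) tn0 (hDu e)) -Mfin => /le_trans; apply.
    (* The argument of zeta simplifies because n - n/p' = n/p. *)
    rewrite (_ : 1 + (2 * n%:R + tau) - gammaU n p = 1 + tau + n%:R / p).
      by apply: lee_wpmul2r => //; exact: (emax_ord_ge (fun e => Mnorm tau (psi e))).
    by rewrite /gammaU /conjugate_exponent; field; rewrite subr_eq0 (gt_eqF p0) (gt_eqF p1).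
  - apply: emax_ord_le => e; have hD := hDt _ rP P1 e.
    have := envelope_series_le gL1 (Dt0 Phi e) (envr_ge0 n1 (Dt0 Phi e) sn0 hD)
      (envr_anti n1 (Dt0 Phi e) sn0 hD) (envr0 n1 (Dt0 Phi e) sn0 hD) (envrS n1 (Dt0 Phi e) sn0 hD).
    rewrite -(envelopeE n1 (Dt0 Phi e) sn0 hD) => /le_trans; apply.
    rewrite (_ : 1 + sigma - gammaL n p = 1 + sigma - n%:R - n%:R / p); last by rewrite /gammaL; ring.
    apply: lee_wpmul2r => //; rewrite /Dt !EFinM fineK// -Dfin.
    by apply: lee_wpmul2l => //; exact: (emax_ord_ge (fun e => Dnorm sigma (tpsi e))).
have ME : emax_ord (fun e => Mnorm tau (psi e)) = (fine (emax_ord (fun e => Mnorm tau (psi e))))%:E.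
  by apply: emax_ord_fin => // e; exact: Mnorm_ge0.
have DE : emax_ord (fun e => Dnorm sigma (tpsi e)) = (fine (emax_ord (fun e => Dnorm sigma (tpsi e))))%:E.
  by apply: emax_ord_fin => // e; exact: Dnorm_ge0.
rewrite /maj /C0_majorant /= ME DE -(fineK Kf).
move: zU0 zUoo zL0 zLoo; set ZU := (1 + _ * zeta (1 + tau + _))%E; set ZL := (1 + _ * zeta _)%E.
move=> zU0 zUoo zL0 zLoo.
have -> : ZU = (fine ZU)%:E by rewrite fineK// ge0_fin_numE.
have -> : ZL = (fine ZL)%:E by rewrite fineK// ge0_fin_numE.
by rewrite -!EFinM ltry.
Qed.
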